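(* Let $R\ge0$ be an integer, $V_1\in\mathcal{O}(\tilde{\mathcal{U}}_q(\hat{\mathfrak{g}}))$ and $V_2\in\mathcal{O}^R(\tilde{\mathcal{U}}_q'(\hat{\mathfrak{g}}))$. Then the formulas of $\Delta_u$ define a structure of $\tilde{\mathcal{U}}_q'(\hat{\mathfrak{g}})$-module on $i(V_1)\otimes_{\mathcal{C}}V_2$, and this module is in $\mathcal{O}^{R+1}(\tilde{\mathcal{U}}_q'(\hat{\mathfrak{g}}))$. Moreover the $l,u$-weights of $i(V_1)\otimes_{\mathcal{C}}V_2$ are of the form $(\lambda_1+\lambda_2,\gamma_1(z)\gamma_2(uz))$ where $(\lambda_1,\gamma_1)$ is an $l$-weight of $V_1$ and $(\lambda_2,\gamma_2)$ is an $l,u$-weight of $V_2$. Here $\gamma(u)(z)=\gamma_1(z)\gamma_2(uz)$ means $\gamma_{i,\pm m}^{\pm}(u)=\sum_{0\le l\le m}(\gamma_1)_{i,\pm l}^{\pm}\,(\gamma_2)_{i,\pm(m-l)}^{\pm}(u)\,u^{\pm(m-l)}$ for $i\in I,m\ge0$.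
   Context: $q\in\mathbb{C}^*$ is not a root of unity; a logarithm of $q$ is fixed so that $q^a$ makes sense for $a\in\mathbb{Q}$. $C=(C_{i,j})_{i,j\in I}$, $I=\{1,\dots,n\}$, is a generalized Cartan matrix: $C_{i,j}\in\mathbb{Z}$, $C_{i,i}=2$, $C_{i,j}\le 0$ for $i\neq j$, $C_{i,j}=0\Leftrightarrow C_{j,i}=0$. It is symmetrizable: positive integers $r_1,\dots,r_n$ are fixed such that $B=(B_{i,j})$, $B_{i,j}=r_iC_{i,j}$, is symmetric. $q_i=q^{r_i}$, $[m]_z=\frac{z^m-z^{-m}}{z-z^{-1}}$. A realization of $C$ is fixed: $\mathfrak{h}$ is a $\mathbb{Q}$-vector space of dimension $2n-\mathrm{rank}(C)$, with linearly independent families $\alpha_1,\dots,\alpha_n\in\mathfrak{h}^*$ and $\alpha_1^\vee,\dots,\alpha_n^\vee\in\mathfrak{h}$ satisfying $\alpha_j(\alpha_i^\vee)=C_{i,j}$. For $\lambda\in\mathfrak{h}^*$, $D(\lambda)=\{\omega\in\mathfrak{h}^*:\lambda-\omega\in\sum_i\mathbb{N}\alpha_i\}$. $\tilde{\mathcal{U}}_q(\hat{\mathfrak{g}})$ is the $\mathbb{C}$-algebra with generators $x_{i,r}^{\pm}$ ($i\in I,r\in\mathbb{Z}$), $k_h$ ($h\in\mathfrak{h}$), $h_{i,m}$ ($i\in I$, $m\in\mathbb{Z}\setminus\{0\}$) and relations (R1) $k_hk_{h'}=k_{h+h'}$, $k_0=1$, $[k_h,h_{j,m}]=0$, $[h_{i,m},h_{j,m'}]=0$;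 (R2) $k_hx_{j,r}^{\pm}k_{-h}=q^{\pm\alpha_j(h)}x_{j,r}^{\pm}$; (R3) $[h_{i,m},x_{j,r}^{\pm}]=\pm\frac1m[mB_{i,j}]_q\,x_{j,m+r}^{\pm}$; (R4) $[x_{i,r}^+,x_{j,r'}^-]=\delta_{i,j}\frac{\phi^+_{i,r+r'}-\phi^-_{i,r+r'}}{q_i-q_i^{-1}}$; (R5) $x_{i,r+1}^{\pm}x_{j,r'}^{\pm}-q^{\pm B_{i,j}}x_{j,r'}^{\pm}x_{i,r+1}^{\pm}=q^{\pm B_{i,j}}x_{i,r}^{\pm}x_{j,r'+1}^{\pm}-x_{j,r'+1}^{\pm}x_{i,r}^{\pm}$. Here $\phi_{i,m}^{\pm}$ is defined by $\sum_{m\ge0}\phi_{i,\pm m}^{\pm}z^{\pm m}=k_{\pm r_i\alpha_i^\vee}\exp\big(\pm(q-q^{-1})\sum_{m'\ge1}h_{i,\pm m'}z^{\pm m'}\big)$, with $\phi^+_{i,m}=0$ for $m<0$ and $\phi^-_{i,m}=0$ for $m>0$. $\mathcal{C}=\mathbb{C}((u))$ and $\tilde{\mathcal{U}}_q'(\hat{\mathfrak{g}})=\mathcal{C}\otimes_{\mathbb{C}}\tilde{\mathcal{U}}_q(\hat{\mathfrak{g}})$. $\Delta_u$ is the $\mathcal{C}$-algebra morphism $\tilde{\mathcal{U}}_q'(\hat{\mathfrak{g}})\to(\tilde{\mathcal{U}}_q(\hat{\mathfrak{g}})\otimes_{\mathbb{C}}\tilde{\mathcal{U}}_q(\hat{\mathfrak{g}}))((u))$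 given by $\Delta_u(x_{i,r}^+)=x_{i,r}^+\otimes1+\sum_{l\ge0}u^{r+l}(\phi_{i,-l}^-\otimes x_{i,r+l}^+)$, $\Delta_u(x_{i,r}^-)=u^r(1\otimes x_{i,r}^-)+\sum_{l\ge0}u^l(x_{i,r-l}^-\otimes\phi_{i,l}^+)$, $\Delta_u(\phi_{i,\pm m}^{\pm})=\sum_{0\le l\le m}u^{\pm l}(\phi_{i,\pm(m-l)}^{\pm}\otimes\phi_{i,\pm l}^{\pm})$, $\Delta_u(k_h)=k_h\otimes k_h$. That these formulas define a module structure means that the infinite sums, applied to vectors, converge $u$-adically in the (finite dimensional over $\mathcal{C}$) weight spaces and the resulting operators satisfy the relations of $\tilde{\mathcal{U}}_q'(\hat{\mathfrak{g}})$. $V_\omega=\{v:k_h.v=q^{\omega(h)}v\ \forall h\}$. $\mathcal{O}(\tilde{\mathcal{U}}_q(\hat{\mathfrak{g}}))$ is the category of $\tilde{\mathcal{U}}_q(\hat{\mathfrak{g}})$-modules $V$ (over $\mathbb{C}$) with $V=\bigoplus_{\omega\in\mathfrak{h}^*}V_\omega$, $\dim V_\omega<\infty$, and weights contained in a finite union of sets $D(\lambda_j)$. An $l$-weight is a pair $(\lambda,\Psi)$, $\lambda\in\mathfrak{h}^*$, $\Psi=(\Psi_{i,\pm m}^{\pm})_{i\in I,m\ge0}$ complex numbers with $\Psi_{i,0}^{\pm}=q_i^{\pm\lambda(\alpha_i^\vee)}$; it is an $l$-weight of $V$ if $V_{\lambda,\Psi}=\{x\in V_\lambda:\exists p\ \forall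 i\ \forall m\ge0,(\phi_{i,\pm m}^{\pm}-\Psi_{i,\pm m}^{\pm})^p.x=0\}\ne0$. For $V\in\mathcal{O}(\tilde{\mathcal{U}}_q(\hat{\mathfrak{g}}))$, $i(V)=V\otimes_{\mathbb{C}}\mathcal{C}$. $P_{l,u}$ is the set of pairs $(\lambda,\Psi(u))$ ($l,u$-weights) with $\lambda\in\mathfrak{h}^*$, $\Psi(u)=(\Psi_{i,\pm m}^{\pm}(u))_{i\in I,m\ge0}$, $\Psi_{i,\pm m}^{\pm}(u)\in\mathbb{C}[u,u^{-1}]$, $\Psi_{i,0}^{\pm}(u)=q_i^{\pm\lambda(\alpha_i^\vee)}$. $\mathcal{O}(\tilde{\mathcal{U}}_q'(\hat{\mathfrak{g}}))$ is the category of $\tilde{\mathcal{U}}_q'(\hat{\mathfrak{g}})$-modules $V$ ($\mathcal{C}$-vector spaces) such that i) $V=\bigoplus_\omega V_\omega$; ii) each $V_\lambda$ is finite dimensional over $\mathcal{C}$; iii) the weights lie in a finite union of sets $D(\lambda_j)$; iv) $V_\lambda=\bigoplus_{(\lambda,\Psi(u))\in P_{l,u}}V_{\lambda,\Psi(u)}$, where $V_{\lambda,\Psi(u)}=\{x\in V_\lambda:\exists p\in\mathbb{N}\ \forall i\ \forall r\ge0,(\phi_{i,\pm r}^{\pm}-\Psi_{i,\pm r}^{\pm}(u))^p.x=0\}$. The $l,u$-weights of $V$ are those with $V_{\lambda,\Psi(u)}\neq0$. $\mathcal{O}^R(\tilde{\mathcal{U}}_q'(\hat{\mathfrak{g}}))$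 is the category of $V\in\mathcal{O}(\tilde{\mathcal{U}}_q'(\hat{\mathfrak{g}}))$ such that for every $\lambda\in\mathfrak{h}^*$ there is a $\mathcal{C}$-basis $(v_\alpha^\lambda)_\alpha$ of $V_\lambda$ satisfying, for all $i\in I$: i) for all $m\in\mathbb{Z}$, $\alpha,\beta$, the coefficient of $x_{i,m}^+.v_\alpha^\lambda$ on $v_\beta^{\lambda+\alpha_i}$ (resp. of $x_{i,m}^-.v_\alpha^\lambda$ on $v_\beta^{\lambda-\alpha_i}$) is in $\mathbb{C}[[u]]$ if $m\ge0$ and in $u^{Rm}\mathbb{C}[[u]]$ if $m\le0$; ii) for all $m\ge0$, $\alpha,\beta$, the coefficient of $\phi_{i,-m}^-.v_\alpha^\lambda$ on $v_\beta^\lambda$ is in $u^{-mR}\mathbb{C}[[u]]$; iii) for all $m\ge0$, $\alpha,\beta$, the coefficient of $\phi_{i,m}^+.v_\alpha^\lambda$ on $v_\beta^\lambda$ is in $\mathbb{C}[[u]]$. *)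

(* Defs.v *)
(* Based on MathComp and MathComp-Analysis.  The complex numbers are R[i] for an
   arbitrary R : realType. *)
From HB Require Import structures.
From mathcomp Require Import all_boot all_order all_algebra.
From mathcomp Require Import boolp classical_sets functions cardinality fsbigop.
From mathcomp Require Import zify generic_quotient.
From mathcomp Require Import reals sequences exp trigo complex.

Set Implicit Arguments.
Unset Strict Implicit.
Unset Printing Implicit Defensive.

Import Order.TTheory GRing.Theory Num.Theory.

Local Open Scope ring_scope.
Local Open Scope classical_set_scope.
Local Open Scope quotient_scope.
Local Open Scope complex_scope.

Definition bounded_below (K : fieldType) : {pred int -> K} :=
  fun f => `[< exists N : int, forall n, n < N -> f n = 0 >].

(* K((u)) as coefficient families over int with support bounded below. *)
Record laurent (K : fieldType) := Laurent {
  lcoef :> int -> K;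
  lcoefP : lcoef \in @bounded_below K }.

HB.instance Definition _ (K : fieldType) := [isSub for @lcoef K].
HB.instance Definition _ (K : fieldType) := [Choice of laurent K by <:].

Section LaurentTheory.
Variable K : fieldType.

Lemma bounded_belowP (f : int -> K) :
  reflect (exists N : int, forall n, n < N -> f n = 0) (f \in @bounded_below K).
Proof. exact: asboolP. Qed.

Fact bounded_below_zmod : zmod_closed (@bounded_below K).
Proof.
split; first by apply/bounded_belowP; exists 0.
move=> f g /bounded_belowP[M fM] /bounded_belowP[N gN].
apply/bounded_belowP; exists (Num.min M N) => n; rewrite lt_min => /andP[nM nN].
by rewrite addrfctE opprfctE fM// gN// subr0.
Qed.
HB.instance Definition _ :=
  GRing.isZmodClosed.Build (int -> K) (@bounded_below K) bounded_below_zmod.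
HB.instance Definition _ := [SubChoice_isSubZmodule of laurent K by <:].

Lemma laurentP (f g : laurent K) : (forall n, f n = g n) -> f = g.
Proof. by move=> fg; apply/val_inj/funext. Qed.

Lemma coefLD (f g : laurent K) n : (f + g) n = f n + g n.
Proof. by []. Qed.

Fact lscale_subproof c (f : laurent K) : (fun n => c * f n) \in @bounded_below K.
Proof.
have /bounded_belowP[N fN] := lcoefP f.
by apply/bounded_belowP; exists N => n /fN->; rewrite mulr0.
Qed.
Definition lscale c (f : laurent K) := Laurent (lscale_subproof c f).

Fact lscaleA a b f : lscale a (lscale b f) = lscale (a * b) f.
Proof. by apply: laurentP => n /=; rewrite mulrA. Qed.
Fact lscale1 : left_id 1 lscale.
Proof. by move=> f; apply: laurentP => n /=; rewrite mul1r. Qed.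
Fact lscaleDr : right_distributive lscale +%R.
Proof. by move=> a f g; apply: laurentP => n; rewrite coefLD /= mulrDr. Qed.
Fact lscaleDl f : {morph lscale^~ f : a b / a + b}.
Proof. by move=> a b; apply: laurentP => n; rewrite coefLD /= mulrDl. Qed.
HB.instance Definition _ := GRing.Zmodule_isLmodule.Build K (laurent K)
  lscaleA lscale1 lscaleDr lscaleDl.

Lemma coefLZ c (f : laurent K) n : (c *: f) n = c * f n.
Proof. by []. Qed.

Lemma coefL0 n : (0 : laurent K) n = 0.
Proof. by []. Qed.

(* The sum is finitely supported when f and g have support bounded below;
   \sum_(_ \in _) is 0 otherwise. *)
Definition lconv (f g : int -> K) (n : int) : K :=
  \sum_(k \in [set: int]) f k * g (n - k).

Let lb (a : int) (f : int -> K) := forall n, n < a -> f n = 0.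

Lemma lconvE f g a b (m : nat) : lb a f -> lb b g ->
  lconv f g (a + b + m%:Z) = \sum_(j < m.+1) f (a + j%:Z) * g (b + (m - j)%:Z).
Proof.
move=> fa gb; rewrite /lconv.
pose r : seq int := [seq a + i%:Z | i <- iota 0 m.+1].
have ur : uniq r by rewrite map_inj_uniq ?iota_uniq// => i j /addrI[].
rewrite -(@fsbig_widen _ _ _ _ [set` r]) //.
- rewrite -fsbig_seq // big_map -val_enum_ord big_map big_enum /=.
  apply: eq_bigr => j _; congr (_ * g _).
  by rewrite -subzn ?leq_ord//; lia.
- move=> k [_ /= /negP kr].
  have [/fa->|ak] := ltrP k a; first by rewrite mul0r.
  rewrite gb ?mulr0// ltNge; apply: contra kr => kb.
  apply/mapP; exists `|k - a|%N; last by lia.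
  by rewrite mem_iota; lia.
Qed.

Lemma lconv_lb f g a b : lb a f -> lb b g -> lb (a + b) (lconv f g).
Proof.
move=> fa gb n nab; rewrite /lconv fsbig1// => k _.
have [/fa->|ak] := ltrP k a; first by rewrite mul0r.
by rewrite gb ?mulr0//; lia.
Qed.

Lemma lconvP (f g : laurent K) : lconv f g \in @bounded_below K.
Proof.
have /bounded_belowP[a fa] := lcoefP f; have /bounded_belowP[b gb] := lcoefP g.
by apply/bounded_belowP; exists (a + b); apply: lconv_lb.
Qed.

Definition laurent_mul (f g : laurent K) := Laurent (lconvP f g).

Definition lconst_fun (c : K) : int -> K := fun n => if n == 0 then c else 0.

Lemma lconst_funP c : lconst_fun c \in @bounded_below K.
Proof. by apply/bounded_belowP; exists 0 => n; rewrite /lconst_fun; case: ltgtP. Qed.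

Definition lconst (c : K) : laurent K := Laurent (lconst_funP c).

Let trunc (a : int) (f : int -> K) N := \poly_(i < N) f (a + i%:Z).

Lemma lconv_trunc f g a b (m N : nat) : lb a f -> lb b g -> (m < N)%N ->
  lconv f g (a + b + m%:Z) = (trunc a f N * trunc b g N)`_m.
Proof.
move=> fa gb mN; rewrite (lconvE _ fa gb) coefM; apply: eq_bigr => j _.
by rewrite !coef_poly !ifT//; have := ltn_ord j; lia.
Qed.

Let coefM_low (p p' q q' : {poly K}) m :
  (forall j, (j <= m)%N -> p`_j = p'`_j) ->
  (forall j, (j <= m)%N -> q`_j = q'`_j) -> (p * q)`_m = (p' * q')`_m.
Proof.
move=> pp qq; rewrite !coefM; apply: eq_bigr => j _.
by rewrite pp ?leq_ord// qq// leq_subr.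
Qed.

Let intD (a n : int) : (n < a) \/ exists m : nat, n = a + m%:Z.
Proof.
by have [?|an] := ltrP n a; [left | right; exists `|n - a|%N; lia].
Qed.

Fact laurent_mulA : associative laurent_mul.
Proof.
move=> f g h; apply: laurentP => n /=.
have /bounded_belowP[a fa] := lcoefP f; have /bounded_belowP[b gb] := lcoefP g.
have /bounded_belowP[c hc] := lcoefP h.
have fgl := lconv_lb fa gb; have ghl := lconv_lb gb hc.
have [nl|[m ->]] := intD (a + b + c) n.
  by rewrite (lconv_lb fa ghl) ?(lconv_lb fgl hc)// addrA.
rewrite (lconv_trunc fgl hc (ltnSn m)) -(addrA a b c).
rewrite (lconv_trunc fa ghl (ltnSn m)).
transitivity ((trunc a f m.+1 * trunc b g m.+1 * trunc c h m.+1)`_m).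
  rewrite -mulrA; apply: coefM_low => // j jm.
  by rewrite coef_poly ltnS jm (lconv_trunc gb hc (_ : j < m.+1)%N).
apply: coefM_low => // j jm.
by rewrite coef_poly ltnS jm (lconv_trunc fa gb (_ : j < m.+1)%N).
Qed.

Fact laurent_mulC : commutative laurent_mul.
Proof.
move=> f g; apply: laurentP => n /=.
have /bounded_belowP[a fa] := lcoefP f; have /bounded_belowP[b gb] := lcoefP g.
have [nl|[m ->]] := intD (a + b) n.
  by rewrite (lconv_lb fa gb)// (lconv_lb gb fa)// addrC.
by rewrite (lconv_trunc fa gb (ltnSn m)) (addrC a) (lconv_trunc gb fa (ltnSn m)) mulrC.
Qed.

Lemma lconst_mulE c (f : laurent K) : laurent_mul (lconst c) f = c *: f.
Proof.
apply: laurentP => n; rewrite coefLZ.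
change (lconv (lconst_fun c) f n = c * f n).
have /bounded_belowP[a fa] := lcoefP f.
have cl : lb 0 (lconst_fun c) by move=> k; rewrite /lconst_fun; case: ltgtP.
have [nl|[m ->]] := intD a n.
  by rewrite (lconv_lb cl fa) ?add0r// fa// mulr0.
rewrite -{1}[a]add0r (lconvE _ cl fa) big_ord_recl big1 ?addr0.
  by rewrite subn0 /lconst_fun ?addr0 eqxx.
by move=> i _; rewrite /lconst_fun add0r /= mul0r.
Qed.

Fact laurent_mul1 : left_id (lconst 1) laurent_mul.
Proof. by move=> f; rewrite lconst_mulE scale1r. Qed.

Fact laurent_mulDl : left_distributive laurent_mul +%R.
Proof.
move=> f g h; apply: laurentP => n.
have /bounded_belowP[a fa] := lcoefP f; have /bounded_belowP[b gb] := lcoefP g.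
have /bounded_belowP[c hc] := lcoefP h.
pose d := Num.min a b.
have fd : lb d f by move=> k kd; apply: fa; move: kd; rewrite /d; lia.
have gd : lb d g by move=> k kd; apply: gb; move: kd; rewrite /d; lia.
have sd : lb d (f + g : laurent K) by move=> k kd; rewrite coefLD fd ?gd ?addr0.
rewrite coefLD.
change (lconv (f + g : laurent K) h n = lconv f h n + lconv g h n).
have [nl|[m ->]] := intD (d + c) n.
  by rewrite (lconv_lb sd hc) ?(lconv_lb fd hc) ?(lconv_lb gd hc) ?addr0.
rewrite (lconvE _ sd hc) (lconvE _ fd hc) (lconvE _ gd hc) -big_split.
by apply: eq_bigr => j _; rewrite coefLD mulrDl.
Qed.

Fact laurent_1neq0 : lconst 1 != 0 :> laurent K.
Proof.
apply/eqP => /(congr1 (fun f : laurent K => f 0)).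
by rewrite coefL0 /= /lconst_fun eqxx => /eqP; rewrite oner_eq0.
Qed.

HB.instance Definition _ := GRing.Zmodule_isComNzRing.Build (laurent K)
  laurent_mulA laurent_mulC laurent_mul1 laurent_mulDl laurent_1neq0.

(* First n coefficients of the inverse of the power series with coefficients
   F 0, F 1, etc. *)
Fixpoint pinv_seq (F : nat -> K) (n : nat) : seq K :=
  if n is m.+1 then
    let s := pinv_seq F m in
    rcons s ((F 0)^-1 * ((m == 0)%:R - \sum_(j < m) F (m - j)%N * s`_j))
  else [::].

Let size_pinv F n : size (pinv_seq F n) = n.
Proof. by elim: n => //= n IH; rewrite size_rcons IH. Qed.

Let pinv_nth F n j : (j < n)%N -> (pinv_seq F n)`_j = (pinv_seq F j.+1)`_j.
Proof.
elim: n => // n IH; rewrite ltnS leq_eqVlt => /orP[/eqP->//|jn].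
by rewrite [LHS]/= nth_rcons size_pinv jn IH.
Qed.

Let pinvP F n : F 0%N != 0 ->
  \sum_(j < n.+1) F (n - j)%N * (pinv_seq F j.+1)`_j = (n == 0)%:R.
Proof.
move=> F0; rewrite big_ord_recr /= subnn nth_rcons size_pinv ltnn eqxx mulVKf//.
rewrite addrC -[RHS](subrK (\sum_(j < n) F (n - j)%N * (pinv_seq F n)`_j)).
by congr (_ + _); apply: eq_bigr => j _; rewrite (pinv_nth _ (ltn_ord j)).
Qed.

Lemma laurent_lead (f : laurent K) : f != 0 ->
  exists2 a : int, f a != 0 & forall n, n < a -> f n = 0.
Proof.
move=> f0; have /bounded_belowP[b fb] := lcoefP f.
have ex : exists m : nat, f (b + m%:Z) != 0.
  apply: contrapT => /forallNP all0; move/eqP: f0; apply; apply: laurentP => n.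
  have [/fb->//|[m ->]] := intD b n.
  by apply/eqP/negPn/negP; apply: all0.
case: (ex_minnP ex) => m fm min; exists (b + m%:Z) => // n nm.
have [/fb->//|[k nE]] := intD b n; apply/eqP/negPn/negP; rewrite nE => /min.
by move: nm; rewrite nE; lia.
Qed.

Lemma laurent_inv_ex (f : laurent K) : exists g : laurent K,
  if f == 0 then g = 0 else g * f = 1.
Proof.
have [f0|f0] := boolP (f == 0); first by exists 0.
have [a fa fl] := laurent_lead f0.
pose F (i : nat) := f (a + i%:Z).
pose gf (n : int) :=
  if n < - a then 0 else (pinv_seq F `|n + a|.+1)`_`|n + a|.
have gl : lb (- a) gf by move=> n na; rewrite /gf na.
have gP : gf \in @bounded_below K by apply/bounded_belowP; exists (- a).
exists (Laurent gP); rewrite mulrC; apply: laurentP => n.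
change (lconv f gf n = lconst_fun 1 n).
have [nl|[m ->]] := intD (a + - a) n.
  by rewrite (lconv_lb fl gl)// /lconst_fun; case: eqP nl => // ->; rewrite subrr ltxx.
rewrite (lconvE _ fl gl) subrr add0r /lconst_fun eqz_nat.
rewrite (reindex_inj rev_ord_inj) /=.
have -> : (if m == 0%N then 1 else 0) = (m == 0%N)%:R :> K by case: eqP.
rewrite -(pinvP m (_ : F 0%N != 0)) ?/F ?addr0//.
apply: eq_bigr => j _; have jm := ltn_ord j; rewrite subSS; congr (_ * _).
have -> : (m - (m - j))%:Z = j%:Z by lia.
have E : - a + j%:Z + a = j%:Z by lia.
by rewrite /gf ifF; [rewrite E | apply/negbTE; rewrite -leNgt; lia].
Qed.

Definition laurent_inv (f : laurent K) : laurent K := sval (cid (laurent_inv_ex f)).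

Fact laurent_mulVf f : f != 0 -> laurent_inv f * f = 1.
Proof.
by move=> f0; rewrite /laurent_inv; case: cid => g /=; rewrite (negbTE f0).
Qed.

Fact laurent_inv0 : laurent_inv 0 = 0.
Proof. by rewrite /laurent_inv; case: cid => g /=; rewrite eqxx. Qed.

HB.instance Definition _ := GRing.ComNzRing_isField.Build (laurent K)
  laurent_mulVf laurent_inv0.

Fact lconst_is_zmod_morphism : zmod_morphism lconst.
Proof.
move=> a b; apply: laurentP => n; change (lconst_fun (a - b) n = lconst_fun a n - lconst_fun b n).
by rewrite /lconst_fun; case: eqP; rewrite ?subr0.
Qed.
Fact lconst_is_monoid_morphism : monoid_morphism lconst.
Proof.
split=> // a b; rewrite -[RHS]/(laurent_mul _ _) lconst_mulE.
by apply: laurentP => n; rewrite coefLZ /= /lconst_fun; case: eqP; rewrite ?mulr0.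
Qed.
HB.instance Definition _ := GRing.isZmodMorphism.Build K (laurent K) lconst
  lconst_is_zmod_morphism.
HB.instance Definition _ := GRing.isMonoidMorphism.Build K (laurent K) lconst
  lconst_is_monoid_morphism.

(* lu is the variable u. *)
Definition lu_fun (n : int) : K := if n == 1 then 1 else 0.
Fact lu_funP : lu_fun \in @bounded_below K.
Proof. by apply/bounded_belowP; exists 1 => n; rewrite /lu_fun; case: ltgtP. Qed.
Definition lu : laurent K := Laurent lu_funP.

Lemma lconstZ c (f : laurent K) : lconst c * f = c *: f.
Proof. exact: lconst_mulE. Qed.

End LaurentTheory.
Section Tensor.
Variables (F : comNzRingType) (A B : lmodType F).

(* A sequence of pairs stands for the formal sum of the a (x) b; tens_rel is the
   congruence generated by bilinearity, so that tens is A (x)_F B (see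
   tens_universal below). *)
Inductive tens_rel : seq (A * B) -> seq (A * B) -> Prop :=
| tens_refl s : tens_rel s s
| tens_sym s t : tens_rel s t -> tens_rel t s
| tens_trans s t r : tens_rel s t -> tens_rel t r -> tens_rel s r
| tens_cat s s' t t' :
    tens_rel s s' -> tens_rel t t' -> tens_rel (s ++ t) (s' ++ t')
| tens_comm s t : tens_rel (s ++ t) (t ++ s)
| tens_zero b : tens_rel [:: (0, b)] [::]
| tens_addl a a' b : tens_rel [:: (a + a', b)] [:: (a, b); (a', b)]
| tens_addr a b b' : tens_rel [:: (a, b + b')] [:: (a, b); (a, b')]
| tens_scale c a b : tens_rel [:: (c *: a, b)] [:: (a, c *: b)].

Definition tens_relb : rel (seq (A * B)) := fun s t => `[< tens_rel s t >].

Fact tens_relb_equiv : equiv_class_of tens_relb.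
Proof.
split=> [s|s t|t s r]; first exact/asboolP/tens_refl.
  by apply/asboolP/asboolP; apply: tens_sym.
by move=> /asboolP st /asboolP tr; apply/asboolP/(tens_trans st).
Qed.

Canonical tens_relb_canonical := EquivRelPack tens_relb_equiv.

Definition tens := {eq_quot tens_relb}.

HB.instance Definition _ : EqQuotient _ tens_relb tens := EqQuotient.on tens.
HB.instance Definition _ := Choice.on tens.

Definition tpi (s : seq (A * B)) : tens := \pi_tens s.
Definition tpure (a : A) (b : B) : tens := tpi [:: (a, b)].

Lemma tpiP s t : tens_rel s t <-> tpi s = tpi t.
Proof.
split=> [st|/eqP]; first by apply/eqP; rewrite /tpi eqmodE; apply/asboolP.
by rewrite /tpi eqmodE => /asboolP.
Qed.

Lemma tpi_repr x : tpi (repr x) = x.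
Proof. by rewrite /tpi reprK. Qed.

Let tpiW (P : tens -> Prop) : (forall s, P (tpi s)) -> forall x, P x.
Proof. by move=> h x; rewrite -(tpi_repr x). Qed.

Definition tadd (x y : tens) := tpi (repr x ++ repr y).
Definition tzero := tpi [::].
Definition topp (x : tens) := tpi [seq (- p.1, p.2) | p <- repr x].
Definition tscale (c : F) (x : tens) := tpi [seq (c *: p.1, p.2) | p <- repr x].

Let repr_tpi s : tens_rel (repr (tpi s)) s.
Proof. by apply/tpiP; rewrite tpi_repr. Qed.

Let tens_rel_map (f : A -> A) : {morph f : a b / a + b} -> scalable f ->
  forall s t, tens_rel s t ->
  tens_rel [seq (f p.1, p.2) | p <- s] [seq (f p.1, p.2) | p <- t].
Proof.
move=> fD fZ s t; have f0 : f 0 = 0 by apply: (addIr (f 0)); rewrite -fD !add0r.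
elim=> {s t} /=.
- by move=> s; apply: tens_refl.
- by move=> s t _; apply: tens_sym.
- by move=> s t r _ st _; apply: (tens_trans st).
- by move=> s s' t t' _ ss _ tt; rewrite !map_cat; apply: tens_cat.
- by move=> s t; rewrite !map_cat; apply: tens_comm.
- by move=> b; rewrite f0; apply: tens_zero.
- by move=> a a' b; rewrite fD; apply: tens_addl.
- by move=> a b b'; apply: tens_addr.
- by move=> c a b; rewrite fZ; apply: tens_scale.
Qed.

Lemma taddE s t : tadd (tpi s) (tpi t) = tpi (s ++ t).
Proof. by apply/tpiP/tens_cat. Qed.

Lemma toppE s : topp (tpi s) = tpi [seq (- p.1, p.2) | p <- s].
Proof.
apply/tpiP/tens_rel_map => // [a b|c a]; last by rewrite scalerN.
by rewrite opprD.
Qed.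

Lemma tscaleE c s : tscale c (tpi s) = tpi [seq (c *: p.1, p.2) | p <- s].
Proof.
apply/tpiP/tens_rel_map => // [a b|d a]; first by rewrite scalerDr.
by rewrite !scalerA mulrC.
Qed.

Fact taddA : associative tadd.
Proof.
by elim/tpiW=> s; elim/tpiW=> t; elim/tpiW=> r; rewrite !taddE catA.
Qed.

Fact taddC : commutative tadd.
Proof.
by elim/tpiW=> s; elim/tpiW=> t; rewrite !taddE; apply/tpiP/tens_comm.
Qed.

Fact tadd0 : left_id tzero tadd.
Proof. by elim/tpiW=> s; rewrite /tzero taddE. Qed.

Let tpi_cons a b s : tpi ((a, b) :: s) = tadd (tpure a b) (tpi s).
Proof. by rewrite taddE. Qed.

Fact taddN : left_inverse tzero topp tadd.
Proof.
elim/tpiW=> s; rewrite toppE; elim: s => [|[a b] s IH] /=.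
  by rewrite taddE.
rewrite !tpi_cons taddA -(taddA (tpure (- a) b)) (taddC (tpi _)).
rewrite taddA -[tadd (tadd (tadd _ _) _) _]taddA IH.
rewrite taddC tadd0 /tpure taddE; apply/tpiP.
have := tens_sym (tens_addl (- a) a b); rewrite addNr => h.
exact: tens_trans h (tens_zero b).
Qed.

HB.instance Definition _ := GRing.isZmodule.Build tens taddA taddC tadd0 taddN.

Lemma tpi_sum s : tpi s = \sum_(p <- s) tpure p.1 p.2.
Proof.
elim: s => [|[a b] s IH]; first by rewrite big_nil.
by rewrite big_cons -IH tpi_cons.
Qed.

Lemma tpiD s t : tpi s + tpi t = tpi (s ++ t).
Proof. exact: taddE. Qed.

Lemma tpureDl a a' b : tpure (a + a') b = tpure a b + tpure a' b.
Proof. by rewrite /tpure tpiD; apply/tpiP/tens_addl. Qed.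

Lemma tpureDr a b b' : tpure a (b + b') = tpure a b + tpure a b'.
Proof. by rewrite /tpure tpiD; apply/tpiP/tens_addr. Qed.

Lemma tpureC c a b : tpure (c *: a) b = tpure a (c *: b).
Proof. exact/tpiP/tens_scale. Qed.

Fact tscaleA c d x : tscale c (tscale d x) = tscale (c * d) x.
Proof.
elim/tpiW: x => s; rewrite !tscaleE -map_comp; congr tpi.
by apply: eq_map => p /=; rewrite scalerA.
Qed.

Fact tscale1 : left_id 1 tscale.
Proof.
elim/tpiW=> s; rewrite tscaleE; congr tpi.
by rewrite -[RHS]map_id; apply: eq_map => -[a b] /=; rewrite scale1r.
Qed.

Fact tscaleDr : right_distributive tscale +%R.
Proof.
move=> c; elim/tpiW=> s; elim/tpiW=> t.
by rewrite tpiD !tscaleE tpiD map_cat.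
Qed.

Fact tscaleDl x : {morph tscale^~ x : a b / a + b}.
Proof.
elim/tpiW: x => s c d; rewrite !tscaleE !tpi_sum !big_map -big_split.
by apply: eq_bigr => p _ /=; rewrite scalerDl tpureDl.
Qed.

HB.instance Definition _ := GRing.Zmodule_isLmodule.Build F tens
  tscaleA tscale1 tscaleDr tscaleDl.

Lemma tpiZ c s : c *: tpi s = tpi [seq (c *: p.1, p.2) | p <- s].
Proof. exact: tscaleE. Qed.

Lemma tpureZl c a b : tpure (c *: a) b = c *: tpure a b.
Proof. by rewrite /tpure tpiZ. Qed.

Lemma tpureZr c a b : tpure a (c *: b) = c *: tpure a b.
Proof. by rewrite -tpureC tpureZl. Qed.

Lemma tens_ind (P : tens -> Prop) : P 0 -> (forall x y, P x -> P y -> P (x + y)) ->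
  (forall a b, P (tpure a b)) -> forall x, P x.
Proof.
move=> P0 PD Pp x; rewrite -(tpi_repr x) tpi_sum; elim/big_ind: _ => // p _.
Qed.

Definition bilin (W : lmodType F) (f : A -> B -> W) :=
  (forall b, linear (f^~ b)) /\ (forall a, linear (f a)).

Lemma tpure_bilin : bilin tpure.
Proof.
by split=> [b c a a'|a c b b']; rewrite ?tpureDl ?tpureZl ?tpureDr ?tpureZr.
Qed.

Definition tlift (W : lmodType F) (f : A -> B -> W) (x : tens) : W :=
  \sum_(p <- repr x) f p.1 p.2.

Section Lift.
Variables (W : lmodType F) (f : A -> B -> W).
Hypothesis fbil : bilin f.

Let fDl a a' b : f (a + a') b = f a b + f a' b.
Proof. by have := fbil.1 b 1 a a'; rewrite !scale1r. Qed.
Let fDr a b b' : f a (b + b') = f a b + f a b'.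
Proof. by have := fbil.2 a 1 b b'; rewrite !scale1r. Qed.
Let f0l b : f 0 b = 0.
Proof. by apply: (addIr (f 0 b)); rewrite -fDl !add0r. Qed.
Let f0r a : f a 0 = 0.
Proof. by apply: (addIr (f a 0)); rewrite -fDr !add0r. Qed.
Let fZl c a b : f (c *: a) b = c *: f a b.
Proof. by have := fbil.1 b c a 0; rewrite !addr0 f0l addr0. Qed.
Let fZr c a b : f a (c *: b) = c *: f a b.
Proof. by have := fbil.2 a c b 0; rewrite !addr0 f0r addr0. Qed.

Lemma tlift_tpi s : tlift f (tpi s) = \sum_(p <- s) f p.1 p.2.
Proof.
suff h t r : tens_rel t r ->
    \sum_(p <- t) f p.1 p.2 = \sum_(p <- r) f p.1 p.2 by exact: h.
elim=> //= {t r}.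
- by move=> t r r' _ Et _ Er; rewrite Et.
- by move=> t t' r r' _ Et _ Er; rewrite !big_cat /= Et Er.
- by move=> t r; rewrite !big_cat /= addrC.
- by move=> b; rewrite big_seq1 big_nil f0l.
- by move=> a a' b; rewrite big_seq1 big_cons big_seq1 fDl.
- by move=> a b b'; rewrite big_seq1 big_cons big_seq1 fDr.
- by move=> c a b; rewrite !big_seq1 /= fZl fZr.
Qed.

Lemma tlift_pure a b : tlift f (tpure a b) = f a b.
Proof. by rewrite tlift_tpi big_seq1. Qed.

Lemma tlift_linear : linear (tlift f).
Proof.
move=> c; elim/tpiW=> s; elim/tpiW=> t.
rewrite tpiZ tpiD !tlift_tpi.
rewrite big_cat big_map scaler_sumr; congr (_ + _).
by apply: eq_bigr => p _; rewrite fZl.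
Qed.

Lemma tens_universal : exists! g : tens -> W,
  linear g /\ forall a b, g (tpure a b) = f a b.
Proof.
exists (tlift f); split; first by split; [exact: tlift_linear | exact: tlift_pure].
move=> g [glin gpure]; apply/funext.
have gD x y : g (x + y) = g x + g y by have := glin 1 x y; rewrite !scale1r.
have lD x y : tlift f (x + y) = tlift f x + tlift f y.
  by have := tlift_linear 1 x y; rewrite !scale1r.
elim/tens_ind => [|x y Ex Ey|a b]; last by rewrite tlift_pure gpure.
- have z (h : tens -> W) : (forall x y, h (x + y) = h x + h y) -> h 0 = 0.
    by move=> hD; apply: (addIr (h 0)); rewrite -hD !add0r.
  by rewrite !z.
- by rewrite lD gD Ex Ey.
Qed.
End Lift.
End Tensor.

Section TensorMap.
Variables (F : comNzRingType) (A A' B B' : lmodType F).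
Variables (f : {linear A -> A'}) (g : {linear B -> B'}).

Definition tmap : tens A B -> tens A' B' :=
  tlift (fun a b => tpure (f a) (g b)).

Fact tmap_bilin : bilin (fun a b => tpure (f a) (g b)).
Proof.
split=> [b c a a'|a c b b']; rewrite linearP.
  by rewrite tpureDl tpureZl.
by rewrite tpureDr tpureZr.
Qed.

Fact tmap_linear : linear tmap.
Proof. exact: tlift_linear tmap_bilin. Qed.
HB.instance Definition _ :=
  GRing.isLinear.Build F (tens A B) (tens A' B') _ tmap tmap_linear.

Lemma tmap_pure a b : tmap (tpure a b) = tpure (f a) (g b).
Proof. exact: tlift_pure tmap_bilin _ _. Qed.

End TensorMap.

(* V (x)_K K((u)) with its K((u))-linear structure coming from the second
   factor; V (x)_K K((u)) as a K-module remains available as tens. *)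
Section ScalarExtension.
Variables (K : fieldType) (V : lmodType K).

Definition scalext := tens V (laurent K).
HB.instance Definition _ := GRing.Zmodule.on scalext.

Definition sext_scale (c : laurent K) : scalext -> scalext :=
  tlift (fun v d => tpure v (c * d)).

Fact sext_bilin (c : laurent K) :
  bilin (fun (v : V) (d : laurent K) => tpure v (c * d)).
Proof.
split=> [d k v v'|v k d d']; first by rewrite tpureDl tpureZl.
by rewrite mulrDr tpureDr -(lconstZ k) mulrCA lconstZ tpureZr.
Qed.

Let scaleE c v d : sext_scale c (tpure v d) = tpure v (c * d).
Proof. exact: tlift_pure (sext_bilin c) _ _. Qed.

Let scaleD c x y : sext_scale c (x + y) = sext_scale c x + sext_scale c y.
Proof.
by have := tlift_linear (sext_bilin c) 1 x y; rewrite !scale1r.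
Qed.

Let scale0 c : sext_scale c 0 = 0.
Proof. by apply: (addIr (sext_scale c 0)); rewrite -scaleD !add0r. Qed.

Fact sext_scaleA a b x : sext_scale a (sext_scale b x) = sext_scale (a * b) x.
Proof.
elim/tens_ind: x => [|x y Ex Ey|v d]; first by rewrite !scale0.
  by rewrite !scaleD Ex Ey.
by rewrite !scaleE mulrA.
Qed.
Fact sext_scale1 : left_id 1 sext_scale.
Proof.
elim/tens_ind => [|x y Ex Ey|v d]; first by rewrite !scale0.
  by rewrite !scaleD Ex Ey.
by rewrite !scaleE mul1r.
Qed.
Fact sext_scaleDr : right_distributive sext_scale +%R.
Proof. by move=> c x y; rewrite scaleD. Qed.
Fact sext_scaleDl x : {morph sext_scale^~ x : a b / a + b}.
Proof.
move=> a b; elim/tens_ind: x => [|x y Ex Ey|v d].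
- by rewrite !scale0 addr0.
- by rewrite !scaleD Ex Ey addrACA.
- by rewrite !scaleE mulrDl tpureDr.
Qed.
HB.instance Definition _ := GRing.Zmodule_isLmodule.Build (laurent K) scalext
  sext_scaleA sext_scale1 sext_scaleDr sext_scaleDl.

Definition sext_pure (v : V) (d : laurent K) : scalext := tpure v d.

Lemma sext_pureZ c v d : c *: sext_pure v d = sext_pure v (c * d).
Proof. exact: scaleE. Qed.

Section Map.
Variable f : {linear V -> V}.

Definition sext_map : scalext -> scalext := tmap f (@idfun (laurent K)).

Lemma sext_map_pure v d : sext_map (sext_pure v d) = sext_pure (f v) d.
Proof. exact: tmap_pure. Qed.

Fact sext_map_linear : linear sext_map.
Proof.
have fD x y : sext_map (x + y) = sext_map x + sext_map y.
  by rewrite /sext_map -raddfD.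
have f0 : sext_map 0 = 0 by rewrite /sext_map -[RHS](raddf0 (tmap f idfun)).
move=> c x y; rewrite fD; congr (_ + _).
elim/tens_ind: x => [|x x' Ex Ex'|v d].
- by rewrite f0 scaler0 f0.
- by rewrite scalerDr !fD Ex Ex' scalerDr.
- by rewrite -/(sext_pure v d) sext_pureZ !sext_map_pure sext_pureZ.
Qed.
HB.instance Definition _ :=
  GRing.isLinear.Build (laurent K) scalext scalext _ sext_map sext_map_linear.
End Map.
End ScalarExtension.

Definition cexp (R : realType) (z : R[i]) : R[i] :=
  let: x +i* y := z in (expR x * cos y) +i* (expR x * sin y).

(* qlog is the fixed logarithm of q; in particular q is nonzero. *)
Record qparam (R : realType) := QParam {
  qval :> R[i];
  qlog : R[i];
  qlogE : cexp qlog = qval;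
  qnot_unity_root : forall m : nat, (0 < m)%N -> qval ^+ m != 1 }.

Definition qpow (R : realType) (q : qparam R) (a : rat) : R[i] :=
  cexp (ratr a * qlog q).

Definition qint (R : realType) (z : R[i]) (m : int) : R[i] :=
  (z ^ m - z ^ (- m)) / (z - z^-1).

(* csym i is the symmetrizing integer r_i. *)
Record cartan_datum (n : nat) := CartanDatum {
  cmat : 'M[int]_n;
  csym : 'I_n -> nat;
  cmat_diag : forall i, cmat i i = 2;
  cmat_offdiag : forall i j, i != j -> cmat i j <= 0;
  cmat_zero : forall i j, cmat i j = 0 <-> cmat j i = 0;
  csym_gt0 : forall i, (0 < csym i)%N;
  cmat_sym : forall i j, (csym i)%:Z * cmat i j = (csym j)%:Z * cmat j i }.

Definition bmat n (C : cartan_datum n) : 'M[int]_n :=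
  \matrix_(i, j) ((csym C i)%:Z * cmat C i j).

Record realization n (C : cartan_datum n) := Realization {
  hsp : vectType rat;
  sroot : 'I_n -> 'Hom(hsp, rat^o);
  coroot : 'I_n -> hsp;
  hsp_dim : \dim {: hsp} = (2 * n - \rank (map_mx intr (cmat C) : 'M[rat]_n))%N;
  sroot_free : free [tuple sroot i | i < n];
  coroot_free : free [tuple coroot i | i < n];
  sroot_coroot : forall i j, sroot j (coroot i) = (cmat C i j)%:~R }.

(* Signs: true is +, false is -. *)
Definition sg (s : bool) : int := if s then 1 else -1.

(* Operators for the generators x^s_{i,r}, k_h and h_{i,m}.  There is no
   generator h_{i,0}: is_umodule pins uh i 0 to 0 so that the unused index
   carries no data. *)
Record uops (K : fieldType) n (C : cartan_datum n) (H : realization C)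
    (V : lmodType K) := UOps {
  ux : bool -> 'I_n -> int -> {linear V -> V};
  uk : hsp H -> {linear V -> V};
  uh : 'I_n -> int -> {linear V -> V} }.

(* Power series in one variable with operator coefficients, as functions of the
   exponent. *)
Section OperatorSeries.
Variables (K : fieldType) (V : lmodType K).
Implicit Types a b : nat -> V -> V.

Definition ops_one : nat -> V -> V := fun m v => if m == 0%N then v else 0.

Definition ops_mul a b : nat -> V -> V :=
  fun m v => \sum_(j < m.+1) a j (b (m - j)%N v).

(* exp(a) for a series a without constant term: the coefficient of exponent m of
   a^p vanishes for p > m, hence the truncation of the sum over p. *)
Definition ops_exp a : nat -> V -> V :=
  fun m v => \sum_(p < m.+1) (p`!%:R)^-1 *: iter p (ops_mul a) ops_one m v.

Lemma ops_exp_linear a : (forall m, linear (a m)) ->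
  forall m, linear (ops_exp a m).
Proof.
move=> alin m c x y.
have pl p : forall m, linear (iter p (ops_mul a) ops_one m).
  elim: p => [|p IH] k d v w /=.
    by rewrite /ops_one; case: eqP => // _; rewrite scaler0 addr0.
  rewrite scaler_sumr -big_split; apply: eq_bigr => j _.
  by rewrite IH alin.
rewrite scaler_sumr -big_split; apply: eq_bigr => p _.
by rewrite pl scalerDr !scalerA mulrC.
Qed.

End OperatorSeries.

(* Modules over K = C (io the identity) and over K = C((u)) (io = lconst) at the
   same time.  A module over the algebra given by generators and relations is a
   vector space with operators satisfying these relations. *)
Section Modules.
Variables (R : realType) (q : qparam R) (n : nat) (C : cartan_datum n).
Variables (H : realization C) (K : fieldType) (io : {rmorphism R[i] -> K}).
Variable V : lmodType K.
Implicit Types (M : uops H V) (s : bool) (i j : 'I_n).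

Let qi i : R[i] := qval q ^+ csym C i.

Definition hser M s i : nat -> V -> V := fun m v =>
  if m == 0%N then 0
  else io ((sg s)%:~R * (qval q - (qval q)^-1)) *: uh M i (sg s * m%:Z) v.

(* phi M s i m is the action of phi^s_{i, s m}, for m : nat. *)
Definition phi M s i (m : nat) : V -> V := fun v =>
  uk M ((sg s * (csym C i)%:Z)%:~R *: coroot H i) (ops_exp (hser M s i) m v).

Fact phi_linear M s i m : linear (phi M s i m).
Proof.
move=> c x y; rewrite /phi ops_exp_linear ?linearP// => k d v w.
rewrite /hser; case: eqP => _; first by rewrite scaler0 addr0.
by rewrite linearP scalerDr !scalerA mulrC.
Qed.
HB.instance Definition _ M s i m :=
  GRing.isLinear.Build K V V _ (phi M s i m) (phi_linear M s i m).

(* phiz M s i m is the action of phi^s_{i, m}, for m : int. *)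
Definition phiz M s i (m : int) : V -> V := fun v =>
  if 0 <= sg s * m then phi M s i `|m|%N v else 0.

Record is_umodule M : Prop := IsUModule {
  uh0 : forall i v, uh M i 0 v = 0;
  ukD : forall h h' v, uk M h (uk M h' v) = uk M (h + h') v;
  uk0 : forall v, uk M 0 v = v;
  ukh : forall h j m v, m != 0 -> uk M h (uh M j m v) = uh M j m (uk M h v);
  uhh : forall i j m m' v, m != 0 -> m' != 0 ->
    uh M i m (uh M j m' v) = uh M j m' (uh M i m v);
  ukx : forall h s j r v,
    uk M h (ux M s j r (uk M (- h) v)) =
    io (qpow q ((sg s)%:~R * sroot H j h)) *: ux M s j r v;
  uhx : forall i m s j r v, m != 0 ->
    uh M i m (ux M s j r v) - ux M s j r (uh M i m v) =
    io ((sg s)%:~R * (m%:~R^-1 * qint (qval q) (m * bmat C i j)))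
      *: ux M s j (m + r) v;
  uxx_pm : forall i j r r' v,
    ux M true i r (ux M false j r' v) - ux M false j r' (ux M true i r v) =
    if i == j then
      io (qi i - (qi i)^-1)^-1
        *: (phiz M true i (r + r') v - phiz M false i (r + r') v)
    else 0;
  uxx : forall s i j r r' v,
    let qB := io (qval q ^ (sg s * bmat C i j)) in
    ux M s i (r + 1) (ux M s j r' v) - qB *: ux M s j r' (ux M s i (r + 1) v) =
    qB *: ux M s i r (ux M s j (r' + 1) v) - ux M s j (r' + 1) (ux M s i r v) }.

Local Notation hdual := 'Hom(hsp H, rat^o).

(* V_w *)
Definition wtsp M (w : hdual) : set V :=
  [set v | forall h, uk M h v = io (qpow q (w h)) *: v].

Definition is_weight M (w : hdual) := exists2 v, wtsp M w v & v != 0.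

(* w is in D(l) *)
Definition cone (l w : hdual) :=
  exists c : 'I_n -> nat, l - w = \sum_i sroot H i *+ c i.

Definition is_basis (W : set V) d (e : 'I_d -> V) :=
  (forall k, W (e k)) /\
  (forall v, W v -> exists! c : 'I_d -> K, v = \sum_k c k *: e k).

(* W is the internal direct sum of the S x for x in P. *)
Definition direct_sum (W : set V) (J : Type) (P : set J) (S : J -> set V) :=
  [/\ forall x, P x -> S x `<=` W,
      forall v, W v -> exists d (x : 'I_d -> J) (w : 'I_d -> V),
        [/\ injective x, forall k, P (x k) /\ S (x k) (w k) & v = \sum_k w k]
    & forall d (x : 'I_d -> J) (w : 'I_d -> V),
        injective x -> (forall k, P (x k) /\ S (x k) (w k)) ->
        \sum_k w k = 0 -> forall k, w k = 0].

(* Weight decomposition, finite dimension and cone conditions, common to the two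
   categories O. *)
Record catO_base M : Prop := CatOBase {
  O_umodule : is_umodule M;
  O_dsum : direct_sum setT setT (wtsp M);
  O_fin : forall w, exists d (e : 'I_d -> V), is_basis (wtsp M w) e;
  O_cone : exists ls : seq hdual,
    forall w, is_weight M w -> exists2 l, l \in ls & cone l w }.

(* Psi s i m stands for Psi^s_{i, s m}; the condition is
   Psi^s_{i,0} = q_i^(s l(coroot i)), with q_i^a = q^(r_i a). *)
Definition psi0 (l : hdual) (Psi : bool -> 'I_n -> nat -> K) :=
  forall s i,
    Psi s i 0%N = io (qpow q ((sg s * (csym C i)%:Z)%:~R * l (coroot H i))).

Definition lwtsp M (l : hdual) (Psi : bool -> 'I_n -> nat -> K) : set V :=
  [set v | wtsp M l v /\ exists p, forall s i m,
     iter p (fun w => phi M s i m w - Psi s i m *: w) v = 0].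

End Modules.

Section Complex.
Variables (R : realType) (q : qparam R) (n : nat) (C : cartan_datum n).
Variables (H : realization C).
Local Notation CC := (R[i]).
Local Notation LC := (laurent R[i]).
Local Notation hdual := 'Hom(hsp H, rat^o).

Definition catO (V : lmodType CC) (M : uops H V) := catO_base q idfun M.

Definition is_lweight (V : lmodType CC) (M : uops H V) (l : hdual) Psi :=
  psi0 q idfun l Psi /\ exists2 v, lwtsp q idfun M l Psi v & v != 0.

Definition lpoly (f : LC) := exists N : int, forall k, N < k -> f k = 0.

Definition Plu (l : hdual) (Psi : bool -> 'I_n -> nat -> LC) :=
  (forall s i m, lpoly (Psi s i m)) /\ psi0 q (@lconst CC) l Psi.

Definition is_luweight (V : lmodType LC) (M : uops H V) (l : hdual) Psi :=
  Plu l Psi /\ exists2 v, lwtsp q (@lconst CC) M l Psi v & v != 0.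

Record catOu (V : lmodType LC) (M : uops H V) : Prop := CatOu {
  Ou_base : catO_base q (@lconst CC) M;
  Ou_dsum : forall l : hdual,
    direct_sum (wtsp q (@lconst CC) M l) [set Psi | Plu l Psi]
      (lwtsp q (@lconst CC) M l) }.

(* u^k C[[u]] *)
Definition upow (k : int) : set LC := [set f | forall m, m < k -> f m = 0].

(* The coefficients of v on the basis e are in S. *)
Definition coefs_in (V : lmodType LC) d (e : 'I_d -> V) (S : set LC) (v : V) :=
  exists2 c : 'I_d -> LC, v = \sum_k c k *: e k & forall k, S (c k).

Record catOR (r : nat) (V : lmodType LC) (M : uops H V) : Prop := CatOR {
  OR_Ou : catOu M;
  OR_basis :
    exists (d : hdual -> nat) (e : forall l : hdual, 'I_(d l) -> V),
    [/\ forall l, is_basis (wtsp q (@lconst CC) M l) (e l),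
        forall l i (m : int) a,
          let xp := ux M true i m (e l a) in
          let xm := ux M false i m (e l a) in
          let ep := e (l + sroot H i) in
          let em := e (l - sroot H i) in
          (0 <= m -> coefs_in ep (upow 0) xp /\ coefs_in em (upow 0) xm) /\
          (m <= 0 -> coefs_in ep (upow (r%:Z * m)) xp /\
                     coefs_in em (upow (r%:Z * m)) xm),
        forall l i (m : nat) a,
          coefs_in (e l) (upow (- (m%:Z * r%:Z)))
            (phi q (@lconst CC) M false i m (e l a))
      & forall l i (m : nat) a,
          coefs_in (e l) (upow 0) (phi q (@lconst CC) M true i m (e l a))] }.

(* i(V) *)
Definition iops (V : lmodType CC) (M : uops H V) : uops H (scalext V) :=
  UOps (fun s i m => sext_map (ux M s i m) : {linear scalext V -> scalext V})
       (fun h => sext_map (uk M h) : {linear scalext V -> scalext V})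
       (fun i m => sext_map (uh M i m) : {linear scalext V -> scalext V}).

(* The series of general term t converges to w for the u-adic topology of the
   finite dimensional space W, i.e. coordinatewise on a basis of W. *)
Definition usum_cvg (V : lmodType LC) (W : set V) (t : nat -> V) (w : V) :=
  exists d (e : 'I_d -> V), is_basis W e /\
  exists (c : nat -> 'I_d -> LC) (cw : 'I_d -> LC),
    [/\ forall N, \sum_(l < N) t l = \sum_k c N k *: e k,
        w = \sum_k cw k *: e k
      & forall k (p : int), exists N0, forall N, (N0 <= N)%N ->
          upow p (c N k - cw k)].

Section Delta.
Variables (V1 : lmodType CC) (M1 : uops H V1).
Variables (V2 : lmodType LC) (M2 : uops H V2).
Local Notation T := (tens (scalext V1) V2).
Local Notation u := (lu CC).
Local Notation A := (iops M1).
Local Notation phi := (phi q (@lconst CC)).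
Local Notation wtsp := (wtsp q (@lconst CC)).

(* The infinite sums in the formulas for x^+ and x^- are required to converge on
   each weight space, to what remains of the operator once its first term is
   removed. *)
Record is_Delta (M : uops H T) : Prop := IsDelta {
  Delta_xp : forall i (r : int) l v, wtsp M l v ->
    usum_cvg (wtsp M (l + sroot H i))
      (fun k => u ^ (r + k%:Z)
         *: tmap (phi A false i k) (ux M2 true i (r + k%:Z)) v)
      (ux M true i r v - tmap (ux A true i r) idfun v);
  Delta_xm : forall i (r : int) l v, wtsp M l v ->
    usum_cvg (wtsp M (l - sroot H i))
      (fun k => u ^ k%:Z
         *: tmap (ux A false i (r - k%:Z)) (phi M2 true i k) v)
      (ux M false i r v - u ^ r *: tmap idfun (ux M2 false i r) v);
  Delta_phi : forall s i m v,
    phi M s i m v =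
    \sum_(l < m.+1) u ^ (sg s * l%:Z)
      *: tmap (phi A s i (m - l)%N) (phi M2 s i l) v;
  Delta_k : forall h v, uk M h v = tmap (uk A h) (uk M2 h) v }.

End Delta.
End Complex.

(* Main.v *)
(* On i(V1) (x) V2 the currents phi act by phi(z) (x) phi(uz), hence h_{i,m} by
   h_{i,m} (x) 1 + u^m (1 (x) h_{i,m}), and x^+_{i,r} and x^-_{i,r} by series in
   u: V2 being in O^R, the coefficients of x_{i,m} on a basis are in C[[u]] for
   m >= 0, so that the powers of u in front of the terms make the series converge
   on the finite dimensional weight spaces.

   The relation m phi_m = sum_k k h_k phi_{m-k}, which characterizes exponentials,
   gives phi(z) x(w) = F x(w) phi(z) with F the expansion of (y - t) / (1 - y t),
   y = q^(+-B_ij).  Products of two convergent series of operators are summed as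
   Cauchy products, and the relations between the x's then hold in each total
   degree, up to the relations above for the cross terms.  The module is unique
   because phi_{i,m} is (q - q^-1) k h_{i,m} plus terms in the h_{i,k}, k < m.

   C being algebraically closed, V1 is the sum of its l-weight spaces.  A tensor
   product of an l-weight vector and of an l,u-weight vector is a generalized
   eigenvector of the phi_{i,m} for the product of the two l-weights: commuting
   nilpotent operators have a nilpotent sum, and the exponent is at most the
   dimension of the weight space.  As generalized eigenvectors of commuting
   operators for distinct systems of eigenvalues are independent, no other
   l,u-weight occurs. *)
From HB Require Import structures.
Require Import Defs.
From mathcomp Require Import all_boot all_order all_algebra.
From mathcomp Require Import boolp classical_sets functions fsbigop.
From mathcomp Require Import reals exp trigo complex zify ring.

Set Implicit Arguments.
Unset Strict Implicit.
Unset Printing Implicit Defensive.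

Import Order.TTheory GRing.Theory Num.Theory.

Local Open Scope ring_scope.


(** * Exponentials of operator series *)

(** No topology is put on the tensor product: a convergent series ([usum]) is a finite combination
    of fixed vectors whose coefficients are convergent series in C((u)). Linear maps then preserve
    convergence without any continuity argument, coordinate functionals give uniqueness of limits,
    and relations are checked term by term on pure tensors. The delicate relation is the one between
    x^+_{i,r} and x^-_{i,r'}. With m = r + r', the commutators of the first terms with the series
    produce, besides the summands of phi^+_m and phi^-_m, the terms u^k phi^-_{m-k} (x) phi^+_k,
    subtracted over k >= 0 and added over k >= m. They are zero unless k >= 0 and k >= m, so these
    two sums cancel, although neither is finite. The constant R + 1 comes from the factor u^(r+l) in
    front of x_{i,r+l}: for r + l < 0 the two exponents add up to (R + 1)(r + l), which is at least
    (R + 1) r. *)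

Lemma triangle_diag (V : nmodType) m (G : nat -> nat -> V) :
  \sum_(j < m.+1) \sum_(k < (m - j).+1) G j k =
  \sum_(s < m.+1) \sum_(j < s.+1) G j (s - j)%N.
Proof.
elim: m => [|m IH]; first by rewrite !big_ord1.
rewrite big_ord_recr [RHS]big_ord_recr /= subnn big_ord1 -IH.
rewrite [X in _ = _ + X]big_ord_recr /= subnn addrA; congr (_ + _).
rewrite -big_split; apply: eq_bigr => j _ /=.
by rewrite subSn ?leq_ord// big_ord_recr.
Qed.

Lemma sum_rev (V : nmodType) m (G : nat -> nat -> V) :
  \sum_(j < m.+1) G j (m - j)%N = \sum_(j < m.+1) G (m - j)%N j.
Proof.
rewrite (reindex_inj rev_ord_inj) /=; apply: eq_bigr => j _.
by rewrite subSS subKn ?leq_ord.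
Qed.

Lemma triangle_swap (V : nmodType) m (G : nat -> nat -> V) :
  \sum_(j < m.+1) \sum_(k < (m - j).+1) G j k =
  \sum_(k < m.+1) \sum_(j < (m - k).+1) G j k.
Proof.
rewrite triangle_diag (triangle_diag m (fun k j => G j k)).
by apply: eq_bigr => s _; rewrite (sum_rev s G).
Qed.

Lemma mulrn_split (V : nmodType) j m (x : V) : (j <= m)%N ->
  x *+ m = x *+ j + x *+ (m - j).
Proof. by move=> jm; rewrite -mulrnDr subnKC. Qed.

Section OperatorExp.
Variables (K : fieldType) (V : lmodType K) (a : nat -> {linear V -> V}).
Hypothesis K0 : forall m, m.+1%:R != 0 :> K.

Lemma mulrn_inj_char0 m (v w : V) : v *+ m.+1 = w *+ m.+1 -> v = w.
Proof.
move=> /eqP; rewrite -!(scaler_nat m.+1) -subr_eq0 -scalerBr scaler_eq0.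
by rewrite (negbTE (K0 m)) subr_eq0 => /eqP.
Qed.

(** Coefficientwise this is z E' = (z a') E. The summand k = 0 carries the factor 0, so m E_m
    depends only on earlier coefficients, and m is invertible. Identities between exponentials are
    proved below by checking this recursion. *)
Lemma ode_unique (E E' : nat -> V) : E 0%N = E' 0%N ->
  (forall m, E m *+ m = \sum_(k < m.+1) a k (E (m - k)%N) *+ k) ->
  (forall m, E' m *+ m = \sum_(k < m.+1) a k (E' (m - k)%N) *+ k) ->
  E =1 E'.
Proof.
move=> E0 HE HE' m; elim/ltn_ind: m => -[//|m] IH.
apply: (@mulrn_inj_char0 m); rewrite HE HE' big_ord_recl [RHS]big_ord_recl !mulr0n; congr (_ + _).
by apply: eq_bigr => k _; rewrite IH //= /bump; lia.
Qed.

Hypothesis a0 : forall v, a 0%N v = 0.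
Hypothesis aC : forall i j v, a i (a j v) = a j (a i v).

Let pw p := iter p (ops_mul a) (@ops_one K V).

Let pwS p m v : pw p.+1 m v = \sum_(j < m.+1) a j (pw p (m - j)%N v).
Proof. by []. Qed.

Let pw_gt p m v : (m < p)%N -> pw p m v = 0.
Proof.
elim: p m v => // p IH m v mp; rewrite pwS big1// => j _.
case: (posnP j) => [->|j0]; first by rewrite a0.
by rewrite IH ?raddf0//; have := ltn_ord j; lia.
Qed.

(** Leibniz rule z (a^p)' = p (z a') a^(p-1): by [aC] the differentiated factor can be moved to the
    front. For p = 0 the outer factor makes the value of [p.-1] harmless. *)
Let pw_ode p m v : pw p m v *+ m =
  (\sum_(k < m.+1) a k (pw p.-1 (m - k)%N v) *+ k) *+ p.
Proof.
elim: p m v => [|p IH] m v.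
  by rewrite mulr0n /pw /= /ops_one; case: eqP => [->|]; rewrite ?mulr0n ?mul0rn.
rewrite pwS -sumrMnl.
rewrite (eq_bigr (fun j : 'I_m.+1 => a j (pw p (m - j)%N v) *+ j
   + \sum_(k < (m - j).+1) (a k (a j (pw p.-1 (m - j - k)%N v)) *+ k) *+ p)); last first.
  move=> j _; rewrite (mulrn_split _ (leq_ord j)); congr (_ + _).
  rewrite -raddfMn IH raddfMn raddf_sum /= -sumrMnl; apply: eq_bigr => k _.
  by rewrite raddfMn aC.
rewrite big_split /= mulrS; congr (_ + _).
rewrite (triangle_swap m (fun j k => (a k (a j (pw p.-1 (m - j - k)%N v)) *+ k) *+ p)).
rewrite -sumrMnl; apply: eq_bigr => k _.
case: p IH => [|p] IH; first by rewrite mulr0n big1.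
rewrite pwS raddf_sum /= -!sumrMnl.
by apply: eq_bigr => j _; rewrite subnAC.
Qed.

Lemma ops_exp0 v : ops_exp a 0 v = v.
Proof. by rewrite /ops_exp big_ord1 fact0 invr1 scale1r. Qed.

Let expE m v : ops_exp a m v = \sum_(p < m.+1) (p`!%:R)^-1 *: pw p m v.
Proof. by []. Qed.

Let exp_widen m N v : (m < N)%N ->
  ops_exp a m v = \sum_(p < N) (p`!%:R)^-1 *: pw p m v.
Proof.
move=> mN; rewrite expE (big_ord_widen N (fun p => (p`!%:R)^-1 *: pw p m v) mN).
rewrite [RHS](bigID (fun p : 'I_N => (p < m.+1)%N)) /= [X in _ = _ + X]big1 ?addr0//.
by move=> p; rewrite -leqNgt => /pw_gt->; rewrite scaler0.
Qed.

(** The Leibniz rule is summed over p: p / p! = 1 / (p-1)! shifts the index by one. *)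
Lemma ops_exp_ode m v :
  ops_exp a m v *+ m = \sum_(k < m.+1) a k (ops_exp a (m - k) v) *+ k.
Proof.
rewrite expE -sumrMnl big_ord_recl scalerMnr pw_ode mulr0n scaler0 add0r.
rewrite [RHS]big_ord_recl mulr0n add0r.
transitivity (\sum_(p < m) (p`!%:R)^-1 *:
    \sum_(k < m) a (bump 0 k) (pw p (m - bump 0 k)%N v) *+ bump 0 k).
  apply: eq_bigr => p _; rewrite scalerMnr pw_ode lift0 /=.
  rewrite big_ord_recl mulr0n add0r -[_ *+ p.+1]scaler_nat scalerA; congr (_ *: _).
  by rewrite factS natrM invfM -mulrA mulrCA mulVf ?mulr1 ?K0.
under eq_bigr => p _ do rewrite scaler_sumr.
rewrite exchange_big; apply: eq_bigr => k _ /=.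
(* [ops_exp] truncates each degree at its own bound; as a^p vanishes in degrees below p, the common
   bound m can be used instead. *)
rewrite (@exp_widen _ m); last by have := ltn_ord k; rewrite /bump; lia.
rewrite raddf_sum /= -sumrMnl; apply: eq_bigr => p _.
by rewrite linearZ /= scalerMnr.
Qed.

End OperatorExp.

Section ExpFunctor.
Variables (K K' : fieldType) (V : lmodType K) (V' : lmodType K').
Variables (a : nat -> {linear V -> V}) (b : nat -> {linear V' -> V'}).
Hypothesis K0 : forall m, m.+1%:R != 0 :> K.
Hypothesis K0' : forall m, m.+1%:R != 0 :> K'.
Hypothesis a0 : forall v, a 0%N v = 0.
Hypothesis aC : forall i j v, a i (a j v) = a j (a i v).
Hypothesis b0 : forall v, b 0%N v = 0.
Hypothesis bC : forall i j v, b i (b j v) = b j (b i v).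

(** Both sides solve the recursion of [b] with the same initial value. [g] is only additive and the
    two fields may differ, so that the embedding [sext1] of V in V (x) C((u)) is covered too. *)
Lemma ops_exp_intertwine (g : {additive V -> V'}) :
  (forall k v, g (a k v) = b k (g v)) ->
  forall m v, g (ops_exp a m v) = ops_exp b m (g v).
Proof.
move=> gab m v; apply: (@ode_unique _ _ b K0' (fun m => g (ops_exp a m v))
  (fun m => ops_exp b m (g v))).
- by rewrite !ops_exp0.
- move=> k; rewrite -raddfMn ops_exp_ode// raddf_sum; apply: eq_bigr => j _.
  by rewrite raddfMn gab.
- by move=> k; apply: ops_exp_ode.
Qed.

End ExpFunctor.

Section ExpSum.
Variables (K : fieldType) (V : lmodType K).
Variables a b c : nat -> {linear V -> V}.
Hypothesis K0 : forall m, m.+1%:R != 0 :> K.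
Hypothesis a0 : forall v, a 0%N v = 0.
Hypothesis aC : forall i j v, a i (a j v) = a j (a i v).
Hypothesis b0 : forall v, b 0%N v = 0.
Hypothesis bC : forall i j v, b i (b j v) = b j (b i v).
Hypothesis abC : forall i j v, a i (b j v) = b j (a i v).

(** The Cauchy product of the two exponentials satisfies the recursion of a + b by the product rule.
    [c] is a separate family, equal to the sum only pointwise: this is how the operators [hser] of a
    tensor product present themselves. *)
Lemma ops_expD m v : (forall k v, c k v = a k v + b k v) ->
  ops_exp c m v = \sum_(l < m.+1) ops_exp a (m - l) (ops_exp b l v).
Proof.
move=> cE; have c0 w : c 0%N w = 0 by rewrite cE a0 b0 addr0.
have cC i j w : c i (c j w) = c j (c i w).
  by rewrite !cE !linearD /= (aC i) (bC i) !abC addrACA.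
apply: (@ode_unique _ _ c K0 (fun m => ops_exp c m v)
  (fun m => \sum_(l < m.+1) ops_exp a (m - l) (ops_exp b l v))) => {m} [|m|m].
- by rewrite big_ord1 !ops_exp0.
- exact: ops_exp_ode.
have bE k l w : b k (ops_exp a l w) = ops_exp a l (b k w).
  by apply: (ops_exp_intertwine K0 K0 a0 aC a0 aC) => j x; rewrite abC.
rewrite -sumrMnl.
transitivity (\sum_(l < m.+1) \sum_(k < (m - l).+1)
     a k (ops_exp a (m - l - k) (ops_exp b l v)) *+ k
  + \sum_(l < m.+1) \sum_(k < l.+1)
     b k (ops_exp a (m - l) (ops_exp b (l - k) v)) *+ k).
  rewrite -big_split; apply: eq_bigr => l _ /=.
  (* Product rule: the weight m is shared as (m - l) + l between the two factors. *)
  rewrite (mulrn_split _ (leq_ord l)) addrC ops_exp_ode//; congr (_ + _).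
  have lin := ops_exp_linear (fun k : nat => linearP (a k)) (m - l).
  pose f : {linear V -> V} :=
    HB.pack (ops_exp a (m - l)) (GRing.isLinear.Build K V V _ _ lin).
  rewrite -[ops_exp a (m - l) _]/(f _) -raddfMn ops_exp_ode// raddf_sum.
  by apply: eq_bigr => k _; rewrite raddfMn bE.
rewrite (triangle_swap m (fun l k => a k (ops_exp a (m - l - k) (ops_exp b l v)) *+ k)).
rewrite [X in _ + X](eq_bigr (fun l : 'I_m.+1 => \sum_(k < l.+1)
   b k (ops_exp a (m - k - (l - k)) (ops_exp b (l - k) v)) *+ k)); last first.
  move=> l _; apply: eq_bigr => k _; congr (b _ (ops_exp _ _ _) *+ _).
  by have := leq_ord l; have := leq_ord k; lia.
rewrite -(triangle_diag m (fun k j => b k (ops_exp a (m - k - j) (ops_exp b j v)) *+ k)).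
rewrite -big_split; apply: eq_bigr => k _ /=.
rewrite cE mulrnDl !raddf_sum /= -!sumrMnl; congr (_ + _).
by apply: eq_bigr => l _; rewrite subnAC.
Qed.

End ExpSum.

(* Coefficients of (y - t) / (1 - y t) = sum_a fcoef y a t^a. *)
Definition fcoef (F : fieldType) (y : F) (a : nat) : F :=
  if a is b.+1 then y ^+ b.+2 - y ^+ b else y.

(** The logarithmic derivative of f = (y - t) / (1 - y t) is t f' / f = sum over k >= 1 of (y^k -
    y^-k) t^k; the statement is the coefficient of t^a in t f' = (t f' / f) f. *)
Lemma fcoef_ode (F : fieldType) (y : F) a : y != 0 ->
  fcoef y a *+ a =
  \sum_(k < a) (y ^+ k.+1 - y ^- k.+1) * fcoef y (a - k.+1)%N.
Proof.
move=> y0; case: a => [|a]; first by rewrite big_ord0.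
(* Closed form of the partial sums, suited to induction. The last summand is kept apart because it
   involves the exceptional value [fcoef y 0 = y]. *)
have telescope b : (b <= a)%N ->
    \sum_(k < b) (y ^+ k.+1 - y ^- k.+1) * (y ^+ (a - k.+1).+2 - y ^+ (a - k.+1)) =
    (y ^+ a.+2 - y ^+ a) *+ b - y ^+ a + y ^+ (a - b) * y ^- b.
  elim: b => [|b IH] ba; first by rewrite big_ord0 mulr0n subn0 divr1 add0r addNr.
  rewrite big_ord_recr /= IH ?(ltnW ba)// mulrS.
  have [c ->] : exists c, a = (c + b.+1)%N by exists (a - b.+1)%N; rewrite subnK.
  rewrite addnK (_ : c + b.+1 - b = c.+1)%N; last by lia.
  rewrite -!exprVn -(mulr_natl _ b) !(exprS, exprD).
  have := mulVf y0; move: (b%:R : F) (y ^+ c) (y ^+ b) y^-1 (y^-1 ^+ b) => v u w z w' zy.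
  apply/eqP; rewrite -subr_eq0; apply/eqP.
  by transitivity (y * u * w' * (1 - z * y)); [ring | rewrite zy subrr mulr0].
rewrite [fcoef y a.+1]/= big_ord_recr /= subnn.
under eq_bigr => k _ do rewrite subSn ?ltn_ord//= .
rewrite telescope// mulrSr subnn mul1r -!exprVn -(mulr_natl _ a) !exprS.
have := mulVf y0; move: (a%:R : F) (y ^+ a) y^-1 (y^-1 ^+ a) => v w z w' zy.
apply/eqP; rewrite -subr_eq0; apply/eqP.
rewrite /fcoef; by transitivity (w' * (z * y - 1)); [ring | rewrite zy subrr mulr0].
Qed.

(** * Exchange relations *)

Section QPower.
Variables (RR : realType) (q : qparam RR).

Lemma cexpD (z w : RR[i]) : cexp (z + w) = cexp z * cexp w.
Proof.
case: z w => [x y] [x' y']; apply/eqP; rewrite eq_complex /= expRD cosD sinD.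
by apply/andP; split; apply/eqP; ring.
Qed.

Lemma qpowD a b : qpow q (a + b) = qpow q a * qpow q b.
Proof. by rewrite /qpow rmorphD mulrDl cexpD. Qed.

Lemma qpow0 : qpow q 0 = 1.
Proof.
rewrite /qpow rmorph0 mul0r /cexp /= expR0 cos0 sin0 mulr1 mulr0.
by [].
Qed.

Lemma qpow_neq0 a : qpow q a != 0.
Proof.
apply/eqP => h; have := qpowD a (- a); rewrite subrr qpow0 h mul0r => /eqP.
by rewrite oner_eq0.
Qed.

Lemma qval_neq0 : qval q != 0.
Proof. by have := qpow_neq0 1; rewrite /qpow rmorph1 mul1r qlogE. Qed.

Lemma qpowN a : qpow q (- a) = (qpow q a)^-1.
Proof.
apply: (mulfI (qpow_neq0 a)); rewrite mulfV ?qpow_neq0// -qpowD subrr.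
exact: qpow0.
Qed.

Lemma qpow_nat (m : nat) : qpow q m%:R = qval q ^+ m.
Proof.
elim: m => [|m IH]; first by rewrite qpow0.
by rewrite -natr1 qpowD IH exprSr /qpow rmorph1 mul1r qlogE.
Qed.

Lemma qpow_int (m : int) : qpow q m%:~R = qval q ^ m.
Proof.
case: m => m; first exact: qpow_nat.
by rewrite NegzE mulrNz qpowN qpow_nat.
Qed.

Lemma qpow_mulrn a (m : nat) : qpow q (a *+ m) = qpow q a ^+ m.
Proof.
by elim: m => [|m IH]; rewrite ?mulr0n ?qpow0// mulrS qpowD IH exprS.
Qed.

(** Raising to the denominator of a leaves an integral power of q equal to 1, and q is not a root of
    unity. *)
Lemma qpow_eq1 a : qpow q a = 1 -> a = 0.
Proof.
move=> a1; have qn (m : nat) : (0 < m)%N -> qval q ^+ m = 1 -> False.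
  by move=> m0 /eqP; rewrite (negbTE (qnot_unity_root q m0)).
have : qval q ^ numq a = 1.
  rewrite -qpow_int (_ : (numq a)%:~R = a *+ `|denq a|%N).
    by rewrite qpow_mulrn a1 expr1n.
  rewrite -mulr_natr natr_absz ger0_norm ?denq_ge0//.
  by rewrite -{2}(divq_num_den a) divfK// intr_eq0 denq_eq0.
case: (numq a) (numq_eq0 a) => [[|m]|m] /esym/eqP a0; first by rewrite a0.
  by move=> /qn-/(_ isT).
rewrite NegzE -invr_expz => /(congr1 GRing.inv); rewrite invrK invr1.
by move=> /qn-/(_ isT).
Qed.

Lemma qpow_inj : injective (qpow q).
Proof.
move=> a b ab; apply/eqP; rewrite -subr_eq0; apply/eqP/qpow_eq1.
by rewrite qpowD ab qpowN mulfV ?qpow_neq0.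
Qed.

Lemma qval_subV_neq0 : qval q - (qval q)^-1 != 0.
Proof.
rewrite subr_eq0; apply/eqP => qV.
have := qnot_unity_root q (isT : (0 < 2)%N); rewrite expr2 {2}qV mulfV ?qval_neq0//.
by rewrite eqxx.
Qed.

(** The eigenvalues of the k_h determine a weight; this is what separates the weight spaces
    below. *)
Lemma qpow_linear_inj (U : vectType rat) (w w' : 'Hom(U, rat^o)) :
  (forall h, qpow q (w h) = qpow q (w' h)) -> w = w'.
Proof. by move=> ww; apply/lfunP => h; apply/qpow_inj/ww. Qed.

End QPower.

Lemma sgM s : sg s * sg s = 1.
Proof. by case: s. Qed.

Lemma subr_exchange (V : zmodType) (a b c d : V) : a - b = c - d -> a - c = b - d.
Proof.
by move=> /(canRL (subrK _)) ->; rewrite addrAC [c - d]addrC addrK addrC.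
Qed.

Section ModuleFacts.
Variables (RR : realType) (q : qparam RR) (n : nat) (C : cartan_datum n).
Variables (H : realization C) (K : fieldType) (io : {rmorphism RR[i] -> K}).
Variable V : lmodType K.
Variable M : uops H V.
Implicit Types (s : bool) (i j : 'I_n).

Lemma rmorph_char0 m : m.+1%:R != 0 :> K.
Proof. by rewrite -(rmorph_nat io) fmorph_eq0 pnatr_eq0. Qed.
Local Notation K0 := rmorph_char0.

Fact hser_linear s i m : linear (hser q io M s i m).
Proof.
move=> c x y; rewrite /hser; case: eqP => _; first by rewrite scaler0 addr0.
by rewrite linearP scalerDr !scalerA mulrC.
Qed.
HB.instance Definition _ s i m :=
  GRing.isLinear.Build K V V _ (hser q io M s i m) (hser_linear s i m).

Hypothesis HM : is_umodule q io M.

Lemma hser0 s i v : hser q io M s i 0 v = 0.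
Proof. by []. Qed.

Lemma hserE s i m v : (0 < m)%N -> hser q io M s i m v =
  io ((sg s)%:~R * (qval q - (qval q)^-1)) *: uh M i (sg s * m%:Z) v.
Proof. by case: m. Qed.

Lemma sg_mul_neq0 s (m : nat) : (0 < m)%N -> sg s * m%:Z != 0.
Proof. by case: s m => [] []. Qed.

Lemma hser_comm s i m s' j m' v :
  hser q io M s i m (hser q io M s' j m' v) =
  hser q io M s' j m' (hser q io M s i m v).
Proof.
case: (posnP m) => [->|m0]; first by rewrite !hser0 linear0.
case: (posnP m') => [->|m'0]; first by rewrite !hser0 linear0.
rewrite !hserE// !linearZ /= (uhh HM) ?sg_mul_neq0//.
by rewrite !scalerA mulrC.
Qed.

Lemma uk_hser h s i m v :
  uk M h (hser q io M s i m v) = hser q io M s i m (uk M h v).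
Proof.
case: (posnP m) => [->|m0]; first by rewrite !hser0 linear0.
by rewrite !hserE// linearZ /= (ukh HM) ?sg_mul_neq0.
Qed.

Lemma uk_comm h h' v : uk M h (uk M h' v) = uk M h' (uk M h v).
Proof. by rewrite !(ukD HM) addrC. Qed.

Lemma hser_exp s i m s' j m' v :
  hser q io M s i m (ops_exp (hser q io M s' j) m' v) =
  ops_exp (hser q io M s' j) m' (hser q io M s i m v).
Proof.
apply: (@ops_exp_intertwine _ _ _ _ (hser q io M s' j) (hser q io M s' j) K0 K0).
- by [].
- by move=> *; apply: hser_comm.
- by [].
- by move=> *; apply: hser_comm.
- by move=> k w; apply: hser_comm.
Qed.

Lemma uk_exp h s i m v :
  uk M h (ops_exp (hser q io M s i) m v) = ops_exp (hser q io M s i) m (uk M h v).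
Proof.
apply: (@ops_exp_intertwine _ _ _ _ (hser q io M s i) (hser q io M s i) K0 K0).
- by [].
- by move=> *; apply: hser_comm.
- by [].
- by move=> *; apply: hser_comm.
- by move=> k w; apply: uk_hser.
Qed.

Lemma phi_at0 s i v :
  phi q io M s i 0 v = uk M ((sg s * (csym C i)%:Z)%:~R *: coroot H i) v.
Proof. by rewrite /phi (ops_exp0 (hser q io M s i)). Qed.

Lemma phi_ode s i m v : phi q io M s i m v *+ m =
  \sum_(k < m.+1) hser q io M s i k (phi q io M s i (m - k) v) *+ k.
Proof.
rewrite /phi -linearMn (@ops_exp_ode _ _ (hser q io M s i) K0)//; last first.
  by move=> *; apply: hser_comm.
by rewrite linear_sum; apply: eq_bigr => k _; rewrite linearMn /= uk_hser.
Qed.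

Lemma hser_phi s i m s' j m' v :
  hser q io M s i m (phi q io M s' j m' v) =
  phi q io M s' j m' (hser q io M s i m v).
Proof. by rewrite /phi -hser_exp uk_hser. Qed.

Lemma uh_phi i m s j m' v : m != 0 ->
  uh M i m (phi q io M s j m' v) = phi q io M s j m' (uh M i m v).
Proof.
move=> m0; pose s' := (0 <= m); pose c : K := io ((sg s')%:~R * (qval q - (qval q)^-1)).
have c0 : c != 0.
  rewrite fmorph_eq0 mulf_neq0 ?qval_subV_neq0//.
  by rewrite intr_eq0 /sg; case: ifP.
have uhE w : uh M i m w = c^-1 *: hser q io M s' i `|m|%N w.
  rewrite hserE ?absz_gt0// scalerA mulVf// scale1r; congr (uh _ _ _ _).
  by rewrite /s' /sg; case: ifP => ?; lia.
by rewrite !uhE hser_phi linearZ.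
Qed.

Lemma uk_phi h s i m v :
  uk M h (phi q io M s i m v) = phi q io M s i m (uk M h v).
Proof. by rewrite /phi uk_comm uk_exp. Qed.

Lemma phi_comm s i m s' j m' v :
  phi q io M s i m (phi q io M s' j m' v) = phi q io M s' j m' (phi q io M s i m v).
Proof.
rewrite {1}/phi.
rewrite -(@ops_exp_intertwine _ _ _ _ (hser q io M s i) (hser q io M s i) K0 K0
  _ _ _ _ (phi q io M s' j m')); last by move=> k w; apply/esym/hser_phi.
- by rewrite uk_phi.
- by [].
- by move=> *; apply: hser_comm.
- by [].
- by move=> *; apply: hser_comm.
Qed.

(* phi^s_{i,0} x^s'_{j,r} = qB s s' i j x^s'_{j,r} phi^s_{i,0}. *)
Definition qB s s' i j : RR[i] := qval q ^ (sg s * sg s' * bmat C i j).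

Lemma qB_neq0 s s' i j : qB s s' i j != 0.
Proof. by rewrite expfz_neq0 ?qval_neq0. Qed.

Lemma ukx' h s j r v : uk M h (ux M s j r v) =
  io (qpow q ((sg s)%:~R * sroot H j h)) *: ux M s j r (uk M h v).
Proof. by rewrite -(ukx HM) (ukD HM) addNr (uk0 HM). Qed.

Lemma phi0_ux s i s' j r v :
  phi q io M s i 0 (ux M s' j r v) =
  io (qB s s' i j) *: ux M s' j r (phi q io M s i 0 v).
Proof.
rewrite !phi_at0 ukx' linearZ /= sroot_coroot /qB -qpow_int mxE.
congr (io (qpow q _) *: _).
by rewrite -[_ *: _]/(_ * _) !intrM; ring.
Qed.

(** The factor q - q^-1 of [hser] cancels the denominator of the quantum integer. What remains, (y^k
    - y^-k) / k, is the coefficient of t^k in the logarithm of (y - t) / (1 - y t). *)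
Lemma hser_ux s i k s' j r v : (0 < k)%N ->
  hser q io M s i k (ux M s' j r v) =
  ux M s' j r (hser q io M s i k v) +
  (io ((qB s s' i j) ^+ k - (qB s s' i j) ^- k) / k%:R) *:
     ux M s' j (r + sg s * k%:Z) v.
Proof.
move=> k0; rewrite !hserE// linearZ /=.
have := uhx HM i s' j r v (sg_mul_neq0 s k0).
move/(canRL (subrK _)) ->; rewrite scalerDr addrC [sg s * _ + r]addrC scalerA.
congr (_ + _ *: _); rewrite -rmorphM -(rmorph_nat io k) -fmorphV -rmorphM; congr (io _).
rewrite /qint (_ : qB s s' i j ^+ k = qval q ^ (sg s * sg s' * (k%:Z * bmat C i j))).
  rewrite [k%:R in RHS]pmulrn.
  have kn0 : (k%:Z)%:~R != 0 :> RR[i] by rewrite intr_eq0 -lt0n.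
  have := qval_subV_neq0 q; move: (qval q - _ : RR[i]) => d d0.
  have := expfz_neq0 (k%:Z * bmat C i j) (qval_neq0 q).
  case: s; case: s'; rewrite /sg !(mul1r, mulr1, mulN1r, mulNr, opprK) -!invr_expz;
    rewrite ?mulrNz ?mulr1z ?invrK;
    by move: (qval q ^ _ : RR[i]) ((k%:Z)%:~R : RR[i]) kn0 => P x x0 P0; field; rewrite ?d0 ?x0 ?P0.
by rewrite /qB exprnP exprz_exp; congr (_ ^ _); ring.
Qed.

(** The right-hand side satisfies the recursion [phi_ode]: its weight m splits into m - a, absorbed
    by the recursion of phi, and a, absorbed by [fcoef_ode]; together they reproduce the commutator
    [hser_ux]. *)
Lemma phi_ux s i m s' j r v :
  phi q io M s i m (ux M s' j r v) =
  \sum_(a < m.+1) io (fcoef (qB s s' i j) a) *: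
     ux M s' j (r + sg s * a%:Z) (phi q io M s i (m - a) v).
Proof.
set y := qB s s' i j.
apply: (@ode_unique _ _ (hser q io M s i) K0 (fun m => phi q io M s i m (ux M s' j r v))
  (fun m => \sum_(a < m.+1) io (fcoef y a) *:
     ux M s' j (r + sg s * a%:Z) (phi q io M s i (m - a) v))) => {m} [|m|m].
- by rewrite big_ord1 phi0_ux mulr0 addr0.
- exact: phi_ode.
rewrite -sumrMnl.
pose p k := y ^+ k - y ^- k.
transitivity (\sum_(a < m.+1) ((io (fcoef y a) *: ux M s' j (r + sg s * a%:Z)
     (phi q io M s i (m - a) v *+ (m - a))) +
   (io (fcoef y a *+ a) *: ux M s' j (r + sg s * a%:Z) (phi q io M s i (m - a) v)))).
  apply: eq_bigr => a _; rewrite (mulrn_split _ (leq_ord a)) addrC; congr (_ + _).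
    by rewrite linearMn scalerMnr.
  by rewrite rmorphMn scalerMnl.
rewrite big_split /=.
pose X (a : nat) w := ux M s' j (r + sg s * a%:Z) w.
pose ph k := phi q io M s i k v.
(* Multiplied by k, the commutator formula also holds for k = 0, where y^0 - y^-0 vanishes. *)
have hX k a w : hser q io M s i k (X a w) *+ k =
    X a (hser q io M s i k w) *+ k + io (p k) *: X (k + a)%N w.
  case: k => [|k]; first by rewrite !mulr0n /p expr0 invr1 subrr rmorph0 scale0r addr0.
  rewrite /X hser_ux// mulrnDl; congr (_ + _).
  rewrite -scaler_nat scalerA mulrC divfK ?K0//; congr (_ *: ux _ _ _ _ _).
  by rewrite PoszD; ring.
rewrite (eq_bigr (fun a : 'I_m.+1 => \sum_(k < (m - a).+1)
    io (fcoef y a) *: (X a (hser q io M s i k (ph (m - a - k)%N)) *+ k))); last first.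
  move=> a _; rewrite phi_ode linear_sum scaler_sumr /=.
  by apply: eq_bigr => k _; rewrite linearMn.
rewrite (triangle_swap m (fun a k => io (fcoef y a) *:
  (X a (hser q io M s i k (ph (m - a - k)%N)) *+ k))).
rewrite [X in _ + X](eq_bigr (fun t : 'I_m.+1 => \sum_(k < t.+1)
    io (p k * fcoef y (t - k)%N) *: X (k + (t - k))%N (ph (m - k - (t - k))%N))); last first.
  move=> t _; rewrite fcoef_ode ?qB_neq0// rmorph_sum scaler_suml big_ord_recl.
  rewrite /p expr0 invr1 subrr mul0r rmorph0 scale0r add0r; apply: eq_bigr => k _.
  have tk : (bump 0 k + (t - bump 0 k))%N = t by have := ltn_ord k; rewrite /bump; lia.
  rewrite -[X in fcoef _ (t - X)]/(bump 0 k) tk; congr (_ *: ux _ _ _ _ (phi _ _ _ _ _ _ _)).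
  by rewrite -{1}tk subnDA.
rewrite -(triangle_diag m (fun k a => io (p k * fcoef y a) *: X (k + a)%N (ph (m - k - a)%N))).
rewrite -big_split; apply: eq_bigr => k _ /=.
rewrite linear_sum -sumrMnl -big_split; apply: eq_bigr => a _ /=.
rewrite linearZ /= scalerMnr -/(X _ _) hX scalerDr scalerA -rmorphM [_ * p k]mulrC.
by rewrite subnAC.
Qed.

(** Multiplying by 1 - y t clears the denominator of the exchange function and leaves y - t: the
    later coefficients cancel because [fcoef y a.+2 = y * fcoef y a.+1]. *)
Lemma phi_ux_rec s i m s' j r v : let y := io (qB s s' i j) in
  phi q io M s i m.+1 (ux M s' j r v) - y *: phi q io M s i m (ux M s' j (r + sg s) v) =
  y *: ux M s' j r (phi q io M s i m.+1 v) - ux M s' j (r + sg s) (phi q io M s i m v).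
Proof.
move=> y; rewrite !phi_ux big_ord_recl subn0 mulr0 addr0.
rewrite -addrA; congr (_ + _).
rewrite [X in X - _]big_ord_recl lift0 subSS subn0 mulr1.
rewrite [X in _ - _ *: X]big_ord_recl subn0 mulr0 addr0 scalerDr opprD addrACA scalerA.
rewrite /y -rmorphM -scalerBl -rmorphB.
have -> : fcoef (qB s s' i j) 1 - qB s s' i j * fcoef (qB s s' i j) 0 = -1.
  by rewrite /fcoef expr0; ring.
rewrite rmorphN1 scaleN1r -[RHS]addr0; congr (_ + _).
rewrite scaler_sumr -sumrB big1// => a _; rewrite scalerA -rmorphM !lift0.
have -> : fcoef (qB s s' i j) a.+2 = qB s s' i j * fcoef (qB s s' i j) a.+1.
  by rewrite /fcoef mulrBr -!exprS.
rewrite subSS; apply/eqP; rewrite subr_eq0; apply/eqP; congr (_ *: ux _ _ _ _ _).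
by rewrite (intS a.+1); ring.
Qed.

Lemma qBC s s' i j : qB s s' i j = qB s s' j i.
Proof. by rewrite /qB !mxE (cmat_sym C). Qed.

Lemma phiE s i (m : nat) v : phiz q io M s i (sg s * m%:Z) v = phi q io M s i m v.
Proof. by rewrite /phiz mulrA sgM mul1r abszM; case: s; rewrite mul1n. Qed.

Lemma phiz0 s i (m : int) v : sg s * m < 0 -> phiz q io M s i m v = 0.
Proof. by rewrite /phiz ltNge => /negbTE->. Qed.

(* The next four relations make the cross terms cancel when the quadratic
   relation between the x's is expanded on a tensor product. *)
Lemma ux_phi_recp i j r k v : let c := io (qval q ^ bmat C i j) in
  ux M true i (r + 1) (phi q io M false j k.+1 v)
    - c *: phi q io M false j k.+1 (ux M true i (r + 1) v) =
  c *: ux M true i r (phi q io M false j k v) - phi q io M false j k (ux M true i r v).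
Proof.
move=> c; have := phi_ux_rec false j k true i (r + 1) v => /=.
have y0 : io (qB false true j i) = c^-1.
  by rewrite qBC /c -fmorphV /qB mulr1 mulN1r invr_expz.
have c0 : c != 0 by rewrite fmorph_eq0 expfz_neq0 ?qval_neq0.
rewrite y0 addrK => /(congr1 (fun w => c *: w)).
rewrite !scalerBr !scalerA mulfV// !scale1r => h.
exact/subr_exchange/esym.
Qed.

Lemma ux_phi0p i j r v : let c := io (qval q ^ bmat C i j) in
  ux M true i (r + 1) (phi q io M false j 0 v)
    - c *: phi q io M false j 0 (ux M true i (r + 1) v) = 0.
Proof.
move=> c; rewrite phi0_ux scalerA -rmorphM (_ : _ * _ = 1) ?rmorph1 ?scale1r ?subrr//.
by rewrite qBC /qB mulr1 mulN1r -expfzDr ?qval_neq0// subrr.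
Qed.

Lemma ux_phi_recm i j r k v : let c := io (qval q ^ (- bmat C i j)) in
  ux M false i (r + 1) (phi q io M true j k v)
    - c *: phi q io M true j k (ux M false i (r + 1) v) =
  c *: ux M false i r (phi q io M true j k.+1 v) - phi q io M true j k.+1 (ux M false i r v).
Proof.
move=> c; have := phi_ux_rec true j k false i r v => /=.
have -> : io (qB true false j i) = c by rewrite qBC /c /qB mul1r mulN1r.
by move/subr_exchange => h; rewrite -opprB -h opprB.
Qed.

Lemma ux_phi0m i j r v : let c := io (qval q ^ (- bmat C i j)) in
  c *: ux M false i r (phi q io M true j 0 v) - phi q io M true j 0 (ux M false i r v) = 0.
Proof.
move=> c; rewrite phi0_ux qBC /qB mul1r mulN1r subrr//.
Qed.

Fact phiz_linear s i (m : int) : linear (phiz q io M s i m).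
Proof.
by move=> c x y; rewrite /phiz; case: ifP => _; rewrite ?linearP// scaler0 addr0.
Qed.
HB.instance Definition _ s i m :=
  GRing.isLinear.Build K V V _ (phiz q io M s i m) (phiz_linear s i m).

End ModuleFacts.

(** * u-adic series *)

Section LaurentSeries.
Variable F : fieldType.
Local Notation L := (laurent F).
Implicit Types (f g : L) (p : int).

(** Valuation at least p: the same body as [upow], over an arbitrary field, so that bounds of either
    form convert to the other. *)
Definition vge p f := forall m, m < p -> f m = 0.

Lemma vge_ex f : exists p, vge p f.
Proof. by have /bounded_belowP := lcoefP f. Qed.

Lemma vge0 p : vge p (0 : L).
Proof. by []. Qed.

Lemma vgeW p p' f : p' <= p -> vge p f -> vge p' f.
Proof. by move=> pp fp m mp; apply: fp; apply: lt_le_trans pp. Qed.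

Lemma vgeD p f g : vge p f -> vge p g -> vge p (f + g).
Proof. by move=> fp gp m mp; rewrite coefLD fp ?gp ?addr0. Qed.

Lemma coefLN f m : (- f) m = - f m.
Proof. by []. Qed.

Lemma vgeN p f : vge p f -> vge p (- f).
Proof. by move=> fp m mp; rewrite coefLN fp ?oppr0. Qed.

Lemma vgeB p f g : vge p f -> vge p g -> vge p (f - g).
Proof. by move=> fp gp; apply/vgeD/vgeN. Qed.

Lemma vgeM p p' f g : vge p f -> vge p' g -> vge (p + p') (f * g).
Proof. by move=> fp gp m; apply: lconv_lb. Qed.

Lemma vgeMl p p' f g : vge p f -> vge p' g -> forall p'', p'' <= p + p' -> vge p'' (f * g).
Proof. by move=> fp gp p'' pp; apply/(vgeW pp)/vgeM. Qed.

Lemma vge_sum p (I : Type) (r : seq I) (P : pred I) (E : I -> L) :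
  (forall i, P i -> vge p (E i)) -> vge p (\sum_(i <- r | P i) E i).
Proof. by move=> h; apply: (big_ind (vge p)) => //; apply: vgeD. Qed.

Lemma vge_lconst c : vge 0 (lconst c).
Proof. by move=> m; rewrite /= /lconst_fun; case: ltgtP. Qed.

Lemma vge_eq0 f : (forall p, vge p f) -> f = 0.
Proof. by move=> h; apply: laurentP => m; apply: (h (m + 1)); lia. Qed.

Lemma vge_lu : vge 1 (lu F).
Proof. by move=> m; rewrite /= /lu_fun; case: ltgtP. Qed.

Let luE (m : int) : lu F m = if m == 1 then 1 else 0.
Proof. by []. Qed.

(** The inverse in [laurent] is obtained by choice, so its coefficients do not compute. This
    explicit series is identified with u^-1 through uniqueness of inverses. *)
Let luV_fun (m : int) : F := if m == -1 then 1 else 0.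
Let luV_funP : luV_fun \in @bounded_below F.
Proof. by apply/bounded_belowP; exists (-1) => m; rewrite /luV_fun; case: ltgtP. Qed.
Let luV : L := Laurent luV_funP.

Let lu_luV : lu F * luV = 1.
Proof.
apply: laurentP => m; change (lconv (lu F) luV m = lconst_fun 1 m).
have lV : vge (-1) luV by move=> k; rewrite /= /luV_fun; case: ltgtP.
have [m0|m0] := ltrP m 0.
  by rewrite (lconv_lb vge_lu lV) ?subrr// /lconst_fun; case: ltgtP m0.
have -> : m = 1 + -1 + `|m|%N%:Z by lia.
rewrite (lconvE _ vge_lu lV) big_ord_recl big1 => [|j _]; last first.
  have -> : lu F (1 + (lift ord0 j)%:Z) = 0.
    by rewrite luE; case: eqP; rewrite // lift0; lia.
  by rewrite mul0r.
rewrite addr0 luE /= /luV_fun /lconst_fun mul1r.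
by do 2!case: eqP => //; lia.
Qed.

Lemma lu_neq0 : lu F != 0.
Proof. by apply/eqP => h; have := lu_luV; rewrite h mul0r => /esym/eqP; rewrite oner_eq0. Qed.

Let luVE : (lu F)^-1 = luV.
Proof. by apply: (mulfI lu_neq0); rewrite mulfV ?lu_neq0// lu_luV. Qed.

Lemma coef_luV (m : int) : (lu F)^-1 m = if m == -1 then 1 else 0.
Proof. by rewrite luVE. Qed.

Lemma vge_luX k : vge k (lu F ^ k).
Proof.
have lV : vge (-1) luV by move=> m; rewrite /= /luV_fun; case: ltgtP.
case: k => k.
  elim: k => [|k IH]; first exact: vge_lconst.
  rewrite -exprnP exprS; apply: (vgeMl vge_lu IH); lia.
rewrite NegzE -exprz_inv luVE; elim: k => [|k IH]; first by rewrite expr1z.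
rewrite -exprnP exprS; apply: (vgeMl lV IH); lia.
Qed.

Definition lsum (c : nat -> L) (s : L) :=
  forall p, exists N0 : nat, forall N, (N0 <= N)%N -> vge p (\sum_(l < N) c l - s).

Lemma lsum0 : lsum (fun=> 0) 0.
Proof. by move=> p; exists 0%N => N _; rewrite big1 // subrr. Qed.

Lemma lsumD c s c' s' : lsum c s -> lsum c' s' -> lsum (fun l => c l + c' l) (s + s').
Proof.
move=> cs cs' p; have [N0 h] := cs p; have [N0' h'] := cs' p.
exists (maxn N0 N0') => N; rewrite geq_max => /andP[/h ? /h' ?].
by rewrite big_split /= opprD addrACA; apply: vgeD.
Qed.

Lemma lsumM a c s : lsum c s -> lsum (fun l => a * c l) (a * s).
Proof.
move=> cs p; have [k ak] := vge_ex a; have [N0 h] := cs (p - k).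
exists N0 => N /h ?; rewrite -mulr_sumr -mulrBr; apply: (vgeMl ak); first eassumption.
by rewrite addrC subrK.
Qed.

Lemma lsum_unique c s s' : lsum c s -> lsum c s' -> s = s'.
Proof.
move=> cs cs'; apply/eqP; rewrite -subr_eq0; apply/eqP/vge_eq0 => p.
have [N h] := cs p; have [N' h'] := cs' p.
set x := \sum_(l < maxn N N') c l.
have -> : s - s' = (x - s') - (x - s) by ring.
exact: vgeB (h' _ (leq_maxr N N')) (h _ (leq_maxl N N')).
Qed.

Lemma lsum_vge p c s : (forall l, vge p (c l)) -> lsum c s -> vge p s.
Proof.
move=> cp cs; have [N h] := cs p.
rewrite -[s](subKr (\sum_(l < N) c l)); apply: vgeB; last exact: h.
by apply: vge_sum.
Qed.

Lemma lsum_cvg0 c s : lsum c s -> forall p, exists N0 : nat, forall l, (N0 <= l)%N -> vge p (c l).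
Proof.
move=> cs p; have [N h] := cs p; exists N => l Nl.
have := vgeB (h l.+1 (leqW Nl)) (h l Nl); rewrite big_ord_recr /=.
by congr vge; ring.
Qed.

(** The coefficient of u^m receives only the terms l <= m + k, so the limit can be written down
    coefficient by coefficient. When m + k < 0 every term vanishes in degree m, and the absolute
    value in the range is harmless. *)
Lemma lsum_ex c (k : int) : (forall l : nat, vge (l%:Z - k) (c l)) -> exists s, lsum c s.
Proof.
move=> ck; pose sf (m : int) : F := \sum_(l < (absz (m + k)%R).+1) c l m.
have sfP : sf \in @bounded_below F.
  by apply/bounded_belowP; exists (- k) => m mk; apply: big1 => l _; apply: ck; lia.
exists (Laurent sfP) => p; exists (absz (p + k)) => N pN m mp.
rewrite coefLD coefLN /= /sf (_ : lcoef (\sum_(l < N) c l) m = \sum_(l < N) c l m); last first.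
  by elim/big_ind2: _ => // x a y b <- <-.
apply/eqP; rewrite subr_eq0; apply/eqP.
have [mk|mk] := ltrP m (- k).
  by rewrite !big1// => l _; apply: ck; lia.
have mN : ((absz (m + k)%R).+1 <= N)%N by lia.
rewrite [RHS](big_ord_widen N (fun l => c l m) mN) [LHS](bigID (fun l : 'I_N => (l < (absz (m + k)%R).+1)%N)) /=.
by rewrite [X in _ + X]big1 ?addr0// => l; rewrite -leqNgt => ml; apply: ck; lia.
Qed.

Lemma lsum_recl c s : lsum c s <-> lsum (fun l => c l.+1) (s - c 0%N).
Proof.
have E N : \sum_(l < N.+1) c l - s = \sum_(l < N) c l.+1 - (s - c 0%N).
  by rewrite big_ord_recl opprB addrCA addrA.
split=> cs p; have [N0 h] := cs p; last first.
  by exists N0.+1 => -[//|N] /h; rewrite E.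
by exists N0 => N N0N; rewrite -E; apply: h; apply: leqW.
Qed.

Lemma lsum_cauchy c s d r : lsum c s -> lsum d r ->
  lsum (fun N => \sum_(l < N.+1) c l * d (N - l)%N) (s * r).
Proof.
move=> cs dr p.
have E N : \sum_(m < N) \sum_(l < m.+1) c l * d (m - l)%N =
    \sum_(l < N) c l * \sum_(k < N - l) d k.
  case: N => [|N]; first by rewrite !big_ord0.
  rewrite -(triangle_diag N (fun l k => c l * d k)).
  by apply: eq_bigr => l _; rewrite mulr_sumr subSn// -ltnS.
(* A convergent sequence has valuations bounded below: only finitely many terms escape the bound
   given by convergence. *)
have bnd (x : nat -> L) (y : L) : (forall q, exists N0 : nat, forall l, (N0 <= l)%N -> vge q (x l - y)) ->
    exists q, forall l, vge q (x l - y).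
  move=> xy; have [N0 h] := xy 0.
  have [q hq] : exists q, forall l, (l < N0)%N -> vge q (x l - y).
    elim: N0 {h} => [|N0 [q hq]]; first by exists 0.
    have [q' hq'] := vge_ex (x N0 - y); exists (Num.min q q') => l.
    rewrite ltnS leq_eqVlt => /predU1P[->|/hq]; first by apply: vgeW hq'; lia.
    by apply: vgeW; lia.
  exists (Num.min q 0) => l; have [/hq|/h] := ltnP l N0; apply: vgeW; lia.
have [qc hc] : exists q, forall l, vge q (c l).
  have [q hq] : exists q, forall l, vge q (c l - 0).
    by apply: bnd => q; have [N h] := lsum_cvg0 cs q; exists N => l /h; rewrite subr0.
  by exists q => l; rewrite -[c l]subr0.
have [qd hd] := bnd (fun N => \sum_(k < N) d k) r dr.
have [qr hr] := vge_ex r.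
have [N1 h1] := lsum_cvg0 cs (p - qd).
have [N2 h2] := dr (p - qc).
have [N3 h3] := cs (p - qr).
(* For l >= N1 the coefficient c_l is small; for l < N1 at least N2 terms of d are summed, so their
   sum is close to r; N3 makes the partial sum of c close to s. *)
exists (N1 + N2 + N3)%N => N NN; rewrite E.
rewrite (_ : _ - s * r = \sum_(l < N) c l * (\sum_(k < N - l) d k - r) + (\sum_(l < N) c l - s) * r).
  apply: vgeD; last by apply: (vgeMl (h3 N _) hr); lia.
  apply: vge_sum => l _; have [l1|l1] := ltnP l N1.
    by apply: (vgeMl (hc l) (h2 _ _)); lia.
  by apply: (vgeMl (h1 l l1) (hd _)); lia.
rewrite mulrBl addrA mulr_suml -big_split; congr (_ - _); apply: eq_bigr => l _ /=.
by rewrite mulrBr subrK.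
Qed.

End LaurentSeries.

Section USum.
Variables (F : fieldType).
Local Notation L := (laurent F).

(* [usum W t s]: the series of general term [t] converges to [s] u-adically
   inside the span of finitely many elements of [W]. *)
Inductive usum (V : lmodType L) (W : V -> Prop) : (nat -> V) -> V -> Prop :=
| usum_nil : usum W (fun=> 0) 0
| usum_cons c cs e t s : W e -> lsum c cs -> usum W t s ->
    usum W (fun l => c l *: e + t l) (cs *: e + s).

Section Theory.
Variables (V : lmodType L).
Implicit Types (W : V -> Prop) (t : nat -> V).

Lemma usum_ext W t t' s s' : usum W t s -> t =1 t' -> s = s' -> usum W t' s'.
Proof. by move=> h /funext <- <-. Qed.

Lemma usumD W t s t' s' : usum W t s -> usum W t' s' -> usum W (fun l => t l + t' l) (s + s').
Proof.
elim=> {t s} [|c cs e t s We ccs _ IH] h.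
  by apply: (usum_ext h) => [l|]; rewrite add0r.
apply: (usum_ext (usum_cons We ccs (IH h))) => [l|]; by rewrite addrA.
Qed.

Lemma usumZ W a t s : usum W t s -> usum W (fun l => a *: t l) (a *: s).
Proof.
elim=> {t s} [|c cs e t s We ccs _ IH].
  by apply: (usum_ext (usum_nil W)) => [l|]; rewrite scaler0.
by apply: (usum_ext (usum_cons We (lsumM a ccs) IH)) => [l|]; rewrite scalerDr scalerA.
Qed.

Lemma usumN W t s : usum W t s -> usum W (fun l => - t l) (- s).
Proof. by move=> /(usumZ (-1)) h; apply: (usum_ext h) => [l|]; rewrite scaleN1r. Qed.

Lemma usumB W t s t' s' : usum W t s -> usum W t' s' -> usum W (fun l => t l - t' l) (s - s').
Proof. by move=> ts /usumN; apply: usumD. Qed.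

Lemma usum_sum W (I : Type) (r : seq I) (P : pred I) (t : I -> nat -> V) (s : I -> V) :
  (forall i, P i -> usum W (t i) (s i)) ->
  usum W (fun l => \sum_(i <- r | P i) t i l) (\sum_(i <- r | P i) s i).
Proof.
move=> h; elim: r => [|i r IH].
  by apply: (usum_ext (usum_nil W)) => [l|]; rewrite big_nil.
case Pi: (P i); last by apply: (usum_ext IH) => [l|]; rewrite big_cons Pi.
by apply: (usum_ext (usumD (h i Pi) IH)) => [l|]; rewrite big_cons Pi.
Qed.

Lemma usum_one W c cs e : W e -> lsum c cs -> usum W (fun l => c l *: e) (cs *: e).
Proof.
move=> We ccs; apply: (usum_ext (usum_cons We ccs (usum_nil W))) => [l|]; by rewrite addr0.
Qed.

Lemma usumW W W' t s : (forall e, W e -> W' e) -> usum W t s -> usum W' t s.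
Proof.
move=> WW'; elim=> {t s} [|c cs e t s We ccs _ IH]; first exact: usum_nil.
by apply: usum_cons => //; apply: WW'.
Qed.

Lemma usum_recl W t s : usum W t s -> usum W (fun l => t l.+1) (s - t 0%N).
Proof.
elim=> {t s} [|c cs e t s We ccs _ IH].
  by apply: (usum_ext (usum_nil W)) => //; rewrite subrr.
apply: (usum_ext (usum_cons We (iffLR (lsum_recl c cs) ccs) IH)) => //.
by rewrite scalerBl opprD addrACA.
Qed.

Lemma usum_delay W t s : usum W t s ->
  usum W (fun l => if l is l'.+1 then t l' else 0) s.
Proof.
elim=> {t s} [|c cs e t s We ccs _ IH].
  by apply: (usum_ext (usum_nil W)) => // -[].
pose c' l := if l is l'.+1 then c l' else 0.
have ccs' : lsum c' cs by apply/lsum_recl; rewrite subr0.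
apply: (usum_ext (usum_cons We ccs' IH)) => // -[|l] //=.
by rewrite scale0r addr0.
Qed.

Lemma usum_fin W t N : (forall l, (N <= l)%N -> t l = 0) -> (forall l, W (t l)) ->
  usum W t (\sum_(l < N) t l).
Proof.
elim: N t => [|N IH] t tN tW.
  by apply: (usum_ext (usum_nil W)) => [l|]; rewrite ?big_ord0 ?tN.
pose c l : L := if l is 0%N then 1 else 0.
have c1 : lsum c 1 by apply/lsum_recl; rewrite subrr; apply: lsum0.
have := usum_delay (IH (fun l => t l.+1) (fun l Nl => tN l.+1 Nl) (fun l => tW l.+1)).
move/(usumD (usum_one (tW 0%N) c1)) => h; apply: (usum_ext h).
  by case=> [|l]; rewrite ?scale1r ?scale0r ?addr0 ?add0r.
by rewrite scale1r big_ord_recl.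
Qed.

(** The sums over k >= 0 and over k >= m have the same nonzero terms. The starting point moves by
    one at a time: [usum_recl] drops a zero term, [usum_delay] inserts one. *)
Lemma usum_zshift W (g : int -> V) (m : int) s :
  (forall k, k < 0 -> g k = 0) -> (forall k, k < m -> g k = 0) ->
  usum W (fun k : nat => g k%:Z) s -> usum W (fun l : nat => g (m + l%:Z)) s.
Proof.
move=> g0; case: m => m.
  elim: m => [|m IH] gm gs; first by apply: (usum_ext gs) => // l; rewrite add0r.
  have gm' k : k < m%:Z -> g k = 0 by move=> km; apply: gm; lia.
  apply: (usum_ext (usum_recl (IH gm' gs))) => [l|]; first by congr g; lia.
  by rewrite gm ?subr0//; lia.
elim: m => [|m IH] _ gs.
  apply: (usum_ext (usum_delay gs)) => // -[|l]; last by congr g; lia.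
  by rewrite g0.
have gm' k : k < Negz m -> g k = 0 by move=> km; apply: g0; lia.
apply: (usum_ext (usum_delay (IH gm' gs))) => // -[|l]; last by congr g; lia.
by rewrite g0.
Qed.

End Theory.

(** Linearity is enough: a [usum] involves finitely many vectors, and the limit is taken in their
    coefficients. *)
Lemma usum_linear (V V' : lmodType L) (W : V -> Prop) (W' : V' -> Prop)
    (f : {linear V -> V'}) t s :
  (forall e, W e -> W' (f e)) -> usum W t s -> usum W' (fun l => f (t l)) (f s).
Proof.
move=> fW; elim=> {t s} [|c cs e t s We ccs _ IH].
  by apply: (usum_ext (usum_nil W')) => [l|]; rewrite linear0.
by apply: (usum_ext (usum_cons (fW _ We) ccs IH)) => [l|]; rewrite linearP.
Qed.

Local Notation all := (fun=> True).

Lemma usum_map (V V' : lmodType L) (f : {linear V -> V'}) t s :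
  usum all t s -> usum all (fun l => f (t l)) (f s).
Proof. exact: usum_linear. Qed.

(** The way back to scalar series, from which uniqueness of limits and the valuations of their
    coordinates are obtained. *)
Lemma usum_functional (V : lmodType L) W (f : {linear V -> L^o}) t s :
  usum W t s -> lsum (fun l => f (t l)) (f s).
Proof.
elim=> {t s} [|c cs e t s We ccs _ IH].
  by rewrite linear0; apply: lsum0.
rewrite linearP (_ : (fun l => _) = (fun l => f e * c l + f (t l))).
  rewrite [cs *: _]mulrC; apply: lsumD => //; exact: lsumM.
by apply/funext => l; rewrite linearP [_ *: _]mulrC.
Qed.

(** By induction on [t] it suffices to treat the terms c_l e with e fixed. The Cauchy product is
    then that of c with the convergent series of the X_l e, and [lsum_cauchy] applies to each
    coefficient of the latter. *)
Lemma usum_cauchy (V V' : lmodType L) (X : nat -> {linear V -> V'}) (Xs : V -> V') t s :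
  (forall v, usum all (fun l => X l v) (Xs v)) -> linear Xs -> usum all t s ->
  usum all (fun N => \sum_(l < N.+1) X l (t (N - l)%N)) (Xs s).
Proof.
move=> HX lin; pose f : {linear V -> V'} := HB.pack Xs (GRing.isLinear.Build L V V' _ _ lin).
elim=> {t s} [|c cs e t s _ ccs _ IH].
  apply: (usum_ext (usum_nil _)) => [N|]; first by rewrite big1// => l _; rewrite linear0.
  by rewrite -[Xs]/(f : _ -> _) linear0.
have gen y r : usum all y r ->
    usum all (fun N => \sum_(l < N.+1) c (N - l)%N *: (y l : V')) (cs *: r).
  elim=> {y r} [|d ds x y r _ dds _ IH'].
    apply: (usum_ext (usum_nil _)) => [N|]; last by rewrite scaler0.
    by rewrite big1// => l _; rewrite scaler0.
  have := usumD (@usum_one _ all _ _ x I (lsum_cauchy dds ccs)) IH'.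
  move=> h; apply: (usum_ext h) => [N|]; last by rewrite scalerDr scalerA mulrC.
  rewrite scaler_suml -big_split; apply: eq_bigr => l _ /=.
  by rewrite scalerDr scalerA mulrC.
apply: (usum_ext (usumD (gen _ _ (HX e)) IH)) => [N|].
  by rewrite -big_split; apply: eq_bigr => l _; rewrite linearP.
by rewrite -[Xs]/(f : _ -> _) linearP.
Qed.

End USum.

(** * The fused module *)

Section LinearClosure.
Variables (F : comNzRingType) (U V W : lmodType F).

Lemma linear_idE : linear (fun v : U => v).
Proof. by []. Qed.

Lemma linear_addE (f g : U -> V) : linear f -> linear g -> linear (fun v => f v + g v).
Proof. by move=> fl gl c x y; rewrite fl gl scalerDr addrACA. Qed.

Lemma linear_oppE (f : U -> V) : linear f -> linear (fun v => - f v).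
Proof. by move=> fl c x y; rewrite fl opprD scalerN. Qed.

Lemma linear_scaleE a (f : U -> V) : linear f -> linear (fun v => a *: f v).
Proof. by move=> fl c x y; rewrite fl scalerDr !scalerA mulrC. Qed.

Lemma linear_compE (h : {linear V -> W}) (f : U -> V) :
  linear f -> linear (fun v => h (f v)).
Proof. by move=> fl c x y; rewrite fl linearP. Qed.

Lemma linear_zeroE : linear (fun _ : U => 0 : V).
Proof. by move=> c x y; rewrite scaler0 addr0. Qed.

Lemma linear_sumE (I : Type) (r : seq I) (P : pred I) (f : I -> U -> V) :
  (forall i, linear (f i)) -> linear (fun v => \sum_(i <- r | P i) f i v).
Proof.
move=> fl c x y; rewrite scaler_sumr -big_split; apply: eq_bigr => i _; exact: fl.
Qed.

End LinearClosure.

(** Proves linearity by following the syntax of an operator expression. It discharges the side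
    conditions of [tens_ext] and [sext_ext], by which identities are reduced to pure tensors. *)
Ltac lin := lazymatch goal with
  | |- forall _ : _, _ => let i := fresh "i" in intro i; lin
  | |- GRing.linear_for _ (fun v => v) => exact: linear_idE
  | |- _ => first
    [ by []
    | exact: linearP
    | (refine (linear_addE _ _)); lin
    | (refine (linear_oppE _)); lin
    | (refine (linear_scaleE _ _)); lin
    | (refine (linear_sumE _ _ _)); lin
    | (refine (linear_compE _ _)); lin
    | exact: linear_zeroE ]
  end.

Lemma tens_ext (F : comNzRingType) (A B W : lmodType F) (f g : tens A B -> W) :
  linear f -> linear g -> (forall a b, f (tpure a b) = g (tpure a b)) -> f =1 g.
Proof.
move=> fl gl fg x.
pose f' : {linear _ -> _} := HB.pack f (GRing.isLinear.Build F _ _ _ _ fl).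
pose g' : {linear _ -> _} := HB.pack g (GRing.isLinear.Build F _ _ _ _ gl).
rewrite -[f]/(f' : _ -> _) -[g]/(g' : _ -> _).
elim/tens_ind: x => [|x y Ex Ey|a b]; rewrite ?linear0 ?linearD ?Ex ?Ey//.
Qed.

Lemma scaler_swap (K : comNzRingType) (V : lmodType K) (a b : K) (v : V) :
  a *: (b *: v) = b *: (a *: v).
Proof. by rewrite !scalerA mulrC. Qed.

(** The letters [p] and [s] stand for the first term and the series part of each factor, so that a
    commutator twisted by c splits into four. *)
Lemma twisted_comm_sum (K : fieldType) (V : lmodType K) (c : K)
    (pp ps sp ss pp' ps' sp' ss' : V) :
  pp + ps + (sp + ss) - c *: (pp' + sp' + (ps' + ss')) =
  (pp - c *: pp') + (ps - c *: ps') + ((sp - c *: sp') + (ss - c *: ss')).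
Proof.
rewrite [pp' + sp' + _]addrACA !scalerDr !opprD [LHS]addrACA.
by congr (_ + _); rewrite addrACA.
Qed.

Section TensorZero.
Variables (F : comNzRingType) (A B : lmodType F).

Lemma tpure0l (b : B) : tpure (0 : A) b = 0.
Proof. by rewrite -(scale0r 0) tpureZl scale0r. Qed.

Lemma tpure0r (a : A) : tpure a (0 : B) = 0.
Proof. by rewrite -(scale0r 0) tpureZr scale0r. Qed.

Lemma tpureBl (a a' : A) (b : B) : tpure (a - a') b = tpure a b - tpure a' b.
Proof. by rewrite -scaleN1r tpureDl tpureZl scaleN1r. Qed.

Lemma tpureBr (a : A) (b b' : B) : tpure a (b - b') = tpure a b - tpure a b'.
Proof. by rewrite -scaleN1r tpureDr tpureZr scaleN1r. Qed.

Lemma tpureMnl (a : A) (b : B) m : tpure (a *+ m) b = tpure a b *+ m.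
Proof. by rewrite -!scaler_nat tpureZl. Qed.

Lemma tpureMnr (a : A) (b : B) m : tpure a (b *+ m) = tpure a b *+ m.
Proof. by rewrite -!scaler_nat tpureZr. Qed.

Lemma tpure_suml (I : Type) (r : seq I) (P : pred I) (a : I -> A) (b : B) :
  tpure (\sum_(i <- r | P i) a i) b = \sum_(i <- r | P i) tpure (a i) b.
Proof.
exact: (big_morph (fun a' : A => tpure a' b) (fun a1 a2 => tpureDl a1 a2 b) (tpure0l b)).
Qed.

Lemma tpure_sumr (I : Type) (r : seq I) (P : pred I) (a : A) (b : I -> B) :
  tpure a (\sum_(i <- r | P i) b i) = \sum_(i <- r | P i) tpure a (b i).
Proof.
exact: (big_morph (fun b' : B => tpure a b') (tpureDr a) (tpure0r a)).
Qed.

End TensorZero.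

Ltac tens_pure v := move: v; refine (tens_ext _ _ _); [lin | lin | ]; cbv beta.

Section Fusion.
Variables (RR : realType) (q : qparam RR) (n : nat) (C : cartan_datum n).
Variables (H : realization C).
Local Notation L := (laurent RR[i]).
Local Notation lc := (@lconst RR[i]).
Local Notation u := (lu RR[i]).
Local Notation all := (fun=> True).
Variables (VA VB : lmodType L) (A : uops H VA) (B : uops H VB).
Hypothesis HA : is_umodule q lc A.
Hypothesis HV : is_umodule q lc B.
Local Notation T := (tens VA VB).
Local Notation phi := (phi q lc).
Implicit Types (i j : 'I_n) (r : int) (v : T).

Definition xp_term i r (l : nat) v : T :=
  u ^ (r + l%:Z) *: tmap (phi A false i l) (ux B true i (r + l%:Z)) v.
Definition xm_term i r (l : nat) v : T :=
  u ^ l%:Z *: tmap (ux A false i (r - l%:Z)) (phi B true i l) v.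

Fact xp_term_linear i r l : linear (xp_term i r l).
Proof. by rewrite /xp_term; lin. Qed.
HB.instance Definition _ i r l := GRing.isLinear.Build L T T _ (xp_term i r l) (xp_term_linear i r l).
Fact xm_term_linear i r l : linear (xm_term i r l).
Proof. by rewrite /xm_term; lin. Qed.
HB.instance Definition _ i r l := GRing.isLinear.Build L T T _ (xm_term i r l) (xm_term_linear i r l).

(** Existence and uniqueness of limits are assumed in this section, where the relations are checked
    for any two modules over C((u)). Both are supplied later by bases of the tensor product. *)
Hypothesis usum_uniq : forall (t : nat -> T) s s', usum all t s -> usum all t s' -> s = s'.
Variables Sp Sm : 'I_n -> int -> {linear T -> T}.
Hypothesis SpP : forall i r v, usum all (fun l => xp_term i r l v) (Sp i r v).
Hypothesis SmP : forall i r v, usum all (fun l => xm_term i r l v) (Sm i r v).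

Definition fusion_xp i r : {linear T -> T} := tmap (ux A true i r) idfun \+ Sp i r.
Definition fusion_xm i r : {linear T -> T} :=
  (u ^ r \*: tmap idfun (ux B false i r)) \+ Sm i r.
Definition fusion_k h : {linear T -> T} := tmap (uk A h) (uk B h).
Definition fusion_h i (m : int) : {linear T -> T} :=
  tmap (uh A i m) idfun \+ (u ^ m \*: tmap idfun (uh B i m)).
Definition fusion : uops H T := UOps
  (fun (s : bool) i r => if s then fusion_xp i r else fusion_xm i r) fusion_k fusion_h.
Local Notation M := fusion.

Lemma fusion_xpE i r v : ux M true i r v = tmap (ux A true i r) idfun v + Sp i r v.
Proof. by []. Qed.
Lemma fusion_xmE i r v : ux M false i r v = u ^ r *: tmap idfun (ux B false i r) v + Sm i r v.
Proof. by []. Qed.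
Lemma fusion_kE h v : uk M h v = tmap (uk A h) (uk B h) v.
Proof. by []. Qed.
Lemma fusion_hE i m v : uh M i m v = tmap (uh A i m) idfun v + u ^ m *: tmap idfun (uh B i m) v.
Proof. by []. Qed.

Lemma fusion_uh0 i v : uh M i 0 v = 0.
Proof.
rewrite fusion_hE; tens_pure v => a b.
rewrite !tmap_pure /= (uh0 HA) (uh0 HV).
by rewrite tpure0l tpure0r scaler0 addr0.
Qed.

Lemma fusion_ukD h h' v : uk M h (uk M h' v) = uk M (h + h') v.
Proof.
rewrite !fusion_kE; tens_pure v => a b.
by rewrite !tmap_pure /= (ukD HA) (ukD HV).
Qed.

Lemma fusion_uk0 v : uk M 0 v = v.
Proof.
rewrite !fusion_kE; tens_pure v => a b.
by rewrite !tmap_pure /= (uk0 HA) (uk0 HV).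
Qed.

Lemma fusion_ukh h j (m : int) v : m != 0 -> uk M h (uh M j m v) = uh M j m (uk M h v).
Proof.
move=> m0; rewrite !fusion_kE !fusion_hE; tens_pure v => a b.
by rewrite !tmap_pure linearD linearZ /= !tmap_pure (ukh HA)// (ukh HV).
Qed.

Lemma fusion_uhh i j (m m' : int) v : m != 0 -> m' != 0 ->
  uh M i m (uh M j m' v) = uh M j m' (uh M i m v).
Proof.
move=> m0 m'0; rewrite !fusion_hE; tens_pure v => a b.
rewrite !tmap_pure !linearD !linearZ /= !tmap_pure /= (uhh HA i j)// (uhh HV i j)//.
by rewrite !scalerA [u ^ m * _]mulrC addrACA.
Qed.

Let a (s : bool) i k : {linear T -> T} := tmap (hser q lc A s i k) idfun.
Let b (s : bool) i k : {linear T -> T} :=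
  u ^ (sg s * k%:Z) \*: tmap idfun (hser q lc B s i k).

Lemma fusion_hser (s : bool) i k v : hser q lc M s i k v = a s i k v + b s i k v.
Proof.
rewrite /a /b /=; case: (posnP k) => [->|k0].
  rewrite hser0; tens_pure v => x y; rewrite !tmap_pure /= !hser0.
  by rewrite tpure0l tpure0r scaler0 addr0.
rewrite hserE// fusion_hE; tens_pure v => x y.
rewrite !tmap_pure /= !hserE// tpureZl tpureZr scalerDr; congr (_ + _).
by rewrite !scalerA mulrC.
Qed.

Let K0 := rmorph_char0 lc.

Let a0 s i v : a s i 0 v = 0.
Proof. by rewrite /a /=; tens_pure v => x y; rewrite tmap_pure /= hser0 tpure0l. Qed.

Let b0 s i v : b s i 0 v = 0.
Proof. by rewrite /b /=; tens_pure v => x y; rewrite tmap_pure /= hser0 tpure0r scaler0. Qed.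

Let aC s i k l v : a s i k (a s i l v) = a s i l (a s i k v).
Proof.
by rewrite /a /=; tens_pure v => x y; rewrite !tmap_pure /= (hser_comm HA).
Qed.

Let bC s i k l v : b s i k (b s i l v) = b s i l (b s i k v).
Proof.
rewrite /b /=; tens_pure v => x y; rewrite !tmap_pure !linearZ /= !tmap_pure /=.
by rewrite (hser_comm HV) !scalerA mulrC.
Qed.

Let abC s i k l v : a s i k (b s i l v) = b s i l (a s i k v).
Proof.
by rewrite /a /b /=; tens_pure v => x y; rewrite !tmap_pure linearZ /= !tmap_pure.
Qed.

(** This is [ops_expD] for the commuting halves [a] and [b]. In [b] the k-th coefficient carries
    u^(sg s * k), which amounts to rescaling the variable by a power of u, so the l-th coefficient
    of its exponential carries u^(sg s * l). *)
Lemma fusion_phi_pure (s : bool) i m x y : phi M s i m (tpure x y) =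
  \sum_(l < m.+1) u ^ (sg s * l%:Z) *: tpure (phi A s i (m - l) x) (phi B s i l y).
Proof.
rewrite /Defs.phi (@ops_expD _ _ (a s i) (b s i) (hser q lc M s i) K0).
- rewrite linear_sum; apply: eq_bigr => l _ /=.
  have -> : ops_exp (b s i) l (tpure x y) =
      u ^ (sg s * l%:Z) *: tpure x (ops_exp (hser q lc B s i) l y).
    apply: (@ode_unique _ _ (b s i) K0 (fun l => ops_exp (b s i) l (tpure x y))
      (fun l => u ^ (sg s * l%:Z) *: tpure x (ops_exp (hser q lc B s i) l y))) => [|k|k].
    + by rewrite (ops_exp0 (b s i)) (ops_exp0 (hser q lc B s i)) mulr0 expr0z scale1r.
    + exact: ops_exp_ode K0 (b0 s i) (bC s i) _ _.
    rewrite scalerMnr -tpureMnr (@ops_exp_ode _ _ (hser q lc B s i) K0)//; last first.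
      by move=> *; apply: (hser_comm HV).
    rewrite tpure_sumr scaler_sumr; apply: eq_bigr => k' _.
    rewrite /b /= linearZ /= tmap_pure /= tpureMnr !scalerMnr scalerA -expfzDr ?lu_neq0//.
    by rewrite -mulrDr -PoszD subnKC ?leq_ord.
  have aE k z : ops_exp (a s i) k (tpure x z) =
      tpure (ops_exp (hser q lc A s i) k x) z.
    apply: (@ode_unique _ _ (a s i) K0 (fun k => ops_exp (a s i) k (tpure x z))
      (fun k => tpure (ops_exp (hser q lc A s i) k x) z)) => {k} [|k|k].
    + by rewrite (ops_exp0 (a s i)) (ops_exp0 (hser q lc A s i)).
    + exact: ops_exp_ode K0 (a0 s i) (aC s i) _ _.
    rewrite -tpureMnl (@ops_exp_ode _ _ (hser q lc A s i) K0)//; last first.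
      by move=> *; apply: (hser_comm HA).
    by rewrite tpure_suml; apply: eq_bigr => k' _; rewrite /a /= tmap_pure /= tpureMnl.
  have lin := ops_exp_linear (fun k : nat => linearP (a s i k)) (m - l).
  pose f : {linear T -> T} :=
    HB.pack (ops_exp (a s i) (m - l)) (GRing.isLinear.Build L T T _ _ lin).
  rewrite -[ops_exp _ _ _]/(f _) linearZ linearZ /= -/(a s i) aE.
  by rewrite tmap_pure.
- exact: a0.
- exact: aC.
- exact: b0.
- exact: bC.
- by move=> k l v; apply: abC.
- exact: fusion_hser.
Qed.

Lemma fusion_phi (s : bool) i m v : phi M s i m v =
  \sum_(l < m.+1) u ^ (sg s * l%:Z) *: tmap (phi A s i (m - l)) (phi B s i l) v.
Proof.
tens_pure v => x y; rewrite fusion_phi_pure.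
by apply: eq_bigr => l _; rewrite tmap_pure.
Qed.

Lemma fusion_ukx h (s : bool) j r v : uk M h (ux M s j r (uk M (- h) v)) =
  lc (qpow q ((sg s)%:~R * sroot H j h)) *: ux M s j r v.
Proof.
set c := lc _; case: s @c => c.
  rewrite !fusion_xpE linearD scalerDr; congr (_ + _).
    rewrite !fusion_kE; tens_pure v => x y.
    by rewrite !tmap_pure /= (ukx HA) (ukD HV) subrr (uk0 HV) tpureZl.
  (* Both sides are limits, so it is enough that the two series agree term by term; the relations
     below follow the same pattern. *)
  apply: usum_uniq (usum_map _ (SpP _ _ _)) _.
  refine (usum_ext (usumZ c (SpP j r v)) _ erefl) => l.
  rewrite !fusion_kE /xp_term; tens_pure v => x y.
  rewrite !tmap_pure !linearZ /= tmap_pure (ukx HV) (uk_phi HA) (ukD HA) subrr (uk0 HA) tpureZr.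
  by rewrite !scalerA mulrC.
rewrite !fusion_xmE linearD scalerDr; congr (_ + _).
  rewrite !fusion_kE; tens_pure v => x y.
  rewrite !tmap_pure !linearZ /= tmap_pure (ukx HV) (ukD HA) subrr (uk0 HA) tpureZr.
  by rewrite !scalerA mulrC.
apply: usum_uniq (usum_map _ (SmP _ _ _)) _.
refine (usum_ext (usumZ c (SmP j r v)) _ erefl) => l.
rewrite !fusion_kE /xm_term; tens_pure v => x y.
rewrite !tmap_pure !linearZ /= tmap_pure (ukx HA) (uk_phi HV) (ukD HV) subrr (uk0 HV) tpureZl.
by rewrite !scalerA mulrC.
Qed.

Lemma fusion_uhx i (m : int) (s : bool) j r v : m != 0 ->
  uh M i m (ux M s j r v) - ux M s j r (uh M i m v) =
  lc ((sg s)%:~R * (m%:~R^-1 * qint (qval q) (m * bmat C i j))) *: ux M s j (m + r) v.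
Proof.
move=> m0; set c := lc _.
case: s @c => c.
  rewrite !fusion_xpE linearD scalerDr opprD addrACA; congr (_ + _).
    rewrite !fusion_hE; tens_pure v => x y.
    rewrite !linearD /= !tmap_pure !linearZ /= !tmap_pure /=.
    by rewrite ?scalerN addrACA subrr addr0 -tpureBl (uhx HA)// tpureZl.
  apply: usum_uniq (usumB (usum_map _ (SpP _ _ _)) (SpP _ _ _)) _.
  refine (usum_ext (usumZ c (SpP j (m + r) v)) _ erefl) => l.
  rewrite !fusion_hE /xp_term; tens_pure v => x y.
  rewrite !linearD /= !tmap_pure !linearZ /= !tmap_pure /= (uh_phi HA)//.
  rewrite ?scalerN addrACA subrr add0r !scalerA [_ * u ^ m]mulrC -scalerBr -tpureBr.
  rewrite (uhx HV)// tpureZr scalerA mulrC -expfzDr ?lu_neq0// addrA.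
  by rewrite [r + _ + m]addrC addrA.
rewrite !fusion_xmE linearD scalerDr opprD addrACA; congr (_ + _).
  rewrite !fusion_hE; tens_pure v => x y.
  rewrite !linearD /= !tmap_pure !linearZ /= !tmap_pure /=.
  rewrite !scalerN addrACA subrr add0r -!scalerBr -tpureBr (uhx HV)// tpureZr.
  by rewrite !scalerA expfzDr ?lu_neq0// [u ^ r * _]mulrC.
apply: usum_uniq (usumB (usum_map _ (SmP _ _ _)) (SmP _ _ _)) _.
refine (usum_ext (usumZ c (SmP j (m + r) v)) _ erefl) => l.
rewrite !fusion_hE /xm_term; tens_pure v => x y.
rewrite !linearD /= !tmap_pure !linearZ /= !tmap_pure /= (uh_phi HV)//.
rewrite !scalerN addrACA subrr addr0 -scalerBr -tpureBl (uhx HA)//.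
by rewrite tpureZl !scalerA mulrC addrA.
Qed.

Let P i r : {linear T -> T} := tmap (ux A true i r) idfun.
Let Q i r : {linear T -> T} := u ^ r \*: tmap idfun (ux B false i r).

Let fxpE i r v : ux M true i r v = P i r v + Sp i r v.
Proof. by []. Qed.
Let fxmE i r v : ux M false i r v = Q i r v + Sm i r v.
Proof. by []. Qed.

(** Exchanging (i, r) with (j, r') swaps the two sides of the quadratic relation up to sign. The
    mixed case of [SS i] and [PP j] can therefore be stated with [PP j] first, and one computation
    serves for both mixed cases. *)
Lemma fusion_uxx_assoc (PP SS : 'I_n -> int -> {linear T -> T}) (c : L) i j r r' v :
  let X i r v := PP i r v + SS i r v in
  (forall v, PP i (r + 1) (PP j r' v) - c *: PP j r' (PP i (r + 1) v) =
     c *: PP i r (PP j (r' + 1) v) - PP j (r' + 1) (PP i r v)) ->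
  (forall v, PP i (r + 1) (SS j r' v) - c *: SS j r' (PP i (r + 1) v) =
     c *: PP i r (SS j (r' + 1) v) - SS j (r' + 1) (PP i r v)) ->
  (forall v, PP j (r' + 1) (SS i r v) - c *: SS i r (PP j (r' + 1) v) =
     c *: PP j r' (SS i (r + 1) v) - SS i (r + 1) (PP j r' v)) ->
  (forall v, SS i (r + 1) (SS j r' v) - c *: SS j r' (SS i (r + 1) v) =
     c *: SS i r (SS j (r' + 1) v) - SS j (r' + 1) (SS i r v)) ->
  X i (r + 1) (X j r' v) - c *: X j r' (X i (r + 1) v) =
  c *: X i r (X j (r' + 1) v) - X j (r' + 1) (X i r v).
Proof.
move=> X pp ps sp ss; rewrite -[RHS]opprB /X.
have lD (f : {linear T -> T}) x y : f (x + y) = f x + f y by exact: linearD.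
rewrite !(lD (PP _ _)) !(lD (SS _ _)) !twisted_comm_sum pp ps ss.
have -> : SS i (r + 1) (PP j r' v) - c *: PP j r' (SS i (r + 1) v) =
    c *: SS i r (PP j (r' + 1) v) - PP j (r' + 1) (SS i r v).
  by apply: oppr_inj; rewrite !opprB sp.
by rewrite !(opprB, opprD) addrACA.
Qed.

Lemma fusion_uxx_p i j r r' v : let c := lc (qval q ^ (sg true * bmat C i j)) in
  ux M true i (r + 1) (ux M true j r' v) - c *: ux M true j r' (ux M true i (r + 1) v) =
  c *: ux M true i r (ux M true j (r' + 1) v) - ux M true j (r' + 1) (ux M true i r v).
Proof.
move=> c.
have PS i' j' r1 r1' w : bmat C i' j' = bmat C i j ->
  P i' (r1 + 1) (Sp j' r1' w) - c *: Sp j' r1' (P i' (r1 + 1) w) =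
  c *: P i' r1 (Sp j' (r1' + 1) w) - Sp j' (r1' + 1) (P i' r1 w).
  move=> BE.
  have h := usumB (usum_map (P i' (r1 + 1)) (SpP j' r1' w))
                  (usumZ c (SpP j' r1' (P i' (r1 + 1) w))).
  have h' := usumB (usumZ c (usum_map (P i' r1) (SpP j' (r1' + 1) w)))
                   (SpP j' (r1' + 1) (P i' r1 w)).
  (* The term k + 1 on the left matches the term k on the right by [ux_phi_recp], and the term 0 on
     the left is zero by [ux_phi0p]. *)
  apply: usum_uniq h'; refine (usum_ext (usum_recl h) _ _) => [k|].
    clear h; rewrite /P /= /xp_term; tens_pure w => x y.
    rewrite !tmap_pure !linearZ /= !tmap_pure.
    rewrite (_ : r1' + k.+1%:Z = r1' + 1 + k%:Z); last by rewrite intS addrA.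
    rewrite !scalerN !(scaler_swap c) -!scalerBr -!tpureZl -!tpureBl /= /c mul1r -BE.
    by rewrite (ux_phi_recp HA).
  rewrite -[RHS]subr0; congr (_ - _).
  clear h; rewrite /P /= /xp_term; tens_pure w => x y.
  rewrite !tmap_pure !linearZ /= !tmap_pure.
  rewrite !scalerN (scaler_swap c) -!scalerBr -!tpureZl -!tpureBl /= /c mul1r -BE.
  by rewrite (ux_phi0p HA) tpure0l scaler0.
apply: (@fusion_uxx_assoc P Sp c i j r r' v) => w.
- rewrite /P /=; tens_pure w => x y; rewrite !tmap_pure /=.
  by rewrite -!tpureZl -!tpureBl (uxx HA).
- exact: PS.
- by apply: PS; rewrite !mxE (cmat_sym C).
(* In total degree N the phi's commute in the first factor, and the quadratic relation of the second
   factor applies to each pair (l, N - l). *)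
have hh i1 j1 r1 r1' w1 := usum_cauchy (SpP i1 r1) (linearP (Sp i1 r1)) (SpP j1 r1' w1).
apply: usum_uniq (usumB (hh i j (r + 1) r' w) (usumZ c (hh j i r' (r + 1) w))) _.
refine (usum_ext (usumB (usumZ c (hh i j r (r' + 1) w)) (hh j i (r' + 1) r w)) _ erefl) => N.
rewrite !(sum_rev N (fun l k => xp_term j _ l (xp_term i _ k w))).
rewrite !scaler_sumr -!sumrB; apply: eq_bigr => l _.
rewrite /xp_term; tens_pure w => x y.
rewrite !tmap_pure !linearZ /= !tmap_pure.
set k := (N - l)%N.
have rE : r + 1 + l%:Z = r + l%:Z + 1 by rewrite addrAC.
have rE' : r' + 1 + k%:Z = r' + k%:Z + 1 by rewrite addrAC.
rewrite !rE !rE' !scalerN !(scaler_swap c) /= (phi_comm HA false j).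
do 3 rewrite ?linearZ /= ?rE ?tmap_pure /=.
rewrite !scalerN !(scaler_swap c).
rewrite (scaler_swap (u ^ (r' + k%:Z + 1)) (u ^ (r + l%:Z))).
rewrite (scaler_swap (u ^ (r' + k%:Z)) (u ^ (r + l%:Z + 1))) -!scalerBr -!tpureZr -!tpureBr -(uxx HV).
rewrite !scalerA -!expfzDr ?lu_neq0//.
by congr (_ ^ _ *: _); ring.
Qed.

Lemma fusion_uxx_m i j r r' v : let c := lc (qval q ^ (sg false * bmat C i j)) in
  ux M false i (r + 1) (ux M false j r' v) - c *: ux M false j r' (ux M false i (r + 1) v) =
  c *: ux M false i r (ux M false j (r' + 1) v) - ux M false j (r' + 1) (ux M false i r v).
Proof.
move=> c.
have QS i' j' r1 r1' w : bmat C i' j' = bmat C i j ->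
  Q i' (r1 + 1) (Sm j' r1' w) - c *: Sm j' r1' (Q i' (r1 + 1) w) =
  c *: Q i' r1 (Sm j' (r1' + 1) w) - Sm j' (r1' + 1) (Q i' r1 w).
  move=> BE.
  have h := usumB (usum_map (Q i' (r1 + 1)) (SmP j' r1' w))
                  (usumZ c (SmP j' r1' (Q i' (r1 + 1) w))).
  have h' := usumB (usumZ c (usum_map (Q i' r1) (SmP j' (r1' + 1) w)))
                   (SmP j' (r1' + 1) (Q i' r1 w)).
  (* Compared with x^+ the shift is on the other side: the term k + 1 on the right matches the term
     k on the left, and the term 0 on the right is zero. *)
  apply: usum_uniq h _; refine (usum_ext (usum_recl h') _ _) => [k|].
    clear h'; rewrite /Q /= /xm_term; tens_pure w => x y.
    rewrite !tmap_pure; do 3 rewrite ?linearZ /= ?tmap_pure.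
    have -> : r1' + 1 - k.+1%:Z = r1' - k%:Z by rewrite intS; ring.
    rewrite !scalerN !(scaler_swap (u ^ k.+1%:Z)) !(scaler_swap (u ^ k%:Z)) !(scaler_swap c).
    rewrite -!scalerBr -!tpureZr -!tpureBr /= /c mulN1r -BE -(ux_phi_recm HV).
    rewrite !scalerA -!expfzDr ?lu_neq0//; congr (_ ^ _ *: _).
    by rewrite intS addrA.
  rewrite -[RHS]subr0; congr (_ - _).
  clear h'; rewrite /Q /= /xm_term; tens_pure w => x y.
  rewrite !tmap_pure; do 3 rewrite ?linearZ /= ?tmap_pure.
  rewrite !scalerN !(scaler_swap (u ^ 0%:Z)) !(scaler_swap c).
  rewrite -!scalerBr -!tpureZr -!tpureBr /= /c mulN1r -BE.
  by rewrite (ux_phi0m HV) tpure0r !scaler0.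
apply: (@fusion_uxx_assoc Q Sm c i j r r' v) => w.
- rewrite /Q /=; tens_pure w => x y.
  rewrite !tmap_pure; do 3 rewrite ?linearZ /= ?tmap_pure.
  rewrite !scalerN !(scaler_swap c).
  rewrite (scaler_swap (u ^ r') (u ^ (r + 1))) (scaler_swap (u ^ (r' + 1)) (u ^ r)).
  rewrite -!scalerBr -!tpureZr -!tpureBr -(uxx HV).
  by rewrite !scalerA -!expfzDr ?lu_neq0//; congr (_ ^ _ *: _); ring.
- exact: QS.
- by apply: QS; rewrite !mxE (cmat_sym C).
have hh i1 j1 r1 r1' w1 := usum_cauchy (SmP i1 r1) (linearP (Sm i1 r1)) (SmP j1 r1' w1).
apply: usum_uniq (usumB (hh i j (r + 1) r' w) (usumZ c (hh j i r' (r + 1) w))) _.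
refine (usum_ext (usumB (usumZ c (hh i j r (r' + 1) w)) (hh j i (r' + 1) r w)) _ erefl) => N.
rewrite !(sum_rev N (fun l k => xm_term j _ l (xm_term i _ k w))).
rewrite !scaler_sumr -!sumrB; apply: eq_bigr => l _.
rewrite /xm_term; tens_pure w => x y.
rewrite !tmap_pure !linearZ /= !tmap_pure; set k := (N - l)%N.
have rE : r + 1 - l%:Z = r - l%:Z + 1 by rewrite addrAC.
have rE' : r' + 1 - k%:Z = r' - k%:Z + 1 by rewrite addrAC.
rewrite !rE !rE' !scalerN !(scaler_swap c) /= (phi_comm HV true j).
do 3 rewrite ?linearZ /= ?rE ?tmap_pure /=.
rewrite !scalerN !(scaler_swap (u ^ k%:Z)) !(scaler_swap c).
by rewrite -!scalerBr -!tpureZl -!tpureBl -(uxx HA).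
Qed.

(** The range is empty for m < 0, where phi^+_m = 0. With [phiz] in place of [phi] the summand also
    makes sense beyond the range, and is zero there, as is needed to view the sum as a series. *)
Lemma fusion_phiz_p i (m : int) v : phiz q lc M true i m v =
  \sum_(k < if 0 <= m then (absz m).+1 else 0%N)
    u ^ k%:Z *: tmap (phiz q lc A true i (m - k%:Z)) (phiz q lc B true i k%:Z) v.
Proof.
rewrite {1}/phiz mul1r; case: ifP => m0; last by rewrite big_ord0.
rewrite fusion_phi; apply: eq_bigr => k _.
rewrite /sg mul1r; congr (_ *: _); tens_pure v => x y; rewrite !tmap_pure /=.
have km : m - k%:Z = (absz m - k)%N%:Z by have := ltn_ord k; lia.
have := phiE q lc A true i (absz m - k) x; have := phiE q lc B true i k y.
by rewrite /sg !mul1r km => -> ->.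
Qed.

Lemma fusion_phiz_m i (m : int) v : phiz q lc M false i m v =
  \sum_(l < if m <= 0 then (absz m).+1 else 0%N)
    u ^ (m + l%:Z) *: tmap (phi A false i l) (phiz q lc B false i (m + l%:Z)) v.
Proof.
rewrite {1}/phiz mulN1r oppr_ge0; case: ifP => m0; last by rewrite big_ord0.
rewrite fusion_phi [RHS](reindex_inj rev_ord_inj) /=; apply: eq_bigr => k _.
rewrite subSS /sg (_ : m + (absz m - k)%N%:Z = -1 * k%:Z); last first.
  by have := ltn_ord k; lia.
congr (_ *: _); tens_pure v => x y; rewrite !tmap_pure /=.
by have := phiE q lc B false i k y; rewrite /sg => ->.
Qed.

Lemma tmap0l (f : {linear VA -> VA}) (g : {linear VB -> VB}) v :
  (forall x, f x = 0) -> tmap f g v = 0.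
Proof. by move=> f0; tens_pure v => x y; rewrite tmap_pure f0 tpure0l. Qed.

Lemma tmap0r (f : {linear VA -> VA}) (g : {linear VB -> VB}) v :
  (forall y, g y = 0) -> tmap f g v = 0.
Proof. by move=> g0; tens_pure v => x y; rewrite tmap_pure g0 tpure0r. Qed.

Lemma fusion_uxx_pm i j r r' v :
  ux M true i r (ux M false j r' v) - ux M false j r' (ux M true i r v) =
  if i == j then lc ((qval q ^+ csym C i) - (qval q ^+ csym C i)^-1)^-1
      *: (phiz q lc M true i (r + r') v - phiz q lc M false i (r + r') v)
  else 0.
Proof.
(* The series parts commute: expanding phi^+ x^+ in the second factor on one side, and phi^- x^- in
   the first factor on the other, gives the same double sum of terms [G], because both exchange
   functions have the same parameter y. *)
have SS w : Sp i r (Sm j r' w) = Sm j r' (Sp i r w).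
  have h := usum_cauchy (SpP i r) (linearP (Sp i r)) (SmP j r' w).
  have h' := usum_cauchy (SmP j r') (linearP (Sm j r')) (SpP i r w).
  apply: usum_uniq h _; refine (usum_ext h' _ erefl) => N; clear h'.
  rewrite (sum_rev N (fun k l => xm_term j r' k (xp_term i r l w))).
  rewrite /xp_term /xm_term; tens_pure w => x y.
  pose f := fcoef (qB q C true true i j).
  pose G a l := u ^ (r + N%:Z) *: (lc (f a) *: tpure
    (ux A false j (r' - (N - l)%N%:Z) (phi A false i l x))
    (ux B true i (r + l%:Z + a%:Z) (phi B true j (N - l - a) y))).
  transitivity (\sum_(l < N.+1) \sum_(a < (N - l).+1) G a l).
    apply: eq_bigr => l _.
    do 3 rewrite ?linearZ /= ?tmap_pure /=.
    rewrite (phi_ux HV) tpure_sumr !scaler_sumr; apply: eq_bigr => a1 _.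
    rewrite tpureZr /G scalerA -expfzDr ?lu_neq0// qBC {1}/sg mul1r.
    by rewrite -addrA -PoszD subnKC ?leq_ord.
  rewrite (triangle_diag N (fun l a => G a l)); apply: eq_bigr => l _.
  rewrite -(sum_rev l (fun a l => G a l)).
  do 3 rewrite ?linearZ /= ?tmap_pure /=.
  rewrite (phi_ux HA) tpure_suml !scaler_sumr; apply: eq_bigr => a1 _.
  have [lN al] : (l <= N)%N /\ (a1 <= l)%N by rewrite !leq_ord.
  rewrite tpureZl /G [RHS]scalerA -expfzDr ?lu_neq0//.
  rewrite (_ : qB q C false false i j = qB q C true true i j)//.
  rewrite (_ : (N - l)%N%:Z + (r + l%:Z) = r + N%:Z); last by lia.
  rewrite (_ : r' - (N - (l - a1))%N%:Z = r' - (N - l)%N%:Z + sg false * a1%:Z); last by rewrite /sg; lia.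
  rewrite (_ : r + (l - a1)%N%:Z + a1%:Z = r + l%:Z); last by lia.
  by rewrite (_ : (N - (l - a1) - a1 = N - l)%N)//; lia.
have PQ w : P i r (Q j r' w) = Q j r' (P i r w).
  rewrite /P /Q /=; tens_pure w => x y.
  by do 3 rewrite ?linearZ /= ?tmap_pure.
pose c := if i == j then lc ((qval q ^+ csym C i) - (qval q ^+ csym C i)^-1)^-1 else 0.
pose m := r + r'.
have PS k w : P i r (xm_term j r' k w) - xm_term j r' k (P i r w) =
    c *: (u ^ k%:Z *: tmap (phiz q lc A true i (m - k%:Z)) (phiz q lc B true i k%:Z) w -
          u ^ k%:Z *: tmap (phiz q lc A false i (m - k%:Z)) (phiz q lc B true i k%:Z) w).
  rewrite /P /= /xm_term; tens_pure w => x y.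
  do 3 rewrite ?linearZ /= ?tmap_pure /=.
  rewrite ?scalerN -!scalerBr -!tpureBl (uxx_pm HA) addrA -/m /c.
  case: eqP => [<-|_]; last by rewrite tpure0l scaler0 scale0r.
  have := phiE q lc B true i k y; rewrite /sg mul1r => ->.
  by rewrite tpureZl scaler_swap.
have SQ l w : xp_term i r l (Q j r' w) - Q j r' (xp_term i r l w) =
    c *: (u ^ (m + l%:Z) *: tmap (phiz q lc A false i (m - (m + l%:Z))) (phiz q lc B true i (m + l%:Z)) w -
          u ^ (m + l%:Z) *: tmap (phi A false i l) (phiz q lc B false i (m + l%:Z)) w).
  rewrite /Q /= /xp_term; tens_pure w => x y.
  do 3 rewrite ?linearZ /= ?tmap_pure /=.
  rewrite ?scalerN -!scalerBr -!tpureBr (uxx_pm HV) /c.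
  have -> : r + l%:Z + r' = m + l%:Z by rewrite addrAC.
  case: eqP => [_|_]; last by rewrite tpure0r !scaler0 scale0r.
  have := phiE q lc A false i l x.
  rewrite /sg mulN1r (_ : - l%:Z = m - (m + l%:Z)); last by ring.
  move=> ->; rewrite tpureZr tpureBr scalerBr !scalerA -expfzDr ?lu_neq0// mulrC.
  rewrite (_ : r' + (r + l%:Z) = m + l%:Z); last by rewrite /m; ring.
  by rewrite -scalerBr scalerA.
pose f1 k := u ^ k%:Z *: tmap (phiz q lc A true i (m - k%:Z)) (phiz q lc B true i k%:Z) v.
pose g (k : int) := u ^ k *: tmap (phiz q lc A false i (m - k)) (phiz q lc B true i k) v.
pose f4 (l : nat) := u ^ (m + l%:Z) *: tmap (phi A false i l) (phiz q lc B false i (m + l%:Z)) v.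
have s1 : usum all (fun k : nat => c *: (f1 k - g k%:Z)) (P i r (Sm j r' v) - Sm j r' (P i r v)).
  exact: (usum_ext (usumB (usum_map (P i r) (SmP j r' v)) (SmP j r' (P i r v))) (fun k => PS k v) erefl).
have s2 : usum all (fun l : nat => c *: (g (m + l%:Z) - f4 l)) (Sp i r (Q j r' v) - Q j r' (Sp i r v)).
  exact: (usum_ext (usumB (SpP i r (Q j r' v)) (usum_map (Q j r') (SpP i r v))) (fun l => SQ l v) erefl).
have F1 : usum all f1 (phiz q lc M true i m v).
  rewrite fusion_phiz_p; apply: usum_fin => // l ml; rewrite /f1.
  have h : m - l%:Z < 0 by move: ml; case: ifP => ?; lia.
  by rewrite tmap0l ?scaler0// => x /=; rewrite phiz0 ?mul1r.
have F4 : usum all f4 (phiz q lc M false i m v).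
  rewrite fusion_phiz_m; apply: usum_fin => // l ml; rewrite /f4.
  have h : 0 < m + l%:Z by move: ml; case: ifP => ?; lia.
  by rewrite tmap0r ?scaler0// => y /=; rewrite phiz0 ?mulN1r ?oppr_lt0.
have G1 : usum all (fun k : nat => c *: g k%:Z)
    (c *: phiz q lc M true i m v - (P i r (Sm j r' v) - Sm j r' (P i r v))).
  refine (usum_ext (usumB (usumZ c F1) s1) _ erefl) => k.
  by rewrite -scalerBr subKr.
have G2 : usum all (fun l : nat => c *: g (m + l%:Z))
    (Sp i r (Q j r' v) - Q j r' (Sp i r v) + c *: phiz q lc M false i m v).
  refine (usum_ext (usumD s2 (usumZ c F4)) _ erefl) => k.
  by rewrite -scalerDr subrK.
(* phi^+ has no negative mode and phi^- no positive one, so the cross term [g] vanishes below 0 and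
   below m, as [usum_zshift] requires. *)
have gneg (k : int) : k < 0 -> c *: g k = 0.
  by move=> k0; rewrite /g tmap0r ?scaler0// => y /=; rewrite phiz0 ?mul1r.
have gpos (k : int) : k < m -> c *: g k = 0.
  by move=> km; rewrite /g tmap0l ?scaler0// => x /=; rewrite phiz0 ?mulN1r ?oppr_lt0 ?subr_gt0.
have E := usum_uniq (usum_zshift gneg gpos G1) G2.
transitivity (c *: (phiz q lc M true i m v - phiz q lc M false i m v)); last first.
  by rewrite /c; case: ifP => // _; rewrite scale0r.
rewrite scalerBr.
transitivity ((P i r (Sm j r' v) - Sm j r' (P i r v)) + (Sp i r (Q j r' v) - Q j r' (Sp i r v))); last first.
  by apply/esym/eqP; rewrite subr_eq -addrA -E addrC subrK.
have lD (f : {linear T -> T}) x y : f (x + y) = f x + f y by exact: linearD.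
rewrite !fxpE !fxmE !(lD (P _ _)) !(lD (Q _ _)) !(lD (Sp _ _)) !(lD (Sm _ _)).
rewrite -[X in _ - X]scale1r twisted_comm_sum !scale1r PQ SS !subrr add0r addr0.
by [].
Qed.

Lemma fusion_umodule : is_umodule q lc M.
Proof.
split.
- exact: fusion_uh0.
- exact: fusion_ukD.
- exact: fusion_uk0.
- exact: fusion_ukh.
- exact: fusion_uhh.
- exact: fusion_ukx.
- exact: fusion_uhx.
- exact: fusion_uxx_pm.
- by case; [apply: fusion_uxx_p | apply: fusion_uxx_m].
Qed.

End Fusion.

(** * Coordinates and weights *)

Section Coordinates.
Variables (K : fieldType) (V : lmodType K) (J : eqType).
Implicit Types (eps : J -> V) (kap : J -> {linear V -> K^o}).

(** Spanning is stated as an induction principle: the index set may be infinite and no support has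
    to be exhibited. *)
Definition spanned eps := forall P : V -> Prop, P 0 ->
  (forall x y, P x -> P y -> P (x + y)) -> (forall c j, P (c *: eps j)) ->
  forall v, P v.

(** A basis with its dual functionals. Weights, limits and valuations on an infinite dimensional
    space are all read off the scalars [kap j v]. *)
Record coords eps kap : Prop := Coords {
  kap_eps : forall j j', kap j (eps j') = (j == j')%:R;
  eps_span : spanned eps }.

Lemma sum_delta (s : seq J) j (c : K) eps : uniq s -> j \in s ->
  \sum_(i <- s) (c * (i == j)%:R) *: eps i = c *: eps j.
Proof.
move=> us js; rewrite (bigD1_seq j)//= eqxx mulr1 big1 ?addr0// => i /negbTE->.
by rewrite mulr0 scale0r.
Qed.

Lemma coords_sum eps kap v : coords eps kap ->
  exists2 s, uniq s & v = \sum_(j <- s) kap j v *: eps j.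
Proof.
move=> [ke sp].
(* The expansion is required for every list containing s, so that supports can be enlarged when two
   vectors are added. *)
suff [s h] : exists s : seq J, forall s', uniq s' -> {subset s <= s'} ->
    v = \sum_(j <- s') kap j v *: eps j.
  exists (undup s); first exact: undup_uniq.
  by apply: h => [|j]; rewrite ?undup_uniq ?mem_undup.
apply: (sp (fun v => exists s : seq J, forall s', uniq s' -> {subset s <= s'} ->
    v = \sum_(j <- s') kap j v *: eps j)) => {v} [|x y [s hs] [t ht]|c j].
- by exists [::] => s' _ _; rewrite big1// => j _; rewrite linear0 scale0r.
- exists (s ++ t) => s' us' sub.
  have ss : {subset s <= s'} by move=> j js; apply: sub; rewrite mem_cat js.
  have ts : {subset t <= s'} by move=> j jt; apply: sub; rewrite mem_cat jt orbT.
  rewrite {1}(hs s' us' ss) {1}(ht s' us' ts) -big_split.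
  by apply: eq_bigr => j _; rewrite linearD scalerDl.
- exists [:: j] => s' us' sub; rewrite -[LHS](@sum_delta s')//; last by apply: sub; rewrite inE.
  by apply: eq_bigr => i _; rewrite linearZ /= ke.
Qed.

Lemma coords_eq0 eps kap v : coords eps kap -> (forall j, kap j v = 0) -> v = 0.
Proof.
move=> ek v0; have [s us ->] := coords_sum v ek.
by rewrite big1// => j _; rewrite v0 scale0r.
Qed.

Lemma kap_sum eps kap (s : seq J) (c : J -> K) j : coords eps kap -> uniq s ->
  kap j (\sum_(i <- s) c i *: eps i) = if j \in s then c j else 0.
Proof.
move=> [ke _] us; rewrite linear_sum.
have [js|js] := ifPn.
  rewrite (bigD1_seq j)//= linearZ /= ke eqxx [_ *: _]mulr1 big1 ?addr0// => i ij.
  by rewrite linearZ /= ke eq_sym (negbTE ij) [_ *: _]mulr0.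
rewrite big_seq big1// => i si; rewrite linearZ /= ke; case: eqP => [ji|_].
  by rewrite ji si in js.
by rewrite [_ *: _]mulr0.
Qed.

Lemma coords_sumS eps kap v (s : seq J) : coords eps kap -> uniq s ->
  (forall j, j \notin s -> kap j v = 0) -> v = \sum_(j <- s) kap j v *: eps j.
Proof.
move=> ek us vs; apply/eqP; rewrite -subr_eq0; apply/eqP/(coords_eq0 ek) => j.
by rewrite linearB /= (kap_sum _ j ek us); case: ifPn => [_|/vs->]; rewrite subrr.
Qed.

Lemma coords_ex eps : spanned eps ->
  (forall s (c : J -> K), uniq s -> \sum_(j <- s) c j *: eps j = 0 ->
     forall j, j \in s -> c j = 0) ->
  exists kap, coords eps kap.
Proof.
move=> sp ind.
(* [f] is a candidate coordinate function of v, zero off s. Independence makes it unique ([repE]),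
   hence linear in v. *)
pose rep v (s : seq J) (f : J -> K) := [/\ uniq s, (forall j, j \notin s -> f j = 0) &
  forall s', uniq s' -> {subset s <= s'} -> v = \sum_(j <- s') f j *: eps j].
have repD x y s t f g c : rep x s f -> rep y t g ->
    rep (c *: x + y) (undup (s ++ t)) (fun j => c * f j + g j).
  move=> [us sf hx] [ut tg hy]; split; first exact: undup_uniq.
    by move=> j; rewrite mem_undup mem_cat negb_or => /andP[/sf-> /tg->]; rewrite mulr0 addr0.
  move=> s' us' sub.
  have ss : {subset s <= s'} by move=> j js; apply: sub; rewrite mem_undup mem_cat js.
  have ts : {subset t <= s'} by move=> j jt; apply: sub; rewrite mem_undup mem_cat jt orbT.
  rewrite (hx s' us' ss) (hy s' us' ts) scaler_sumr -big_split.
  by apply: eq_bigr => j _; rewrite scalerDl scalerA.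
have repE v s t f g : rep v s f -> rep v t g -> f = g.
  move=> vf vg; have [u1 h1 h2] := repD _ _ _ _ _ _ (-1) vf vg.
  apply/funext => j; set st := undup (s ++ t) in u1 h1 h2.
  have := h2 st u1 (fun _ => id); rewrite scaleN1r addNr => /esym/(ind _ _ u1) h.
  apply/eqP; rewrite -subr_eq0 -oppr_eq0 opprB addrC -mulN1r; apply/eqP.
  by have [/h|/h1] := boolP (j \in st).
have ex v : exists sf : seq J * (J -> K), rep v sf.1 sf.2.
  apply: (sp (fun v => exists sf, rep v sf.1 sf.2)) => {v} [|x y [[s f] /= hs] [[t g] /= ht]|c j].
  - by exists ([::], fun=> 0); split=> // s' _ _; rewrite big1// => j _; rewrite scale0r.
  - by exists (undup (s ++ t), fun j => 1 * f j + g j); rewrite -[x]scale1r; apply: repD.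
  - exists ([:: j], fun i => c * (i == j)%:R); split=> //= [i|s' us' sub].
      by rewrite inE => /negbTE->; rewrite mulr0.
    by rewrite sum_delta//; apply: sub; rewrite inE.
have [F HF] := choice ex.
pose kf j v := (F v).2 j.
have kl j : linear (kf j : V -> K^o).
  move=> c x y; rewrite /kf (repE _ _ _ _ _ (HF _) (repD _ _ _ _ _ _ c (HF x) (HF y))).
  by [].
pose kap j : {linear V -> K^o} :=
  HB.pack (kf j : V -> K^o) (GRing.isLinear.Build K V K^o _ _ (kl j)).
exists kap; split=> // j j'.
rewrite /= /kf (repE _ _ [:: j'] _ (fun i => (i == j')%:R) (HF _))//.
split=> //= [i|s' us' sub].
  by rewrite inE => /negbTE->.
rewrite -{1}[eps j']scale1r -(@sum_delta s')//; last by apply: sub; rewrite inE.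
by apply: eq_bigr => i _; rewrite mul1r.
Qed.

End Coordinates.

Lemma scale_regular (K : fieldType) (a b : K) : a *: (b : K^o) = a * b.
Proof. by []. Qed.

Section Weighted.
Variables (RR : realType) (q : qparam RR) (n : nat) (C : cartan_datum n).
Variables (H : realization C) (K : fieldType) (io : {rmorphism RR[i] -> K}).
Variables (V : lmodType K) (M : uops H V).
Local Notation hdual := 'Hom(hsp H, rat^o).
Local Notation wtsp := (wtsp q io M).

Lemma wtsp0 w : wtsp w 0.
Proof. by move=> h; rewrite linear0 scaler0. Qed.

Lemma wtspD w x y : wtsp w x -> wtsp w y -> wtsp w (x + y).
Proof. by move=> wx wy h; rewrite linearD /= wx wy scalerDr. Qed.

Lemma wtspZ w c x : wtsp w x -> wtsp w (c *: x).
Proof. by move=> wx h; rewrite linearZ /= wx !scalerA mulrC. Qed.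

Lemma wtsp_sum w (I : Type) (r : seq I) (P : pred I) (f : I -> V) :
  (forall i, P i -> wtsp w (f i)) -> wtsp w (\sum_(i <- r | P i) f i).
Proof. by move=> h; apply: (big_ind (wtsp w)); [exact: wtsp0 | exact: wtspD|]. Qed.

Section FromCoords.
Variables (J : eqType) (eps : J -> V) (kap : J -> {linear V -> K^o}) (wt : J -> hdual).
Hypothesis ek : coords eps kap.
Hypothesis eps_wt : forall j, wtsp (wt j) (eps j).

Lemma kap_uk j h v : kap j (uk M h v) = io (qpow q (wt j h)) * kap j v.
Proof.
apply: (eps_span ek (P := fun v => kap j (uk M h v) = io (qpow q (wt j h)) * kap j v)) => {v}.
- by rewrite !linear0 mulr0.
- by move=> x y Ex Ey; rewrite !linearD /= Ex Ey mulrDr.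
- move=> c j'; rewrite !linearZ /= eps_wt linearZ /= (kap_eps ek).
  by rewrite !scale_regular mulrCA; case: eqP => [->//|_]; rewrite !mulr0.
Qed.

(** k_h multiplies the coordinate j by the scalar of the weight [wt j], and some h distinguishes
    this weight from w. *)
Lemma kap_wtsp w v : wtsp w v -> forall j, wt j != w -> kap j v = 0.
Proof.
move=> vw j jw.
have [h hw] : exists h, qpow q (wt j h) != qpow q (w h).
  apply: contrapT => /forallNP nh; move/eqP: jw; apply.
  by apply: (@qpow_linear_inj _ q) => h; apply/eqP/negPn/negP/nh.
have := kap_uk j h v; rewrite vw linearZ /= scale_regular => /eqP.
rewrite -subr_eq0 -mulrBl mulf_eq0 -rmorphB fmorph_eq0 subr_eq0 => /orP[/eqP h'|/eqP//].
by rewrite h' eqxx in hw.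
Qed.

Lemma wtsp_kap w v : (forall j, wt j != w -> kap j v = 0) -> wtsp w v.
Proof.
move=> vw; have [s us ->] := coords_sum v ek; apply: wtsp_sum => j _.
have [<-|jw] := eqVneq (wt j) w; first exact/wtspZ/eps_wt.
by rewrite vw// scale0r; apply: wtsp0.
Qed.

Lemma is_weight_wt w : is_weight q io M w -> exists j, wt j = w.
Proof.
move=> [v vw v0]; apply: contrapT => /forallNP nw; move/eqP: v0; apply.
by apply: (coords_eq0 ek) => j; apply: (kap_wtsp vw); apply/eqP/nw.
Qed.

Lemma wt_is_weight j : is_weight q io M (wt j).
Proof.
exists (eps j); first exact: eps_wt.
apply/eqP => e0; have := kap_eps ek j j; rewrite e0 linear0 eqxx => /esym/eqP.
by rewrite oner_eq0.
Qed.

Lemma wt_dsum : direct_sum setT setT wtsp.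
Proof.
split=> // [v _|d x w xinj xw sum0 k].
  have [s us vE] := coords_sum v ek.
  pose ws := undup [seq wt j | j <- s].
  exists (size ws), (fun k => tnth (in_tuple ws) k).
  exists (fun k => \sum_(j <- s | wt j == tnth (in_tuple ws) k) kap j v *: eps j).
  split.
  - by apply/tuple_uniqP; rewrite /= undup_uniq.
  - move=> k; split=> //; apply: wtsp_sum => j /eqP <-; exact/wtspZ/eps_wt.
  - rewrite (exchange_big_dep xpredT)//= {1}vE; apply: eq_big_seq => j js.
    have jw : wt j \in in_tuple ws by rewrite mem_undup map_f.
    have /tnthP[k kE] := jw.
    rewrite (bigD1 k) /= ?kE// big1 ?addr0// => k' /andP[/eqP k'E kk'].
    have /tuple_uniqP inj : uniq (in_tuple ws) by rewrite /= undup_uniq.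
    by move/inj: k'E => /esym/eqP; rewrite (negbTE kk').
apply: (coords_eq0 ek) => j.
have [jk|jk] := eqVneq (wt j) (x k); last exact: (kap_wtsp (xw k).2).
have : kap j (\sum_k w k) = 0 by rewrite sum0 linear0.
rewrite linear_sum (bigD1 k)//= big1 ?addr0// => k' kk'.
apply: (kap_wtsp (xw k').2); rewrite jk; apply: contra kk' => /eqP/xinj->//.
Qed.

Lemma wtsp_expand w (S : seq J) v : uniq S -> (forall j, (j \in S) = (wt j == w)) ->
  wtsp w v -> v = \sum_(j <- S) kap j v *: eps j.
Proof.
move=> uS SE vw; apply: coords_sumS => // j; rewrite SE; exact: kap_wtsp.
Qed.

Lemma wt_basis w (S : seq J) : uniq S -> (forall j, (j \in S) = (wt j == w)) ->
  is_basis (wtsp w) (fun a : 'I_(size S) => eps (tnth (in_tuple S) a)).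
Proof.
move=> uS SE; split=> [a|v vw].
  have : tnth (in_tuple S) a \in S by apply: mem_tnth.
  by rewrite SE => /eqP <-; apply: eps_wt.
exists (fun a => kap (tnth (in_tuple S) a) v); split.
  by rewrite {1}(wtsp_expand uS SE vw) big_tnth.
move=> c vE; apply/funext => a; rewrite vE linear_sum (bigD1 a)//= linearZ /= (kap_eps ek) eqxx.
rewrite big1 ?addr0 ?[_ *: _]mulr1// => b ba; rewrite linearZ /= (kap_eps ek).
case: eqP => [/esym|_]; last by rewrite [_ *: _]mulr0.
have /tuple_uniqP inj : uniq (in_tuple S) by [].
by move/inj => /eqP; rewrite (negbTE ba).
Qed.

End FromCoords.

Section ToCoords.
Variables (d : hdual -> nat) (e : forall w, 'I_(d w) -> V).
Hypothesis eb : forall w, is_basis (wtsp w) (@e w).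
Hypothesis ds : direct_sum setT setT wtsp.

Definition windex := {w : hdual & 'I_(d w)}.
Definition wvec (j : windex) : V := e (tagged j).

Lemma wvec_wt j : wtsp (tag j) (wvec j).
Proof. exact: (eb _).1. Qed.

Lemma wvec_span : spanned wvec.
Proof.
move=> P P0 PD Pe v; case: ds => _ /(_ v I)[m [x [w [_ xw ->]]]] _.
apply: (big_ind P) => // k _.
have [c [-> _]] := (eb (x k)).2 _ (xw k).2.
by apply: (big_ind P) => // a _; apply: (Pe (c a) (Tagged (fun w => 'I_(d w)) a)).
Qed.

Definition wfiber w : seq windex := [seq Tagged (fun w => 'I_(d w)) a | a <- enum 'I_(d w)].

Lemma wfiberE w (j : windex) : (j \in wfiber w) = (tag j == w).
Proof.
apply/mapP/eqP => [[a _ ->]//|<-]; exists (tagged j); first by rewrite mem_enum.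
by case: j.
Qed.

Lemma wfiber_uniq w : uniq (wfiber w).
Proof. by rewrite map_inj_uniq ?enum_uniq// => a b /eqP; rewrite -tag_eqE /= /tag_eq eqxx tagged_asE => /eqP. Qed.

(** Independence of the union of the bases: the part of each weight in a vanishing combination
    vanishes because the sum of the weight spaces is direct, and then the basis of that weight space
    applies. *)
Lemma wvec_coords : exists kap, coords wvec kap.
Proof.
apply: coords_ex => [|s c us s0 j js]; first exact: wvec_span.
case: ds => _ _ ds3.
pose ws := undup [seq tag i | i <- s].
pose W (w : hdual) := \sum_(i <- s | tag i == w) c i *: wvec i.
have /tuple_uniqP inj : uniq (in_tuple ws) by rewrite /= undup_uniq.
have W0 : W (tag j) = 0.
  have /tnthP[k kE] : tag j \in in_tuple ws by rewrite mem_undup map_f.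
  rewrite kE; apply: (ds3 _ _ (fun k => W (tnth (in_tuple ws) k)) inj) => [k'|].
    split=> //; apply: wtsp_sum => i /eqP <-; exact/wtspZ/wvec_wt.
  rewrite /W (exchange_big_dep xpredT)//= -[RHS]s0; apply: eq_big_seq => i si.
  have /tnthP[k' k'E] : tag i \in in_tuple ws by rewrite mem_undup map_f.
  rewrite (bigD1 k') /= ?k'E// big1 ?addr0// => k'' /andP[/eqP E].
  by move/inj: E => ->; rewrite eqxx.
pose cf (a : 'I_(d (tag j))) : K :=
  if Tagged (fun w => 'I_(d w)) a \in s then c (Tagged (fun w => 'I_(d w)) a) else 0.
have WE : W (tag j) = \sum_a cf a *: e a.
  rewrite /W -big_filter.
  have -> : \sum_a cf a *: e a = \sum_(i <- wfiber (tag j)) (if i \in s then c i else 0) *: wvec i.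
    by rewrite /wfiber big_map big_enum.
  rewrite [RHS](bigID (mem s)) /= [X in _ = _ + X]big1 ?addr0; last first.
    by move=> i /negbTE->; rewrite scale0r.
  rewrite -[RHS]big_filter.
  rewrite (perm_big [seq i <- wfiber (tag j) | i \in s]) /=; last first.
    apply: uniq_perm; rewrite ?filter_uniq ?wfiber_uniq// => i.
    by rewrite !mem_filter wfiberE andbC.
  apply: eq_big_seq => i.
  by rewrite mem_filter => /andP[->].
have [cc [_ ccu]] := (eb (tag j)).2 0 (wtsp0 _).
have e1 := ccu cf; have e2 := ccu (fun=> 0).
have z : 0 = \sum_(a < d (tag j)) (0 : K) *: e a by rewrite big1// => a _; rewrite scale0r.
have : cf = fun=> 0 by rewrite -e1 ?e2// -WE W0.
move=> /(congr1 (fun f => f (tagged j))); rewrite /cf.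
by rewrite (_ : Tagged _ (tagged j) = j) ?js//; case: (j).
Qed.

End ToCoords.
End Weighted.

(** * The tensor product of a module with an extension of scalars *)

Section ExtendedFunctional.
Variables (F : fieldType) (V : lmodType F) (f : {linear V -> F^o}).
Local Notation L := (laurent F).

Definition sext_fun : scalext V -> L := tlift (fun v (d : L) => lconst (f v : F) * d).

Fact sext_fun_bilin : bilin (fun v (d : L) => lconst (f v : F) * d : L).
Proof.
split=> [d c v v'|v c d d'].
  by rewrite linearP !lconstZ scalerDl scalerA.
by rewrite mulrDr -!(lconstZ c) mulrCA.
Qed.

Lemma sext_fun_pure v d : sext_fun (sext_pure v d) = lconst (f v : F) * d.
Proof. exact: (tlift_pure sext_fun_bilin). Qed.

Fact sext_fun_linear : linear (sext_fun : scalext V -> L^o).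
Proof.
have fD x y : sext_fun (x + y) = sext_fun x + sext_fun y.
  by have := tlift_linear sext_fun_bilin 1 x y; rewrite !scale1r.
have f0 : sext_fun 0 = 0 by apply: (addIr (sext_fun 0)); rewrite -fD !add0r.
move=> c x y; rewrite fD; congr (_ + _); rewrite scale_regular.
elim/tens_ind: x => [|x x' Ex Ex'|v d].
- by rewrite scaler0 f0 mulr0.
- by rewrite scalerDr !fD Ex Ex' mulrDr.
- by rewrite -/(sext_pure v d) sext_pureZ !sext_fun_pure mulrCA.
Qed.
HB.instance Definition _ :=
  GRing.isLinear.Build L (scalext V) L^o _ sext_fun sext_fun_linear.

End ExtendedFunctional.

Section TensorFunctional.
Variables (K : fieldType) (VA VB : lmodType K).
Variables (f : {linear VA -> K^o}) (g : {linear VB -> K^o}).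

Definition tens_fun : tens VA VB -> K^o := tlift (fun a b => f a * g b : K^o).

Fact tens_fun_bilin : bilin (fun a b => f a * g b : K^o).
Proof.
split=> [b c a a'|a c b b']; rewrite linearP !scale_regular.
  by rewrite mulrDl mulrA.
by rewrite mulrDr mulrCA.
Qed.

Fact tens_fun_linear : linear tens_fun.
Proof. exact: tlift_linear tens_fun_bilin. Qed.
HB.instance Definition _ :=
  GRing.isLinear.Build K (tens VA VB) K^o _ tens_fun tens_fun_linear.

Lemma tens_fun_pure a b : tens_fun (tpure a b) = f a * g b.
Proof. exact: (tlift_pure tens_fun_bilin). Qed.

End TensorFunctional.

Section TensorCoords.
Variables (F : fieldType) (V1 : lmodType F).
Local Notation L := (laurent F).
Variables (V2 : lmodType L) (J1 J2 : eqType).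
Variables (eps1 : J1 -> V1) (kap1 : J1 -> {linear V1 -> F^o}).
Variables (eps2 : J2 -> V2) (kap2 : J2 -> {linear V2 -> L^o}).
Hypothesis ek1 : coords eps1 kap1.
Hypothesis ek2 : coords eps2 kap2.
Local Notation T := (tens (scalext V1) V2).

Definition teps (j : J1 * J2) : T := tpure (sext_pure (eps1 j.1) 1) (eps2 j.2).
Lemma tepsE j : teps j = tpure (sext_pure (eps1 j.1) 1) (eps2 j.2).
Proof. by []. Qed.

Definition tkap (j : J1 * J2) : {linear T -> L^o} := tens_fun (sext_fun (kap1 j.1)) (kap2 j.2).

Lemma tkap_pure j v d b :
  tkap j (tpure (sext_pure v d) b) = lconst (kap1 j.1 v : F) * d * kap2 j.2 b.
Proof. by rewrite /tkap /= tens_fun_pure /= sext_fun_pure. Qed.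

Lemma tcoords : coords teps tkap.
Proof.
split=> [j j'|P P0 PD Pe].
  rewrite tkap_pure (kap_eps ek1) (kap_eps ek2) mulr1.
  case: j j' => [j1 j2] [j1' j2'] /=; rewrite xpair_eqE.
  by case: (j1 == j1'); rewrite ?rmorph1 ?rmorph0 ?mul1r ?mul0r.
elim/tens_ind => // a b; move: a.
apply: (eps_span ek2 (P := fun b => forall a, P (tpure a b))) => {b}.
- by move=> a; rewrite tpure0r.
- by move=> x y Px Py a; rewrite tpureDr; apply: PD.
move=> c j2 a; rewrite tpureZr; move: c.
elim/tens_ind: a => [c|x y Px Py c|v d c]; first by rewrite tpure0l scaler0.
  by rewrite tpureDl scalerDr; apply: PD.
rewrite -/(sext_pure v d); move: c d.
apply: (eps_span ek1 (P := fun v => forall c d, P (c *: tpure (sext_pure v d) (eps2 j2)))) => {v}.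
- by move=> c d; rewrite /sext_pure tpure0l tpure0l scaler0.
- move=> x y Px Py c d; rewrite /sext_pure tpureDl tpureDl scalerDr; apply: PD; [apply: Px | apply: Py].
move=> c' j1 c d; rewrite /sext_pure tpureC -/(sext_pure _ _).
rewrite -[c' *: d]mulr1 -sext_pureZ tpureZl scalerA.
exact: (Pe _ (j1, j2)).
Qed.

Lemma tens_usum_uniq (W : T -> Prop) (t : nat -> T) s s' :
  usum W t s -> usum W t s' -> s = s'.
Proof.
move=> ts ts'; apply/eqP; rewrite -subr_eq0; apply/eqP/(coords_eq0 tcoords) => j.
have := usumB ts ts' => /(usum_functional (tkap j)) h; apply: lsum_unique h _.
rewrite (_ : (fun l => _) = fun=> 0); first exact: lsum0.
by apply/funext => l; rewrite subrr linear0.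
Qed.

(** All the terms live on the finite set S of coordinates, so convergence reduces to finitely many
    scalar series, each handled by [lsum_ex]. *)
Lemma tens_usum_ex (W : T -> Prop) (S : seq (J1 * J2)) (t : nat -> T) : uniq S ->
  (forall j, j \in S -> W (teps j)) ->
  (forall l j, j \notin S -> tkap j (t l) = 0) ->
  (forall j, exists k : int, forall l : nat, vge (l%:Z - k) (tkap j (t l) : L)) ->
  exists s, usum W t s.
Proof.
move=> uS SW tS tv.
have /choice[f fP] : forall j, exists s : L, lsum (fun l => tkap j (t l) : L) s.
  by move=> j; have [k /lsum_ex] := tv j.
exists (\sum_(j <- S) f j *: teps j).
have h : usum W (fun l => \sum_(j <- S | j \in S) tkap j (t l) *: teps j) (\sum_(j <- S | j \in S) f j *: teps j).
  by apply: usum_sum => j jS; apply: usum_one => //; apply: SW.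
apply: (usum_ext h) => [l|]; rewrite -big_seq//.
by apply/esym/(coords_sumS tcoords uS) => j; apply: tS.
Qed.

End TensorCoords.

Section ModuleWeights.
Variables (RR : realType) (q : qparam RR) (n : nat) (C : cartan_datum n).
Variables (H : realization C) (K : fieldType) (io : {rmorphism RR[i] -> K}).
Variables (V : lmodType K) (M : uops H V).
Hypothesis HM : is_umodule q io M.
Local Notation wtsp := (wtsp q io M).

Lemma phi_wtsp s i m w v : wtsp w v -> wtsp w (phi q io M s i m v).
Proof. by move=> vw h; rewrite (uk_phi HM) vw linearZ. Qed.

Lemma ux_wtsp s i r w v : wtsp w v ->
  wtsp (if s then w + sroot H i else w - sroot H i) (ux M s i r v).
Proof.
move=> vw h; rewrite (ukx' HM) vw linearZ /= scalerA -rmorphM -qpowD; congr (io (qpow q _) *: _).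
by case: s; rewrite add_lfunE ?opp_lfunE /sg ?mul1r ?mulN1r addrC.
Qed.

Lemma phi0_wtsp s i w v : wtsp w v ->
  phi q io M s i 0 v = io (qpow q ((sg s * (csym C i)%:Z)%:~R * w (coroot H i))) *: v.
Proof. by move=> vw; rewrite phi_at0 vw linearZ. Qed.

End ModuleWeights.

Section ScalarExtensionModule.
Variables (RR : realType) (q : qparam RR) (n : nat) (C : cartan_datum n).
Variables (H : realization C).
Local Notation L := (laurent RR[i]).
Local Notation lc := (@lconst RR[i]).
Variables (V : lmodType RR[i]) (M : uops H V).
Local Notation A := (iops M).

(** The embedding of V is only semilinear, over [lconst]; it is therefore bundled as an additive
    map. *)
Definition sext1 (v : V) : scalext V := sext_pure v 1.

Fact sext1_zmod : zmod_morphism sext1.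
Proof. by move=> x y; rewrite /sext1 /sext_pure tpureBl. Qed.
HB.instance Definition _ := GRing.isZmodMorphism.Build V (scalext V) sext1 sext1_zmod.

Lemma sext1Z c v : sext1 (c *: v) = lc c *: sext1 v.
Proof.
by rewrite /sext1 sext_pureZ mulr1 /sext_pure tpureC -lconstZ mulr1.
Qed.

Lemma sext_pure1 v d : sext_pure v d = d *: sext1 v.
Proof. by rewrite /sext1 sext_pureZ mulr1. Qed.

Lemma sext_ext (W : lmodType L) (f g : scalext V -> W) : linear f -> linear g ->
  (forall v, f (sext1 v) = g (sext1 v)) -> f =1 g.
Proof.
move=> fl gl fg x.
pose f' : {linear scalext V -> W} := HB.pack f (GRing.isLinear.Build L _ _ _ _ fl).
pose g' : {linear scalext V -> W} := HB.pack g (GRing.isLinear.Build L _ _ _ _ gl).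
change (f' x = g' x); elim/tens_ind: x => [|x y Ex Ey|v d].
- by rewrite !linear0.
- by rewrite (linearD f') (linearD g') Ex Ey.
- by rewrite -/(sext_pure v d) sext_pure1 !linearZ /= fg.
Qed.

Lemma iops_ux s i m v : ux A s i m (sext1 v) = sext1 (ux M s i m v).
Proof. exact: sext_map_pure. Qed.

Lemma iops_uk h v : uk A h (sext1 v) = sext1 (uk M h v).
Proof. exact: sext_map_pure. Qed.

Lemma iops_uh i m v : uh A i m (sext1 v) = sext1 (uh M i m v).
Proof. exact: sext_map_pure. Qed.

Hypothesis HM : is_umodule q idfun M.

Lemma iops_hser s i m v : hser q lc A s i m (sext1 v) = sext1 (hser q idfun M s i m v).
Proof.
case: (posnP m) => [->|m0]; first by rewrite !hser0 raddf0.
by rewrite !hserE// iops_uh sext1Z.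
Qed.

Ltac sext_gen v := move: v; refine (sext_ext _ _ _); [lin | lin | ]; cbv beta.

Lemma iops_hser_comm s i m m' v :
  hser q lc A s i m (hser q lc A s i m' v) = hser q lc A s i m' (hser q lc A s i m v).
Proof.
by sext_gen v => v; rewrite !iops_hser (hser_comm HM).
Qed.

Lemma iops_phi s i m v : phi q lc A s i m (sext1 v) = sext1 (phi q idfun M s i m v).
Proof.
rewrite /phi -iops_uk; congr (uk _ _ _).
apply/esym/(@ops_exp_intertwine _ _ _ _ (hser q idfun M s i) (hser q lc A s i)
  (rmorph_char0 idfun) (rmorph_char0 lc)).
- by [].
- by move=> *; apply: hser_comm.
- by [].
- by move=> *; apply: iops_hser_comm.
- by move=> k w; apply: (esym (iops_hser _ _ _ _)).
Qed.

Lemma iops_phiz s i m v : phiz q lc A s i m (sext1 v) = sext1 (phiz q idfun M s i m v).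
Proof. by rewrite /phiz; case: ifP => _; rewrite ?iops_phi ?raddf0. Qed.

Lemma iops_umodule : is_umodule q lc A.
Proof.
split.
- by move=> i v; sext_gen v => v; rewrite iops_uh (uh0 HM) raddf0.
- by move=> h h' v; sext_gen v => v; rewrite !iops_uk (ukD HM).
- by move=> v; sext_gen v => v; rewrite !iops_uk (uk0 HM).
- by move=> h j m v m0; sext_gen v => v; rewrite !(iops_uk, iops_uh) (ukh HM).
- by move=> i j m m' v m0 m0'; sext_gen v => v; rewrite !iops_uh (uhh HM).
- by move=> h s j r v; sext_gen v => v; rewrite !(iops_uk, iops_ux) (ukx HM) sext1Z.
- move=> i m s j r v m0; sext_gen v => v.
  by rewrite !(iops_uh, iops_ux) -raddfB /= (uhx HM)// sext1Z.
- move=> i j r r' v; case: eqP => [<-|/eqP ij]; sext_gen v => v.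
    by rewrite !iops_ux -raddfB /= (uxx_pm HM) eqxx sext1Z !iops_phiz raddfB.
  by rewrite !iops_ux -raddfB /= (uxx_pm HM) (negbTE ij) raddf0.
- move=> s i j r r' v c; sext_gen v => v.
  by rewrite !iops_ux -!sext1Z -!raddfB /= (uxx HM).
Qed.

End ScalarExtensionModule.

Section OperatorSum.
Variables (RR : realType) (n : nat) (C : cartan_datum n) (H : realization C).
Local Notation F := (RR[i]).
Local Notation L := (laurent F).
Local Notation hdual := 'Hom(hsp H, rat^o).
Variables (V1 : lmodType F) (V2 : lmodType L) (J1 J2 : eqType).
Variables (eps1 : J1 -> V1) (kap1 : J1 -> {linear V1 -> F^o}).
Variables (eps2 : J2 -> V2) (kap2 : J2 -> {linear V2 -> L^o}).
Hypothesis ek1 : coords eps1 kap1.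
Hypothesis ek2 : coords eps2 kap2.
Local Notation T := (tens (scalext V1) V2).
Local Notation teps := (teps eps1 eps2).
Local Notation tkap := (tkap kap1 kap2).
Local Notation all := (fun=> True).
Variables (wt : J1 * J2 -> hdual) (S : hdual -> seq (J1 * J2)).
Hypothesis S_uniq : forall w, uniq (S w).
Hypothesis SE : forall w j, (j \in S w) = (wt j == w).

Definition tweight (w : hdual) (v : T) := forall j, wt j != w -> tkap j v = 0.

Lemma tweight_eps j : tweight (wt j) (teps j).
Proof.
move=> j' jj; rewrite (kap_eps (tcoords ek1 ek2)); case: eqP => // jE.
by rewrite jE eqxx in jj.
Qed.

(** The limit is chosen vector by vector, and is linear because limits are unique. The second
    conclusion keeps the sum inside one weight space, as [is_Delta] demands; it holds for basis
    vectors, and a weight vector involves finitely many of these. *)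
Lemma operator_sum_ex (X : nat -> {linear T -> T}) (a : hdual) :
  (forall l j, tweight (wt j + a) (X l (teps j))) ->
  (forall j j', exists k : int, forall l : nat, vge (l%:Z - k) (tkap j' (X l (teps j)) : L)) ->
  exists2 Xs : {linear T -> T}, forall v, usum all (X ^~ v) (Xs v)
    & forall w v, tweight w v -> usum (tweight (w + a)) (X ^~ v) (Xs v).
Proof.
move=> Xw Xv; have ek := tcoords ek1 ek2.
have base j : exists s, usum (tweight (wt j + a)) (X ^~ (teps j)) s.
  apply: (tens_usum_ex ek1 ek2 (S_uniq (wt j + a))) => [j' jS|l j' jS|j'].
  - by move: jS; rewrite SE => /eqP <-; apply: tweight_eps.
  - by apply: Xw; rewrite -SE.
  - exact: Xv.
have [b bP] := choice base.
have sumP (W : T -> Prop) (s : seq (J1 * J2)) (c : J1 * J2 -> L) :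
    (forall j x, j \in s -> tweight (wt j + a) x -> W x) ->
    usum W (X ^~ (\sum_(j <- s) c j *: teps j)) (\sum_(j <- s) c j *: b j).
  move=> sW; rewrite big_seq [X in usum _ _ X]big_seq.
  have h := @usum_sum _ _ W _ s (mem s) (fun j l => c j *: X l (teps j)) (fun j => c j *: b j).
  refine (usum_ext (h _) _ erefl) => [j js|l].
    by apply: usumZ; apply: (usumW _ (bP j)) => x; apply: sW.
  by rewrite linear_sum; apply: eq_bigr => j _; rewrite linearZ.
have ex v : exists s, usum all (X ^~ v) s.
  have [s us ->] := coords_sum v ek.
  by exists (\sum_(j <- s) tkap j v *: b j); apply: sumP.
have [f fP] := choice ex.
have fl : linear f.
  move=> c x y; apply: (tens_usum_uniq ek1 ek2 (fP _)).
  by apply: (usum_ext (usumD (usumZ c (fP x)) (fP y))) => // l; rewrite linearP.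
pose Xs : {linear T -> T} := HB.pack f (GRing.isLinear.Build L T T _ _ fl).
exists Xs => // w v vw.
have vE : v = \sum_(j <- S w) tkap j v *: teps j.
  by apply: (coords_sumS ek) => // j; rewrite SE; apply: vw.
have h := sumP (tweight (w + a)) (S w) (fun j => tkap j v) _.
rewrite -vE in h; rewrite -[Xs v]/(f v).
rewrite -(tens_usum_uniq ek1 ek2 (usumW (fun _ _ => I) (h _)) (fP v)).
  by apply: h => j x; rewrite SE => /eqP <-.
by move=> j x; rewrite SE => /eqP <-.
Qed.

End OperatorSum.

(** * Generalized eigenspaces *)

(** The same label may occur several times in such a sum; [sumclos_repr] merges equal labels to
    produce the injective families of [direct_sum]. *)
Inductive sumclos (V : nmodType) (P : V -> Prop) : V -> Prop :=
| sumclos_nil : sumclos P 0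
| sumclos_cons x v : P x -> sumclos P v -> sumclos P (x + v).

Section SumClosure.
Variables (V : nmodType).
Implicit Types (P : V -> Prop).

Lemma sumclosD P x y : sumclos P x -> sumclos P y -> sumclos P (x + y).
Proof.
elim=> [|a v Pa _ IH] Py; first by rewrite add0r.
by rewrite -addrA; apply: sumclos_cons => //; apply: IH.
Qed.

Lemma sumclos_one P x : P x -> sumclos P x.
Proof. by move=> Px; rewrite -[x]addr0; apply: sumclos_cons => //; apply: sumclos_nil. Qed.

Lemma sumclos_sum P (I : Type) (r : seq I) (Q : pred I) (f : I -> V) :
  (forall i, Q i -> sumclos P (f i)) -> sumclos P (\sum_(i <- r | Q i) f i).
Proof.
by move=> h; apply: (big_ind (sumclos P)) => //; [exact: sumclos_nil | exact: sumclosD].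
Qed.

Lemma sumclosW P P' x : (forall v, v != 0 -> P v -> P' v) -> sumclos P x -> sumclos P' x.
Proof.
move=> PP'; elim=> [|a v Pa _ IH]; first exact: sumclos_nil.
have [->|a0] := eqVneq a 0; first by rewrite add0r.
by apply: sumclos_cons => //; apply: PP'.
Qed.

Lemma sumclos_repr (J : Type) (Q : J -> Prop) (S : J -> V -> Prop) v :
  (forall j x y, S j x -> S j y -> S j (x + y)) ->
  sumclos (fun x => exists2 j, Q j & S j x) v ->
  exists d (x : 'I_d -> J) (w : 'I_d -> V),
    [/\ injective x, forall k, Q (x k) /\ S (x k) (w k) & v = \sum_k w k].
Proof.
move=> SD; elim=> [|a u [j Qj Sj] _ [d [x [w [xi xw ->]]]]].
  have f0 (T : Type) : 'I_0 -> T by case.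
  by exists 0%N, (f0 J), (f0 V); split; rewrite ?big_ord0//; case.
have [[k xk]|nk] := pselect (exists k, x k = j).
  exists d, x, (fun i => if i == k then a + w i else w i); split=> // [i|].
    case: eqP => [->|_] //; split; first exact: (xw k).1.
    by apply: SD; [rewrite xk | apply: (xw k).2].
  rewrite (bigD1 k)//= [RHS](bigD1 k)//= eqxx addrA; congr (_ + _).
  by apply: eq_bigr => i /negbTE->.
exists d.+1, (fun i => if unlift ord0 i is Some i' then x i' else j).
exists (fun i => if unlift ord0 i is Some i' then w i' else a); split.
- move=> i i'; case: unliftP => [k ->|->]; case: unliftP => [k' ->|->] //.
  + by move/xi => ->.
  + by move=> E; case: nk; exists k.
  + by move=> E; case: nk; exists k'.
- by move=> i; case: unliftP.
- rewrite big_ord_recl unlift_none; congr (_ + _); apply: eq_bigr => i _.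
  by rewrite liftK.
Qed.

End SumClosure.

Lemma sumclos_map (V V' : zmodType) (f : {additive V -> V'}) P P' x :
  (forall v, P v -> P' (f v)) -> sumclos P x -> sumclos P' (f x).
Proof.
move=> PP'; elim=> [|a v Pa _ IH]; first by rewrite raddf0; apply: sumclos_nil.
by rewrite raddfD; apply: sumclos_cons => //; apply: PP'.
Qed.

Section GeneralizedEigen.
Variables (K : fieldType) (V : lmodType K).
Implicit Types (f g : {linear V -> V}) (c : K) (v : V).

Definition shiftop f c : {linear V -> V} := f \- (c \*: idfun).

Lemma shiftopE f c v : shiftop f c v = f v - c *: v.
Proof. by []. Qed.

Lemma iter_linear0 f p : iter p f 0 = 0.
Proof. by elim: p => [//|p IH]; rewrite iterS IH linear0. Qed.

Lemma iter_linearD f p v w : iter p f (v + w) = iter p f v + iter p f w.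
Proof. by elim: p => [//|p IH]; rewrite !iterS IH linearD. Qed.

Lemma iter_linearZ f p c v : iter p f (c *: v) = c *: iter p f v.
Proof. by elim: p => [//|p IH]; rewrite !iterS IH linearZ. Qed.

Lemma iter_le f p p' v : (p <= p')%N -> iter p f v = 0 -> iter p' f v = 0.
Proof. by move=> /subnK <- h; rewrite iterD h iter_linear0. Qed.

Lemma iter_comm f g p v : (forall w, f (g w) = g (f w)) -> iter p f (g v) = g (iter p f v).
Proof. by move=> fg; elim: p => [//|p IH]; rewrite !iterS IH fg. Qed.

Lemma shiftop_comm f g c v : (forall w, f (g w) = g (f w)) ->
  shiftop f c (g v) = g (shiftop f c v).
Proof. by move=> fg; rewrite !shiftopE fg (linearB g) (linearZ_LR g). Qed.

(** Induction on p + p': applying one shifted operator lowers its own exponent and, by commutation,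
    preserves the other. Both thus kill v, and then a v = f v = b v. *)
Lemma shiftop_inj f a b p p' v : a != b ->
  iter p (shiftop f a) v = 0 -> iter p' (shiftop f b) v = 0 -> v = 0.
Proof.
move=> ab; have [N] := ubnP (p + p'); elim: N p p' v => // N IH [|p] [|p'] v //.
move=> ltN; rewrite !iterSr => va vb.
have fC w : shiftop f b (shiftop f a w) = shiftop f a (shiftop f b w).
  by apply: shiftop_comm => x; apply/esym/shiftop_comm.
have fC' w : shiftop f a (shiftop f b w) = shiftop f b (shiftop f a w) by [].
have fa : shiftop f a v = 0.
  apply: (IH p p'.+1); [by lia | exact: va |].
  by rewrite iter_comm// iterSr vb linear0.
have fb : shiftop f b v = 0.
  apply: (IH p.+1 p'); [by lia | | exact: vb].
  by rewrite iter_comm// iterSr va linear0.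
move: fa fb; rewrite !shiftopE => /eqP; rewrite subr_eq0 => /eqP ->.
by move=> /eqP; rewrite -scalerBl scaler_eq0 subr_eq0 (negbTE ab) => /eqP.
Qed.

(** Induction on p + p' in place of the binomial formula: h v = f v + g v, where f v has a lower
    exponent for f, and g v a lower one for g. *)
Lemma iter_add_nil f g (h : {linear V -> V}) p p' v :
  (forall w, h w = f w + g w) -> (forall w, f (g w) = g (f w)) ->
  iter p f v = 0 -> iter p' g v = 0 -> iter (p + p') h v = 0.
Proof.
move=> hE fg; have [N] := ubnP (p + p'); elim: N p p' v => // N IH p p' v ltN.
case: p ltN => [|p] ltN; first by move=> v0 _; rewrite [v]v0 iter_linear0.
case: p' ltN => [|p'] ltN; first by move=> _ v0; rewrite [v]v0 iter_linear0.
move=> fv gv; rewrite addSn iterSr hE iter_linearD.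
rewrite (_ : iter _ _ (f v) = 0) ?add0r; last first.
  apply: (IH p p'.+1); [by lia | by rewrite -iterSr |].
  by rewrite iter_comm ?gv ?linear0// => w; rewrite fg.
rewrite addnS -addSn; apply: (IH p.+1 p'); [by lia | | by rewrite -iterSr].
by rewrite iter_comm ?fv ?linear0.
Qed.

Lemma iter_sum_nil (h : nat -> {linear V -> V}) m v :
  (forall i j w, h i (h j w) = h j (h i w)) ->
  (forall i, exists p, iter p (h i) v = 0) ->
  exists p, iter p (fun w => \sum_(i < m) h i w) v = 0.
Proof.
move=> hC hv; elim: m => [|m [p IH]].
  by exists 1%N; rewrite /= big_ord0.
have lin : linear (fun w => \sum_(i < m) h i w) by apply: linear_sumE => i; apply: linearP.
pose g : {linear V -> V} := HB.pack (fun w => \sum_(i < m) h i w) (GRing.isLinear.Build K V V _ _ lin).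
have [p' hm] := hv m; exists (p + p')%N.
have lin' : linear (fun w => \sum_(i < m.+1) h i w) by apply: linear_sumE => i; apply: linearP.
pose g' : {linear V -> V} := HB.pack (fun w => \sum_(i < m.+1) h i w) (GRing.isLinear.Build K V V _ _ lin').
apply: (@iter_add_nil g (h m) g') => // w; first by rewrite /= big_ord_recr.
by rewrite /= linear_sum; apply: eq_bigr => i _; apply: hC.
Qed.

Section Joint.
Variables (X : Type) (f : X -> {linear V -> V}).
Hypothesis fC : forall s t v, f s (f t v) = f t (f s v).

Definition geig (Psi : X -> K) v := exists p, forall t, iter p (shiftop (f t) (Psi t)) v = 0.

(** At an index t where the first system differs from Psi, a power of the shifted operator kills the
    first w, preserves every joint eigenspace and is injective on that of Psi. It thus removes one
    summand without losing v. *)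
Lemma geig_indep d (x : 'I_d -> X -> K) (w : 'I_d -> V) Psi v :
  geig Psi v -> (forall k, geig (x k) (w k) /\ x k <> Psi) ->
  v + \sum_k w k = 0 -> v = 0.
Proof.
elim: d x w v => [|d IH] x w v gv gw; first by rewrite big_ord0 addr0.
rewrite big_ord_recl addrCA => sum0.
have [[p hp] x0] := gw ord0.
have [t /eqP xt] : exists t, x ord0 t <> Psi t.
  by apply: contrapT => /forallNP h; apply: x0; apply/funext => t; apply: contrapT; apply: h.
pose g := iter p (shiftop (f t) (x ord0 t)).
have gg Psi' u : geig Psi' u -> geig Psi' (g u).
  move=> [p' hp']; exists p' => s; rewrite /g.
  elim: (p) => [|m IHm]; first exact: hp'.
  rewrite iterS iter_comm ?IHm ?linear0// => y.
  by rewrite shiftop_comm// => z; apply/esym/shiftop_comm => z'; rewrite fC.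
have gv0 : g v = 0.
  apply: (IH (fun k => x (lift ord0 k)) (fun k => g (w (lift ord0 k)))).
  - exact: gg.
  - by move=> k; split; [apply/gg/(gw _).1 | apply: (gw _).2].
  have gD a b : g (a + b) = g a + g b by apply: iter_linearD.
  rewrite -(big_morph g gD (iter_linear0 _ _)).
  have : g (w ord0 + (v + \sum_(k < d) w (lift ord0 k))) = 0.
    by rewrite sum0; apply: iter_linear0.
  by rewrite gD [g (w ord0)](hp t) add0r gD.
have [p' hp'] := gv.
by apply: (shiftop_inj xt gv0 (hp' t)).
Qed.

Lemma geigD Psi v w : geig Psi v -> geig Psi w -> geig Psi (v + w).
Proof.
move=> [p hp] [p' hp']; exists (p + p')%N => t; rewrite iter_linearD.
by rewrite (iter_le (leq_addr _ _) (hp t)) (iter_le (leq_addl _ _) (hp' t)) addr0.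
Qed.

End Joint.
End GeneralizedEigen.

Lemma sumclos_bind (V : nmodType) (P P' : V -> Prop) v :
  (forall x, P x -> sumclos P' x) -> sumclos P v -> sumclos P' v.
Proof.
move=> PP'; elim=> [|x w Px _ IH]; first exact: sumclos_nil.
by apply: sumclosD => //; apply: PP'.
Qed.

(** * Simultaneous decomposition over an algebraically closed field *)

Section JointMatrix.
Variables (C : closedFieldType) (n : nat).
Local Notation rV := 'rV[C]_n.+1.
Local Notation Mn := 'M[C]_n.+1.

(** Primary decomposition for one matrix. All the occurrences of a root z are separated at once, so
    that p and q are coprime; the components of c are its images under polynomials in A, hence stay
    in the stable subspace U. *)
Lemma mx_split (A U : Mn) m r (c : rV) : stablemx U A -> (size r <= m)%N ->
  (c <= U)%MS -> c *m horner_mx A (\prod_(z <- r) ('X - z%:P)) = 0 ->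
  sumclos (fun x => (x <= U)%MS /\ exists z, x *m (A - z%:M) ^+ m = 0) c.
Proof.
move=> UA; have [N] := ubnP (size r); elim: N r c => // N IH [|z r0] c rN rm cU.
  by rewrite big_nil rmorph1 mulmx1 => ->; apply: sumclos_nil.
set r := z :: r0 in rN rm *; pose r' := [seq x <- r | x != z]; pose k := count_mem z r.
pose p : {poly C} := ('X - z%:P) ^+ k; pose q : {poly C} := \prod_(x <- r') ('X - x%:P).
have -> : \prod_(x <- r) ('X - x%:P) = p * q.
  rewrite (bigID (pred1 z)) /= /q big_filter; congr (_ * _).
  rewrite (eq_bigr (fun=> 'X - z%:P)) => [|x /eqP->//].
  by rewrite big_const_seq iter_mulr_1.
have r'lt : (size r' < N)%N.
  have : (size r' <= size r0)%N by rewrite /r' /= eqxx /= size_filter count_size.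
  by move: rN; rewrite /r /=; lia.
have km : (k <= m)%N by apply: leq_trans rm; apply: count_size.
have : coprimep p q.
  apply: coprimep_expl; rewrite coprimep_sym coprimep_XsubC root_prod_XsubC.
  by rewrite mem_filter eqxx.
move=> /Bezout_eq1_coprimepP [[/= a b] ab] cpq.
have hM (x y : {poly C}) : horner_mx A (x * y) = horner_mx A x *m horner_mx A y.
  by rewrite rmorphM.
have sub (x : {poly C}) : (c *m horner_mx A x <= U)%MS.
  by apply: submx_trans (submxMr _ cU) _; apply: horner_mx_stable.
(* In the Bezout relation a p + b q = 1, the component with b q is killed by a power of A - z, and
   the component with a p is killed by q(A). *)
have -> : c = c *m horner_mx A (b * q) + c *m horner_mx A (a * p).
  by rewrite -mulmxDr -rmorphD addrC ab rmorph1 mulmx1.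
apply: sumclos_cons.
  split=> //; exists z.
  have -> : (A - z%:M) ^+ m = horner_mx A (p * ('X - z%:P) ^+ (m - k)).
    by rewrite /p -exprD subnKC// rmorphXn rmorphB /= horner_mx_X horner_mx_C.
  rewrite -mulmxA -hM (_ : _ * _ = p * q * (b * ('X - z%:P) ^+ (m - k))); last by ring.
  by rewrite hM mulmxA cpq mul0mx.
apply: (IH r') => //; first by apply: leq_trans rm; rewrite size_filter count_size.
rewrite -/q -mulmxA -hM (_ : _ * _ = p * q * a); last by ring.
by rewrite hM mulmxA cpq mul0mx.
Qed.

(** Induction on the rank of U. If every A t has a single generalized eigenvalue on U, nothing is
    left to split. Otherwise some t splits c into components lying in strictly smaller subspaces,
    still stable by commutation. The family may thus be infinite. *)
Lemma mx_joint (X : Type) (A : X -> Mn) (U : Mn) (c : rV) :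
  (forall s t, A s *m A t = A t *m A s) -> (forall t, stablemx U (A t)) -> (c <= U)%MS ->
  sumclos (fun x => exists Psi : X -> C, forall t, x *m (A t - (Psi t)%:M) ^+ n.+1 = 0) c.
Proof.
move=> AC; have [N] := ubnP (\rank U); elim: N U c => // N IH U c rU UA cU.
have [/choice[Psi UP]|] := pselect (forall t, exists z, (U <= kermx ((A t - z%:M) ^+ n.+1))%MS).
  apply: sumclos_one; exists Psi => t; apply/sub_kermxP.
  exact: submx_trans cU (UP t).
move=> /existsNP[t /forallNP nt].
have [r rE] := closed_field_poly_normal (char_poly (A t)).
have := char_poly_monic (A t); rewrite monicE => /eqP lc1; rewrite lc1 scale1r in rE.
have sr : size r = n.+1.
  by have := size_char_poly (A t); rewrite rE size_prod_XsubC => -[].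
apply: (sumclos_bind _ (@mx_split (A t) U n.+1 r c (UA t) _ cU _)); last 2 first.
- by rewrite sr.
- by rewrite -rE Cayley_Hamilton mulmx0.
move=> x [xU [z xz]]; pose U' := (U :&: kermx ((A t - z%:M) ^+ n.+1))%MS.
apply: (IH U').
- rewrite -ltnS (leq_trans _ rU)// ltnS; apply: rank_ltmx; rewrite /U' ltmxE capmxSl /=.
  by rewrite sub_capmx negb_and; apply/orP; right; apply/negP/nt.
- move=> s; rewrite /U' sub_capmx; apply/andP; split.
    exact: submx_trans (submxMr _ (capmxSl _ _)) (UA s).
  apply: submx_trans (submxMr _ (capmxSr _ _)) _; apply: comm_mx_stable_ker.
  have : GRing.comm (A s) (A t - z%:M).
    by apply: commrB; [exact: AC | apply: scalar_mxC].
  by move/(commrX n.+1) => h; apply/esym.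
- by rewrite /U' sub_capmx xU; apply/sub_kermxP.
Qed.

End JointMatrix.

Section FiniteDimensional.
Variables (K : fieldType) (V : lmodType K) (W : V -> Prop) (d : nat) (e : 'I_d -> V).
Hypothesis We : is_basis W e.
Hypothesis Wsum : forall c : 'I_d -> K, W (\sum_a c a *: e a).

Lemma basis_inj (c c' : 'I_d -> K) : \sum_a c a *: e a = \sum_a c' a *: e a -> c = c'.
Proof.
move=> cc; have [x [_ xu]] := We.2 _ (Wsum c).
by rewrite -(xu c)// -(xu c').
Qed.

(** An l-weight space asks for one exponent valid for all the phi's, whereas nilpotency is first
    obtained with an exponent depending on each of them. *)
Lemma nil_bound (f : {linear V -> V}) N v : (forall v, W v -> W (f v)) -> W v ->
  iter N f v = 0 -> iter d f v = 0.
Proof.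
move=> Wf Wv fN; apply: contrapT => /eqP fd.
have ex : exists N, iter N f v == 0 by exists N; apply/eqP.
case: (ex_minnP ex) => {fN ex}N /eqP fN Nmin.
have dN : (d < N)%N.
  by rewrite ltnNge; apply: contra fd => Nd; rewrite (iter_le Nd).
have Wi k : W (iter k f v) by elim: k => //= k; apply: Wf.
have /choice[c cE] k : exists c : 'I_d -> K, iter k f v = \sum_a c a *: e a.
  by have [c [-> _]] := We.2 _ (Wi k); exists c.
pose A : 'M[K]_(d.+1, d) := \matrix_(k, a) c k a.
(* The d + 1 vectors v, f v, ..., f^d v lie in a space of dimension d, so they satisfy a nontrivial
   relation r. *)
have : kermx A != 0.
  rewrite kermx_eq0 /row_free; apply/negP => /eqP rA.
  by have := rank_leq_col A; rewrite rA ltnn.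
move=> /rowV0Pn[r /sub_kermxP rA r0].
have sum0 : \sum_(k < d.+1) r 0 k *: iter k f v = 0.
  rewrite (eq_bigr (fun k : 'I_d.+1 => \sum_a (r 0 k * c k a) *: e a)).
    rewrite exchange_big big1// => a _; rewrite -scaler_suml.
    have := congr1 (fun M : 'rV_d => M 0 a) rA; rewrite !mxE => h.
    rewrite (_ : \sum_(i < _) _ = 0) ?scale0r// -[RHS]h.
    by apply: eq_bigr => k _; rewrite mxE.
  by move=> k _; rewrite cE scaler_sumr; apply: eq_bigr => a _; rewrite scalerA.
have exk : exists k : nat, [exists i : 'I_d.+1, (i == k :> nat) && (r 0 i != 0)].
  by have /rV0Pn[i ri] := r0; exists i; apply/existsP; exists i; rewrite eqxx.
case: (ex_minnP exk) => k /existsP[i /andP[/eqP ik ri]] kmin.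
have iN : (i < N)%N by apply: leq_trans (ltn_ord i) dN.
(* This power of f turns the first nonzero term of the relation into a multiple of f^(N-1) v and
   kills the later ones, against the minimality of N. *)
have := congr1 (iter (N.-1 - i) f) sum0; rewrite iter_linear0.
rewrite (big_morph _ (@iter_linearD _ _ f _) (iter_linear0 _ _)) (bigD1 i)//= big1 ?addr0.
  rewrite iter_linearZ -iterD subnK; last by lia.
  move/eqP; rewrite scaler_eq0 (negbTE ri) /= => /Nmin; lia.
move=> j ji; rewrite iter_linearZ -iterD.
have [ltj|] := ltnP j i; last first.
  move=> ij; rewrite (iter_le _ fN) ?scaler0//.
  have : (nat_of_ord j != i)%N by [].
  lia.
have [->|rj] := eqVneq (r 0 j) 0; first by rewrite scale0r.
have := kmin j; rewrite -ik leqNgt ltj => /(_ _)/negP; case=> //.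
by apply/existsP; exists j; rewrite eqxx.
Qed.

End FiniteDimensional.

Section JointDecomposition.
Variables (K : closedFieldType) (V : lmodType K) (W : V -> Prop) (d : nat) (e : 'I_d -> V).
Hypothesis We : is_basis W e.
Hypothesis Wsum : forall c : 'I_d -> K, W (\sum_a c a *: e a).
Variables (X : Type) (f : X -> {linear V -> V}).
Hypothesis fC : forall s t v, f s (f t v) = f t (f s v).
Hypothesis Wf : forall t v, W v -> W (f t v).

Lemma geig_decomp v : W v -> sumclos (fun x => W x /\ exists Psi, geig f Psi x) v.
Proof.
move=> Wv; have [c [vE _]] := We.2 _ Wv; rewrite {}vE {Wv}.
(* The matrix lemmas are stated in positive size, hence the separate case d = 0. *)
case: d e We Wsum c => [|n] eb Web Wsumb c.
  by rewrite big_ord0; apply: sumclos_nil.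
have /choice[a aE] : forall t, exists a : 'I_n.+1 -> 'I_n.+1 -> K,
    forall i, f t (eb i) = \sum_j a i j *: eb j.
  move=> t.
  suff /choice[a aE] : forall i, exists c' : 'I_n.+1 -> K, f t (eb i) = \sum_j c' j *: eb j.
    by exists a.
  by move=> i; have [c' [-> _]] := Web.2 _ (Wf t (Web.1 i)); exists c'.
pose A t : 'M[K]_n.+1 := \matrix_(i, j) a t i j.
pose vec (r : 'rV[K]_n.+1) := \sum_i r 0 i *: eb i.
have vec_zmod : zmod_morphism vec.
  by move=> r s; rewrite -sumrB; apply: eq_bigr => i _; rewrite !mxE scalerBl.
pose vecL : {additive 'rV[K]_n.+1 -> V} := HB.pack vec (GRing.isZmodMorphism.Build _ _ vec vec_zmod).
have vecZ z r : vec (z *: r) = z *: vec r.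
  by rewrite scaler_sumr; apply: eq_bigr => i _; rewrite mxE scalerA.
have vecA t r : vec (r *m A t) = f t (vec r).
  rewrite linear_sum (eq_bigr (fun i => \sum_j (r 0 i * a t i j) *: eb j)).
    rewrite exchange_big; apply: eq_bigr => j _; rewrite mxE scaler_suml.
    by apply: eq_bigr => i _; rewrite mxE.
  by move=> i _; rewrite linearZ /= aE scaler_sumr; apply: eq_bigr => j _; rewrite scalerA.
(* Commutation passes from the operators to their matrices because coordinates on the basis are
   unique. *)
have AC s t : A s *m A t = A t *m A s.
  apply/row_matrixP => i; rewrite !row_mul; apply/rowP => j.
  have : vec (row i (A s) *m A t) = vec (row i (A t) *m A s).
    by rewrite !rowE -!mulmxA !mulmxA !vecA fC.
  by move/(basis_inj Web Wsumb)/(congr1 (fun h => h j)).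
have vecS t z r p : vec (r *m (A t - z%:M) ^+ p) = iter p (shiftop (f t) z) (vec r).
  elim: p r => [|p IH] r; first by rewrite mulmx1.
  rewrite exprSr mulmxA iterS -IH shiftopE -vecA -vecZ -vec_zmod; congr vec.
  by rewrite mulmxBr mul_mx_scalar.
have -> : \sum_k c k *: eb k = vecL (\row_k c k).
  by apply: eq_bigr => k _; rewrite mxE.
have dec := @mx_joint K n X A 1%:M (\row_k c k) AC (fun t => submx1 _) (submx1 _).
apply: (sumclos_map _ dec) => r [Psi rP]; split; first exact: Wsumb.
by exists Psi, n.+1 => t; rewrite -vecS rP; apply: (raddf0 vecL).
Qed.

End JointDecomposition.

(** * Bounds, uniqueness and l,u-weights *)

(** Uniqueness of the module is an equality of records of bundled linear maps, so agreement on
    vectors has to give equality of the bundles, by proof irrelevance. *)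
Lemma linear_eq (K : fieldType) (U V : lmodType K) (f g : {linear U -> V}) :
  f =1 g -> f = g.
Proof.
move=> /funext; case: f => f cf; case: g => g cg /= fg.
case: g / fg cg => cg; congr (GRing.Linear.Pack _).
case: cf => -[a] [b]; case: cg => -[c] [d].
by rewrite (Prop_irrelevance a c) (Prop_irrelevance b d).
Qed.

Section ConvergenceBases.
Variables (RR : realType) (V : lmodType (laurent RR[i])).
Local Notation L := (laurent RR[i]).

Lemma usum_usum_cvg (W : V -> Prop) d (e : 'I_d -> V) t s :
  is_basis W e -> usum W t s -> usum_cvg W t s.
Proof.
move=> We ts.
suff [c [cw [tE sE cP]]] : exists (c : nat -> 'I_d -> L) (cw : 'I_d -> L),
    [/\ forall l, t l = \sum_k c l k *: e k, s = \sum_k cw k *: e k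
      & forall k, lsum (c ^~ k) (cw k)].
  exists d, e; split=> //; exists (fun N k => \sum_(l < N) c l k), cw; split=> //.
    move=> N; under eq_bigr => l _ do rewrite tE.
    by rewrite exchange_big; apply: eq_bigr => k _; rewrite scaler_suml.
elim: ts => [|c cs x t' s' Wx ccs _ [c' [cw' [tE sE cP]]]].
  exists (fun _ _ => 0), (fun _ => 0).
  by split=> *; rewrite ?big1 => *; rewrite ?scale0r//; apply: lsum0.
have [b [xE _]] := We.2 _ Wx.
exists (fun l k => c l * b k + c' l k), (fun k => cs * b k + cw' k); split.
- move=> l; rewrite tE xE scaler_sumr -big_split; apply: eq_bigr => k _.
  by rewrite scalerA scalerDl.
- rewrite sE xE scaler_sumr -big_split; apply: eq_bigr => k _.
  by rewrite scalerA scalerDl.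
- move=> k; apply: lsumD => //; rewrite mulrC (_ : (fun l => _) = (fun l => b k * c l)).
    exact: lsumM.
  by apply/funext => l; rewrite mulrC.
Qed.

Lemma usum_cvg_usum (W : V -> Prop) t s : usum_cvg W t s -> usum (fun=> True) t s.
Proof.
move=> [d [e [We [c [cw [tE sE cP]]]]]].
(* [usum_cvg] gives coordinates of the partial sums, so those of the terms are differences. The
   coordinates [c 0] of the empty sum are not known to be zero, hence the correction of the
   limit. *)
have h : usum (fun=> True) (fun l => \sum_k (c l.+1 k - c l k) *: e k) (\sum_k (cw k - c 0%N k) *: e k).
  apply: usum_sum => k _; apply: usum_one => // p.
  have [N0 hN] := cP k p; exists N0 => N /hN.
  rewrite (_ : \sum_(l < N) _ - _ = c N k - cw k)//.
  rewrite -(big_mkord xpredT (fun l => c l.+1 k - c l k)) telescope_sumr//.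
  by ring.
apply: (usum_ext h) => [l|].
  under eq_bigr => k _ do rewrite scalerBl.
  by rewrite sumrB -!tE big_ord_recr /= [LHS]addrC addKr.
under eq_bigr => k _ do rewrite scalerBl.
by rewrite sumrB -sE -tE big_ord0 subr0.
Qed.

End ConvergenceBases.

Section TensorModule.
Variables (RR : realType) (q : qparam RR) (n : nat) (C : cartan_datum n).
Variables (H : realization C) (R : nat).
Local Notation F := (RR[i]).
Local Notation L := (laurent F).
Local Notation lc := (@lconst RR[i]).
Local Notation u := (lu RR[i]).
Local Notation hdual := 'Hom(hsp H, rat^o).
Local Notation all := (fun=> True).
Variables (V1 : lmodType F) (M1 : uops H V1) (V2 : lmodType L) (M2 : uops H V2).
Hypothesis HM1 : is_umodule q idfun M1.
Hypothesis HM2 : is_umodule q lc M2.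
Variables (J1 J2 : eqType).
Variables (eps1 : J1 -> V1) (kap1 : J1 -> {linear V1 -> F^o}) (wt1 : J1 -> hdual).
Variables (eps2 : J2 -> V2) (kap2 : J2 -> {linear V2 -> L^o}) (wt2 : J2 -> hdual).
Hypothesis ek1 : coords eps1 kap1.
Hypothesis ek2 : coords eps2 kap2.
Hypothesis eps1_wt : forall j, wtsp q idfun M1 (wt1 j) (eps1 j).
Hypothesis eps2_wt : forall j, wtsp q lc M2 (wt2 j) (eps2 j).
Local Notation T := (tens (scalext V1) V2).
Local Notation teps := (teps eps1 eps2).
Local Notation tkap := (tkap kap1 kap2).
Let wt (j : J1 * J2) : hdual := wt1 j.1 + wt2 j.2.
Variable S : hdual -> seq (J1 * J2).
Hypothesis S_uniq : forall w, uniq (S w).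
Hypothesis SE : forall w j, (j \in S w) = (wt j == w).
Local Notation tweight := (tweight kap1 kap2 wt).
Local Notation A := (iops M1).
Let HA : is_umodule q lc A := iops_umodule HM1.
Let ek : coords teps tkap := tcoords ek1 ek2.

(** The two clauses on x_{i,m} in the definition of O^R as a single exponent; they agree at m =
    0. *)
Definition xbound (r : nat) (m : int) : int := if 0 <= m then 0 else r%:Z * m.

Hypothesis ux_bound : forall s i m j j',
  vge (xbound R m) (kap2 j' (ux M2 s i m (eps2 j)) : L).
Hypothesis phim_bound : forall i (m : nat) j j',
  vge (- (m%:Z * R%:Z)) (kap2 j' (phi q lc M2 false i m (eps2 j)) : L).
Hypothesis phip_bound : forall i (m : nat) j j',
  vge 0 (kap2 j' (phi q lc M2 true i m (eps2 j)) : L).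

Lemma tkap_tmap (f : {linear scalext V1 -> scalext V1}) (f1 : V1 -> V1)
    (g : {linear V2 -> V2}) j j' : (forall v, f (sext1 v) = sext1 (f1 v)) ->
  tkap j' (tmap f g (teps j)) =
  lc (kap1 j'.1 (f1 (eps1 j.1)) : F) * kap2 j'.2 (g (eps2 j.2)).
Proof.
move=> ff; rewrite tepsE tmap_pure -/(sext1 _) ff tkap_pure mulr1.
by [].
Qed.

Lemma tkap_weight (f1 : V1 -> V1) (g : V2 -> V2) w1 w2 j j' :
  wtsp q idfun M1 w1 (f1 (eps1 j.1)) -> wtsp q lc M2 w2 (g (eps2 j.2)) ->
  wt j' != w1 + w2 ->
  lc (kap1 j'.1 (f1 (eps1 j.1)) : F) * kap2 j'.2 (g (eps2 j.2)) = 0.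
Proof.
move=> fw gw jw.
have [j1|j1] := eqVneq (wt1 j'.1) w1; last first.
  by rewrite (kap_wtsp ek1 eps1_wt fw j1) rmorph0 mul0r.
have [j2|j2] := eqVneq (wt2 j'.2) w2; last first.
  by rewrite (kap_wtsp ek2 eps2_wt gw j2) mulr0.
by move: jw; rewrite /wt j1 j2 eqxx.
Qed.

Lemma tkap_xp_term i r l j j' : tkap j' (xp_term q A M2 i r l (teps j)) =
  u ^ (r + l%:Z) * (lc (kap1 j'.1 (phi q idfun M1 false i l (eps1 j.1)) : F) *
    kap2 j'.2 (ux M2 true i (r + l%:Z) (eps2 j.2))).
Proof.
rewrite /xp_term linearZ /= (tkap_tmap _ _ _ (iops_phi HM1 false i l)).
by [].
Qed.

Lemma tkap_xm_term i r l j j' : tkap j' (xm_term q A M2 i r l (teps j)) =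
  u ^ l%:Z * (lc (kap1 j'.1 (ux M1 false i (r - l%:Z) (eps1 j.1)) : F) *
    kap2 j'.2 (phi q lc M2 true i l (eps2 j.2))).
Proof.
rewrite /xm_term linearZ /= (tkap_tmap _ _ _ (iops_ux M1 false i (r - l%:Z))).
by [].
Qed.

Lemma xp_term_weight i r l j : tweight (wt j + sroot H i) (xp_term q A M2 i r l (teps j)).
Proof.
move=> j' jw; rewrite tkap_xp_term.
rewrite (@tkap_weight _ _ (wt1 j.1) (wt2 j.2 + sroot H i)) ?mulr0//.
- exact: phi_wtsp.
- exact: (ux_wtsp HM2 true i _ (eps2_wt _)).
- by rewrite addrA.
Qed.

Lemma xm_term_weight i r l j : tweight (wt j - sroot H i) (xm_term q A M2 i r l (teps j)).
Proof.
move=> j' jw; rewrite tkap_xm_term.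
rewrite (@tkap_weight _ _ (wt1 j.1 - sroot H i) (wt2 j.2)) ?mulr0//.
- exact: (ux_wtsp HM1 false i _ (eps1_wt _)).
- exact: phi_wtsp.
- by rewrite addrAC.
Qed.

Lemma xp_term_vge i r l j j' :
  vge (r + l%:Z + xbound R (r + l%:Z)) (tkap j' (xp_term q A M2 i r l (teps j)) : L).
Proof.
rewrite tkap_xp_term; apply: vgeM; first exact: vge_luX.
by rewrite -[xbound _ _]add0r; apply: vgeM; [exact: vge_lconst | exact: ux_bound].
Qed.

Lemma xm_term_vge i r l j j' :
  vge l%:Z (tkap j' (xm_term q A M2 i r l (teps j)) : L).
Proof.
rewrite tkap_xm_term -[l%:Z]addr0; apply: vgeM; first by rewrite addr0; apply: vge_luX.
by rewrite -[0]add0r; apply: vgeM; [exact: vge_lconst | exact: phip_bound].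
Qed.

Lemma xp_sum_ex i r : exists2 Xs : {linear T -> T},
    forall v, usum all (fun l => xp_term q A M2 i r l v) (Xs v)
  & forall w v, tweight w v ->
    usum (tweight (w + sroot H i)) (fun l => xp_term q A M2 i r l v) (Xs v).
Proof.
apply: (operator_sum_ex ek1 ek2 S_uniq SE).
- by move=> l j; apply: xp_term_weight.
(* For r + l < 0 the valuation is at least (R + 1)(r + l) >= l - (R + 1)|r|; for r + l >= 0 it is at
   least l - |r|. *)
- move=> j j'; exists ((R.+1)%:Z * (absz r)%:Z) => l; apply: (vgeW _ (@xp_term_vge i r l j j')).
  rewrite /xbound; case: ifP => ?; nia.
Qed.

Lemma xm_sum_ex i r : exists2 Xs : {linear T -> T},
    forall v, usum all (fun l => xm_term q A M2 i r l v) (Xs v)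
  & forall w v, tweight w v ->
    usum (tweight (w - sroot H i)) (fun l => xm_term q A M2 i r l v) (Xs v).
Proof.
apply: (operator_sum_ex ek1 ek2 S_uniq SE).
- by move=> l j; apply: xm_term_weight.
- by move=> j j'; exists 0 => l; apply: (vgeW _ (@xm_term_vge i r l j j')); rewrite subr0.
Qed.

Section Fused.
Variables Sp Sm : 'I_n -> int -> {linear T -> T}.
Hypothesis SpP : forall i r v, usum all (fun l => xp_term q A M2 i r l v) (Sp i r v).
Hypothesis SmP : forall i r v, usum all (fun l => xm_term q A M2 i r l v) (Sm i r v).
Hypothesis SpW : forall i r w v, tweight w v ->
  usum (tweight (w + sroot H i)) (fun l => xp_term q A M2 i r l v) (Sp i r v).
Hypothesis SmW : forall i r w v, tweight w v ->
  usum (tweight (w - sroot H i)) (fun l => xm_term q A M2 i r l v) (Sm i r v).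
Let M : uops H T := fusion A M2 Sp Sm.

Let usum_uniq (t : nat -> T) (s s' : T) := @tens_usum_uniq _ _ _ _ _ _ _ _ _ ek1 ek2 all t s s'.

Lemma fused_umodule : is_umodule q lc M.
Proof. exact: (fusion_umodule HA HM2 usum_uniq SpP SmP). Qed.

Lemma teps_wt j : wtsp q lc M (wt j) (teps j).
Proof.
move=> h; rewrite fusion_kE tepsE tmap_pure -/(sext1 _) iops_uk eps1_wt sext1Z eps2_wt.
by rewrite tpureZl tpureZr scalerA -rmorphM -qpowD add_lfunE.
Qed.

Lemma wtsp_tweight w v : wtsp q lc M w v <-> tweight w v.
Proof.
by split; [apply: (kap_wtsp ek teps_wt) | apply: (wtsp_kap ek teps_wt)].
Qed.

Lemma fused_basis w :
  is_basis (wtsp q lc M w) (fun a : 'I_(size (S w)) => teps (tnth (in_tuple (S w)) a)).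
Proof. exact: (wt_basis ek teps_wt). Qed.

Lemma fused_Delta : is_Delta q M1 M2 M.
Proof.
split.
- move=> i r l v /wtsp_tweight vl.
  apply: (usum_usum_cvg (fused_basis _)).
  have -> : ux M true i r v - tmap (ux A true i r) idfun v = Sp i r v.
    by rewrite fusion_xpE [LHS]addrC addKr.
  by apply: (usumW _ (SpW i r vl)) => x /wtsp_tweight.
- move=> i r l v /wtsp_tweight vl.
  apply: (usum_usum_cvg (fused_basis _)).
  have -> : ux M false i r v - u ^ r *: tmap idfun (ux M2 false i r) v = Sm i r v.
    by rewrite fusion_xmE [LHS]addrC addKr.
  by apply: (usumW _ (SmW i r vl)) => x /wtsp_tweight.
- by move=> s i m v; apply: (fusion_phi HA HM2).
- by [].
Qed.

Lemma xbound_le0 r m : xbound r m <= 0.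
Proof. by rewrite /xbound; case: ifP => ?; nia. Qed.

(** For m < 0 the extreme terms are the term l = 0 of the series of x^+ and the first term of x^-:
    each multiplies u^m by a coefficient in u^(R m) C[[u]]. The first term of x^+ and the series of
    x^- have valuation at least 0. *)
Lemma fused_ux_bound s i m j j' : vge (xbound R.+1 m) (tkap j' (ux M s i m (teps j)) : L).
Proof.
case: s.
  rewrite fusion_xpE linearD; apply: vgeD.
    rewrite (tkap_tmap _ _ _ (iops_ux M1 true i m)) /= (kap_eps ek2).
    apply: (vgeMl (@vge_lconst _ _) (_ : vge 0 _)); last by rewrite addr0 xbound_le0.
    by case: eqP => _; [exact: (vge_lconst 1) | exact: vge0].
  apply: (lsum_vge _ (usum_functional (tkap j') (SpP i m (teps j)))) => l.
  apply: (vgeW _ (@xp_term_vge i m l j j')); rewrite /xbound.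
  by case: ifP => ?; case: ifP => ?; nia.
rewrite fusion_xmE linearD linearZ; apply: vgeD.
  rewrite /= scale_regular (tkap_tmap (f1 := id))//.
  refine (vgeMl (@vge_luX _ _) (vgeM (@vge_lconst _ _) (@ux_bound false i m _ _)) _).
  by rewrite /xbound; case: ifP => ?; nia.
apply: (lsum_vge _ (usum_functional (tkap j') (SmP i m (teps j)))) => l.
by apply: (vgeW _ (@xm_term_vge i m l j j')); apply: le_trans (xbound_le0 _ _) _.
Qed.

Lemma fused_phi_tkap s i m j j' : tkap j' (phi q lc M s i m (teps j)) =
  \sum_(l < m.+1) u ^ (sg s * l%:Z) *
    (lc (kap1 j'.1 (phi q idfun M1 s i (m - l) (eps1 j.1)) : F) *
     kap2 j'.2 (phi q lc M2 s i l (eps2 j.2))).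
Proof.
rewrite (fusion_phi HA HM2) linear_sum; apply: eq_bigr => l _.
by rewrite linearZ /= (tkap_tmap _ _ _ (iops_phi HM1 s i (m - l))).
Qed.

(** The l-th summand has valuation at least - l - l R, and l <= m. *)
Lemma fused_phim_bound i (m : nat) j j' :
  vge (- (m%:Z * R.+1%:Z)) (tkap j' (phi q lc M false i m (teps j)) : L).
Proof.
rewrite fused_phi_tkap; apply: vge_sum => l _.
apply: (vgeMl (@vge_luX _ _) (vgeM (@vge_lconst _ _) (@phim_bound i l _ _))).
by rewrite /sg; have := leq_ord l; nia.
Qed.

Lemma fused_phip_bound i (m : nat) j j' :
  vge 0 (tkap j' (phi q lc M true i m (teps j)) : L).
Proof.
rewrite fused_phi_tkap; apply: vge_sum => l _.
apply: (vgeMl (@vge_luX _ _) (vgeM (@vge_lconst _ _) (@phip_bound i l _ _))).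
by rewrite /sg; lia.
Qed.

Lemma fused_unique (M' : uops H T) :
  is_umodule q lc M' -> is_Delta q M1 M2 M' -> M = M'.
Proof.
move=> HM' HD.
have HM := fused_umodule.
have kE h v : uk M h v = uk M' h v by rewrite (Delta_k HD).
have wE w v : wtsp q lc M w v -> wtsp q lc M' w v by move=> vw h; rewrite -kE vw.
have tail (f g : {linear T -> T}) : (forall j, f (teps j) = g (teps j)) -> f =1 g.
  move=> fg; apply: (eps_span ek) => [|x y Ex Ey|c j]; first by rewrite !linear0.
    by rewrite (linearD f) (linearD g) Ex Ey.
  by rewrite (linearZ_LR f) (linearZ_LR g) fg.
have xE s i r : ux M s i r =1 ux M' s i r.
  case: s; apply: tail => j.
    have /usum_cvg_usum h := Delta_xp HD i r (wE _ _ (teps_wt j)).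
    by rewrite fusion_xpE (usum_uniq (SpP i r (teps j)) h) addrC subrK.
  have /usum_cvg_usum h := Delta_xm HD i r (wE _ _ (teps_wt j)).
  by rewrite fusion_xmE (usum_uniq (SmP i r (teps j)) h) addrC subrK.
have phE s i m v : phi q lc M s i m v = phi q lc M' s i m v.
  by rewrite (Delta_phi HD) (fusion_phi HA HM2).
have hsE s i m v : hser q lc M s i m v = hser q lc M' s i m v.
  elim/ltn_ind: m v => -[//|m] IH v.
  have [h hE] : exists h, forall w, phi q lc M s i 0 w = uk M h w.
    by eexists => w; apply: phi_at0.
  (* In the recursion at m + 1 the last summand is the new coefficient applied to phi_0 = k_h, which
     evaluation at k_{-h} v cancels. The other summands agree by induction. *)
  have := phi_ode HM s i m.+1 (uk M (- h) v); rewrite phE (phi_ode HM').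
  rewrite big_ord_recr [X in _ = X -> _]big_ord_recr /= subnn -!phE !hE.
  rewrite (ukD HM) subrr (uk0 HM).
  rewrite (eq_bigr (fun k : 'I_m.+1 => hser q lc M s i k (phi q lc M s i (m.+1 - k) (uk M (- h) v)) *+ k)).
    by move/addrI/esym/(mulrn_inj_char0 (rmorph_char0 lc)).
  by move=> k _; rewrite -phE IH.
have hE i (m : int) : uh M i m =1 uh M' i m.
  move=> v; have [->|m0] := eqVneq m 0; first by rewrite (uh0 HM) (uh0 HM').
  have := hsE (0 <= m) i (absz m) v; rewrite !hserE ?absz_gt0//.
  rewrite (_ : sg (0 <= m) * (absz m)%:Z = m); last by rewrite /sg; case: ifP => ?; lia.
  move/(scalerI _); apply; rewrite fmorph_eq0 mulf_neq0 ?qval_subV_neq0//.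
  by rewrite intr_eq0 /sg; case: ifP.
rewrite /M; case: M' xE kE hE {HM' HD wE phE hsE} => x' k' h' /= xE kE hE.
congr UOps.
- apply/funext => s; apply/funext => i; apply/funext => r; exact/linear_eq/xE.
- by apply/funext => h; apply/linear_eq/kE.
- by apply/funext => i; apply/funext => m; apply/linear_eq/hE.
Qed.

End Fused.
End TensorModule.

Section LaurentPolynomials.
Variable RR : realType.
Local Notation L := (laurent RR[i]).

Lemma lpolyD (f g : L) : lpoly f -> lpoly g -> lpoly (f + g).
Proof.
move=> [N fN] [N' gN]; exists (Num.max N N') => k; rewrite gt_max => /andP[Nk N'k].
by rewrite coefLD fN// gN// addr0.
Qed.

Lemma lpolyM (f g : L) : lpoly f -> lpoly g -> lpoly (f * g).
Proof.
move=> [N fN] [N' gN]; exists (N + N') => k Nk.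
change (lconv f g k = 0); rewrite /lconv fsbig1// => j _.
have [/fN->|jN] := ltrP N j; first by rewrite mul0r.
by rewrite gN ?mulr0//; lia.
Qed.

Lemma lpoly_lconst (c : RR[i]) : lpoly (lconst c).
Proof. by exists 0 => k; rewrite /= /lconst_fun; case: ltgtP. Qed.

Lemma lpoly_sum (I : Type) (r : seq I) (P : pred I) (f : I -> L) :
  (forall i, P i -> lpoly (f i)) -> lpoly (\sum_(i <- r | P i) f i).
Proof.
by move=> h; apply: (big_ind (@lpoly RR)) => //; [exists 0 | exact: lpolyD].
Qed.

Lemma lpoly_luX (k : int) : lpoly (lu RR[i] ^ k).
Proof.
have pX (f : L) m : lpoly f -> lpoly (f ^+ m).
  by move=> fp; elim: m => [|m IH]; [exact: (lpoly_lconst 1) | rewrite exprS; apply: lpolyM].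
have u1 : lpoly (lu RR[i]).
  by exists 1 => j j1; rewrite /= /lu_fun; case: eqP j1 => // ->; rewrite ltxx.
have uV : lpoly (lu RR[i])^-1.
  by exists 0 => j j0; rewrite coef_luV; case: eqP j0 => // ->.
case: k => k; first exact: pX.
by rewrite NegzE -exprz_inv -exprnP; apply: pX.
Qed.

End LaurentPolynomials.

(** * The l-weight spaces as joint generalized eigenspaces *)

Section LWeights.
Variables (RR : realType) (q : qparam RR) (n : nat) (C : cartan_datum n).
Variables (H : realization C) (K : fieldType) (io : {rmorphism RR[i] -> K}).
Variables (V : lmodType K) (M : uops H V).
Hypothesis HM : is_umodule q io M.
Local Notation hdual := 'Hom(hsp H, rat^o).
Implicit Types (Psi : bool -> 'I_n -> nat -> K).

Definition phi_index := (bool * 'I_n * nat)%type.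
Definition phi_fam (t : phi_index) : {linear V -> V} := phi q io M t.1.1 t.1.2 t.2.
Definition uncurry3 Psi (t : phi_index) : K := Psi t.1.1 t.1.2 t.2.

Lemma phi_famC s t v : phi_fam s (phi_fam t v) = phi_fam t (phi_fam s v).
Proof. exact: phi_comm. Qed.

Lemma lwtsp_geig l Psi v :
  lwtsp q io M l Psi v <-> wtsp q io M l v /\ geig phi_fam (uncurry3 Psi) v.
Proof.
split=> -[vl [p hp]]; split=> //; exists p; first by case=> [[s i] m]; apply: hp.
by move=> s i m; apply: (hp (s, i, m)).
Qed.

Lemma uncurry3_inj Psi Psi' : uncurry3 Psi = uncurry3 Psi' -> Psi = Psi'.
Proof.
move=> E; apply/funext => s; apply/funext => i; apply/funext => m.
exact: (congr1 (fun f => f (s, i, m)) E).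
Qed.

Lemma lwtspD l Psi v w :
  lwtsp q io M l Psi v -> lwtsp q io M l Psi w -> lwtsp q io M l Psi (v + w).
Proof.
move=> /lwtsp_geig[vl gv] /lwtsp_geig[wl gw]; apply/lwtsp_geig; split.
  exact: wtspD.
exact: geigD.
Qed.

Lemma lwtspN l Psi v : lwtsp q io M l Psi v -> lwtsp q io M l Psi (- v).
Proof.
move=> /lwtsp_geig[vl [p gv]]; rewrite -scaleN1r; apply/lwtsp_geig; split.
  exact: wtspZ.
by exists p => t; rewrite iter_linearZ gv scaler0.
Qed.

(** phi_{i,0} acts on a weight space by the scalar required by [psi0], and a nonzero vector has only
    one generalized eigenvalue. *)
Lemma lwtsp_psi0 l Psi v : lwtsp q io M l Psi v -> v != 0 -> psi0 q io l Psi.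
Proof.
move=> [vl [p hp]] v0 s i; apply: contrapT => /eqP ne; move/eqP: v0; apply.
pose c := io (qpow q ((sg s * (csym C i)%:Z)%:~R * l (coroot H i))).
apply: (@shiftop_inj _ _ (phi_fam (s, i, 0%N)) (Psi s i 0%N) c p 1%N) => //.
  exact: hp.
exact: (etrans (congr1 (fun z => z - c *: v) (phi0_wtsp s i vl)) (subrr _)).
Qed.

Lemma lwtsp_indep l d (x : 'I_d -> bool -> 'I_n -> nat -> K) (w : 'I_d -> V) Psi v :
  lwtsp q io M l Psi v -> (forall k, lwtsp q io M l (x k) (w k) /\ x k <> Psi) ->
  v + \sum_k w k = 0 -> v = 0.
Proof.
move=> /lwtsp_geig[_ gv] gw; apply: (geig_indep phi_famC (x := uncurry3 \o x) gv) => k.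
have [/lwtsp_geig[_ gk] ne] := gw k; split=> // E.
by apply: ne; apply: uncurry3_inj.
Qed.

Lemma wtsp_phi_stable l t v : wtsp q io M l v -> wtsp q io M l (phi_fam t v).
Proof. exact: phi_wtsp. Qed.

End LWeights.

Section LWeightDecomposition.
Variables (RR : realType) (q : qparam RR) (n : nat) (C : cartan_datum n).
Variables (H : realization C) (V : lmodType RR[i]) (M : uops H V).
Hypothesis HM : is_umodule q idfun M.

Lemma lweight_decomp l d (e : 'I_d -> V) v : is_basis (wtsp q idfun M l) e ->
  wtsp q idfun M l v ->
  sumclos (fun x => exists2 Psi, is_lweight q M l Psi & lwtsp q idfun M l Psi x) v.
Proof.
move=> le vl.
have Wsum (c : 'I_d -> RR[i]) : wtsp q idfun M l (\sum_a c a *: e a).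
  by apply: wtsp_sum => a _; apply/wtspZ/le.1.
have := geig_decomp le Wsum (phi_famC HM) (wtsp_phi_stable HM (l := l)) vl.
apply: sumclosW => x x0 [xl [Psi gx]].
pose Psi' s i m := Psi (s, i, m).
have xP : lwtsp q idfun M l Psi' x.
  apply/lwtsp_geig; split=> //; rewrite (_ : uncurry3 Psi' = Psi)//.
  by apply/funext => -[[s i] m].
exists Psi' => //; split; last by exists x.
exact: (lwtsp_psi0 xP x0).
Qed.

End LWeightDecomposition.

Section TensorLWeights.
Variables (RR : realType) (q : qparam RR) (n : nat) (C : cartan_datum n).
Variables (H : realization C).
Local Notation F := (RR[i]).
Local Notation L := (laurent F).
Local Notation lc := (@lconst RR[i]).
Local Notation u := (lu RR[i]).
Local Notation hdual := 'Hom(hsp H, rat^o).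
Variables (V1 : lmodType F) (M1 : uops H V1) (V2 : lmodType L) (M2 : uops H V2).
Hypothesis HM1 : is_umodule q idfun M1.
Hypothesis HM2 : is_umodule q lc M2.
Local Notation T := (tens (scalext V1) V2).
Variable M : uops H T.
Hypothesis HM : is_umodule q lc M.
Hypothesis HD : is_Delta q M1 M2 M.
Local Notation A := (iops M1).
Let HA : is_umodule q lc A := iops_umodule HM1.

Definition tensor_lweight (Psi1 : bool -> 'I_n -> nat -> F) (Psi2 : bool -> 'I_n -> nat -> L)
    (s : bool) (i : 'I_n) (m : nat) : L :=
  \sum_(k < m.+1) lc (Psi1 s i k) * Psi2 s i (m - k)%N * u ^ (sg s * (m - k)%N%:Z).

Lemma tensor_lweight_Plu (l1 l2 : hdual) Psi1 Psi2 :
  psi0 q idfun l1 Psi1 -> Plu q l2 Psi2 -> Plu q (l1 + l2) (tensor_lweight Psi1 Psi2).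
Proof.
move=> p1 [p2 p20]; split=> [s i m|s i].
  apply: lpoly_sum => k _; apply: lpolyM; last exact: lpoly_luX.
  by apply: lpolyM; [exact: lpoly_lconst | exact: p2].
rewrite /tensor_lweight big_ord1 subnn mulr0 expr0z mulr1 p1 p20 -rmorphM -qpowD.
by rewrite add_lfunE mulrDr.
Qed.

Lemma iter_tmap (f : {linear scalext V1 -> scalext V1}) (g : {linear V2 -> V2})
    (h : {linear T -> T}) c p x y : (forall v, h v = c *: tmap f g v) ->
  iter p h (tpure x y) = c ^+ p *: tpure (iter p f x) (iter p g y).
Proof.
move=> hE; elim: p => [|p IH]; first by rewrite scale1r.
by rewrite !iterS IH (linearZ_LR h) hE tmap_pure !scalerA exprSr.
Qed.

Lemma sext1_shift_nil s i m c p x :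
  iter p (shiftop (phi q idfun M1 s i m) c) x = 0 ->
  iter p (shiftop (phi q lc A s i m) (lc c)) (sext1 x) = 0.
Proof.
move=> xp.
have -> : iter p (shiftop (phi q lc A s i m) (lc c)) (sext1 x) =
    sext1 (iter p (shiftop (phi q idfun M1 s i m) c) x).
  elim: p {xp} => // p IH.
  rewrite !iterS IH; move: (iter _ _ _) => y.
  by rewrite !shiftopE /= (iops_phi HM1) -sext1Z -raddfB.
by rewrite xp raddf0.
Qed.

Lemma tensor_phi_nil s i m Psi1 Psi2 x1 x2 :
  (forall m, exists p, iter p (shiftop (phi q idfun M1 s i m) (Psi1 s i m)) x1 = 0) ->
  (forall m, exists p, iter p (shiftop (phi q lc M2 s i m) (Psi2 s i m)) x2 = 0) ->
  exists p, iter p (shiftop (phi q lc M s i m) (tensor_lweight Psi1 Psi2 s i m))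
    (tpure (sext1 x1) x2) = 0.
Proof.
move=> n1 n2.
pose c1 l := lc (Psi1 s i (m - l)%N); pose c2 l := Psi2 s i l.
pose ul (l : nat) := u ^ (sg s * l%:Z).
(* With f = phi_{m-l} on i(V1) and g = phi_l on V2, f (x) g - c1 c2 = (f - c1) (x) g + c1 (1 (x) (g
   - c2)). Each summand is nilpotent on the vector because one of its factors is, and everything
   commutes. *)
pose h1 l : {linear T -> T} := ul l \*: tmap (shiftop (phi q lc A s i (m - l)) (c1 l)) (phi q lc M2 s i l).
pose h2 l : {linear T -> T} := (ul l * c1 l) \*: tmap idfun (shiftop (phi q lc M2 s i l) (c2 l)).
pose h l : {linear T -> T} := h1 l \+ h2 l.
have tC (f f' : {linear scalext V1 -> scalext V1}) (g g' : {linear V2 -> V2}) v :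
    (forall x, f (f' x) = f' (f x)) -> (forall y, g (g' y) = g' (g y)) ->
    tmap f g (tmap f' g' v) = tmap f' g' (tmap f g v).
  by move=> ff gg; tens_pure v => x y; rewrite !tmap_pure ff gg.
pose X l : {linear T -> T} := tmap (phi q lc A s i (m - l)) (phi q lc M2 s i l).
have hE l v : h l v = ul l *: shiftop (X l) (c1 l * c2 l) v.
  have -> : h l v = ul l *: tmap (shiftop (phi q lc A s i (m - l)) (c1 l)) (phi q lc M2 s i l) v +
      (ul l * c1 l) *: tmap idfun (shiftop (phi q lc M2 s i l) (c2 l)) v by [].
  rewrite shiftopE /X /=; tens_pure v => x y; rewrite !tmap_pure !shiftopE.
  rewrite tpureBl tpureBr !tpureZl !tpureZr !scalerBr !scalerA.
  by rewrite addrA mulrA subrK.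
have h12 l v : h1 l (h2 l v) = h2 l (h1 l v).
  rewrite /h1 /h2 /= !linearZ /= scaler_swap; congr (_ *: (_ *: _)).
  by apply: tC => // y; apply/esym/shiftop_comm.
have hC k l v : h k (h l v) = h l (h k v).
  rewrite (hE k (h l v)) (hE l (h k v)) (hE l v) (hE k v).
  rewrite (linearZ_LR (shiftop (X k) _)) (linearZ_LR (shiftop (X l) _)) scaler_swap.
  congr (_ *: (_ *: _)).
  have XC w : X k (X l w) = X l (X k w).
    by apply: tC => x; [exact: (phi_comm HA) | exact: (phi_comm HM2)].
  by apply: shiftop_comm => w; apply/esym/shiftop_comm => w'; rewrite XC.
have hn l : exists p, iter p (h l) (tpure (sext1 x1) x2) = 0.
  have [p hp] := n1 (m - l)%N; have [p' hp'] := n2 l; exists (p + p')%N.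
  apply: (@iter_add_nil _ _ (h1 l) (h2 l)) => //.
  - rewrite (@iter_tmap _ _ (h1 l) (ul l) p _ _ (fun=> erefl)).
    by rewrite sext1_shift_nil// tpure0l scaler0.
  - rewrite (@iter_tmap _ _ (h2 l) (ul l * c1 l) p' _ _ (fun=> erefl)).
    by rewrite hp' tpure0r scaler0.
have [p hp] := @iter_sum_nil _ _ h m.+1 _ hC hn; exists p.
rewrite -[RHS]hp; apply: eq_iter => v; rewrite shiftopE [X in X - _](Delta_phi HD).
rewrite /tensor_lweight (sum_rev m (fun k j => lc (Psi1 s i k) * Psi2 s i j * u ^ (sg s * j%:Z))).
rewrite scaler_suml -sumrB; apply: eq_bigr => l _.
by rewrite hE shiftopE scalerBr scalerA [_ * (c1 _ * _)]mulrC.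
Qed.

Lemma tensor_lwtsp (l1 l2 : hdual) d (e : 'I_d -> T) Psi1 Psi2 x1 x2 :
  is_basis (wtsp q lc M (l1 + l2)) e ->
  lwtsp q idfun M1 l1 Psi1 x1 -> lwtsp q lc M2 l2 Psi2 x2 ->
  lwtsp q lc M (l1 + l2) (tensor_lweight Psi1 Psi2) (tpure (sext1 x1) x2).
Proof.
move=> le [w1 [p1 n1]] [w2 [p2 n2]].
have w12 : wtsp q lc M (l1 + l2) (tpure (sext1 x1) x2).
  move=> h; rewrite (Delta_k HD) tmap_pure iops_uk w1 sext1Z w2.
  by rewrite tpureZl tpureZr scalerA -rmorphM -qpowD add_lfunE.
(* The exponents available so far depend on s, i and m; [nil_bound] replaces them all by the
   dimension d of the weight space. *)
split=> //; exists d => s i m.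
have [p hp] := @tensor_phi_nil s i m Psi1 Psi2 x1 x2
  (fun m => ex_intro _ p1 (n1 s i m)) (fun m => ex_intro _ p2 (n2 s i m)).
pose f := shiftop (phi q lc M s i m) (tensor_lweight Psi1 Psi2 s i m).
have fW v : wtsp q lc M (l1 + l2) v -> wtsp q lc M (l1 + l2) (f v).
  move=> wv; rewrite /f shiftopE -scaleNr; apply: wtspD; last exact: wtspZ.
  exact: phi_wtsp.
exact: (nil_bound le fW w12 hp).
Qed.

Lemma tensor_decomp (l1 l2 : hdual) d1 (e1 : 'I_d1 -> V1) d (e : 'I_d -> T) a b :
  is_basis (wtsp q idfun M1 l1) e1 -> is_basis (wtsp q lc M (l1 + l2)) e ->
  wtsp q idfun M1 l1 a ->
  sumclos (fun x => exists2 Psi, Plu q l2 Psi & lwtsp q lc M2 l2 Psi x) b ->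
  sumclos (fun x => exists Psi1 Psi2, [/\ is_lweight q M1 l1 Psi1, is_luweight q M2 l2 Psi2
     & lwtsp q lc M (l1 + l2) (tensor_lweight Psi1 Psi2) x]) (tpure (sext1 a) b).
Proof.
move=> le1 le a1 bd.
have bd' : sumclos (fun x => exists2 Psi, is_luweight q M2 l2 Psi & lwtsp q lc M2 l2 Psi x) b.
  apply: sumclosW bd => x x0 [Psi Pp xP]; exists Psi => //; split=> //; by exists x.
elim: (lweight_decomp HM1 le1 a1) => [|x v [Psi1 P1 xP1] _ IH].
  by rewrite raddf0 tpure0l; apply: sumclos_nil.
rewrite raddfD /= tpureDl; apply: sumclosD => //.
elim: bd' => [|y w [Psi2 P2 yP2] _ IH2]; first by rewrite tpure0r; apply: sumclos_nil.
rewrite tpureDr; apply: sumclos_cons => //; exists Psi1, Psi2; split=> //.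
exact: tensor_lwtsp le xP1 yP2.
Qed.

End TensorLWeights.

(** * Finiteness of the weight spaces of the tensor product *)

Section ConeSplittings.
Variables (n : nat) (C : cartan_datum n) (H : realization C).
Local Notation hdual := 'Hom(hsp H, rat^o).

Lemma sroot_sum_inj (c c' : 'I_n -> nat) :
  \sum_i sroot H i *+ c i = \sum_i sroot H i *+ c' i -> c =1 c'.
Proof.
move=> cc i; have /freeP fr := sroot_free H.
have /fr/(_ i)/eqP : \sum_i ((c i)%:R - (c' i)%:R) *: [tuple sroot H i | i < n]`_i = 0.
  rewrite -[RHS](subrr (\sum_i sroot H i *+ c i)) {2}cc -sumrB; apply: eq_bigr => j _.
  by rewrite -tnth_nth tnth_mktuple scalerBl !scaler_nat.
by rewrite subr_eq0 eqr_nat => /eqP.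
Qed.

(** The coefficients of l1 - w1 and l2 - w2 on the simple roots add up to those of l1 + l2 - w,
    which are unique since the simple roots are free. Those of l1 - w1 are thus bounded, and w1
    ranges over a finite set. *)
Lemma cone_splittings (l1 l2 w : hdual) : exists s : seq hdual, forall w1 w2,
  cone l1 w1 -> cone l2 w2 -> w1 + w2 = w -> w1 \in s.
Proof.
have [[N NE]|nN] := pselect (exists N : 'I_n -> nat, l1 + l2 - w = \sum_i sroot H i *+ N i).
  (* A common bound for all the N i, so that the possible coefficients form a finite type of
     functions. *)
  pose B := (\sum_i N i)%N.
  exists [seq l1 - \sum_i sroot H i *+ (f i : nat) | f : {ffun 'I_n -> 'I_B.+1}].
  move=> w1 w2 [c cE] [c' cE'] ww.
  have cN i : (c i + c' i)%N = N i.
    apply: (sroot_sum_inj (c := fun i => c i + c' i)%N); rewrite -NE -ww opprD addrACA cE cE'.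
    by rewrite -big_split; apply: eq_bigr => j _; rewrite mulrnDr.
  have cB i : (c i < B.+1)%N.
    by rewrite ltnS /B (bigD1 i)//= -cN -addnA leq_addr.
  apply/mapP; exists [ffun i => Ordinal (cB i)]; first by rewrite mem_enum.
  rewrite -[w1](subKr l1) cE; congr (_ - _).
  by apply: eq_bigr => i _; rewrite ffunE.
exists [::] => w1 w2 [c cE] [c' cE'] ww; case: nN; exists (fun i => c i + c' i)%N.
rewrite -ww opprD addrACA cE cE' -big_split.
by apply: eq_bigr => j _; rewrite mulrnDr.
Qed.

(** A weight w arises from finitely many pairs (w1, w - w1), hence from finitely many pairs of basis
    vectors. The lists [S w] will index the bases of the weight spaces of the tensor product. *)
Lemma weight_fibers (P1 P2 : hdual -> Prop) (ls1 ls2 : seq hdual) (d1 d2 : hdual -> nat) :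
  (forall w, P1 w -> exists2 l, l \in ls1 & cone l w) ->
  (forall w, P2 w -> exists2 l, l \in ls2 & cone l w) ->
  (forall j : windex d1, P1 (tag j)) -> (forall j : windex d2, P2 (tag j)) ->
  exists S : hdual -> seq (windex d1 * windex d2),
    (forall w, uniq (S w)) /\ forall w j, (j \in S w) = (tag j.1 + tag j.2 == w).
Proof.
move=> c1 c2 j1P j2P.
suff /choice[S SP] : forall w, exists s : seq (windex d1 * windex d2),
    uniq s /\ forall j, (j \in s) = (tag j.1 + tag j.2 == w).
  by exists S; split=> w; [exact: (SP w).1 | exact: (SP w).2].
move=> w.
have /choice[f fP] : forall ll : hdual * hdual, exists s : seq hdual, forall w1 w2,
    cone ll.1 w1 -> cone ll.2 w2 -> w1 + w2 = w -> w1 \in s.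
  by move=> ll; apply: cone_splittings.
pose ws := flatten [seq f ll | ll <- [seq (l1, l2) | l1 <- ls1, l2 <- ls2]].
pose S := flatten [seq [seq (j1, j2) | j1 <- wfiber d1 w1, j2 <- wfiber d2 (w - w1)] | w1 <- ws].
exists (undup S); split=> [|[j1 j2]]; first exact: undup_uniq.
rewrite mem_undup; apply/flatten_mapP/eqP => [[w1 _ /allpairsP[[a b] /= [aw bw [-> ->]]]]|jw].
  by move: aw bw; rewrite !wfiberE => /eqP -> /eqP ->; rewrite addrC subrK.
have [l1 l1s l1c] := c1 _ (j1P j1); have [l2 l2s l2c] := c2 _ (j2P j2).
exists (tag j1).
  apply/flatten_mapP; exists (l1, l2); last exact: (fP (l1, l2) _ (tag j2)).
  by apply/allpairsP; exists (l1, l2).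
apply/allpairsP; exists (j1, j2); split=> //=; rewrite wfiberE ?eqxx//.
by rewrite -jw addrC addKr.
Qed.

End ConeSplittings.

Lemma coefs_in_kap (RR : realType) (V : lmodType (laurent RR[i])) (J : eqType)
    (eps : J -> V) (kap : J -> {linear V -> (laurent RR[i])^o}) (s : seq J)
    (X : set (laurent RR[i])) v :
  coords eps kap -> uniq s -> (forall j, j \notin s -> kap j v = 0) ->
  (forall j, X (kap j v)) ->
  coefs_in (fun a : 'I_(size s) => eps (tnth (in_tuple s) a)) X v.
Proof.
move=> ek us vs vX; exists (fun a => kap (tnth (in_tuple s) a) v) => //.
by rewrite {1}(coords_sumS ek us vs) big_tnth.
Qed.

Lemma kap_coefs_in (RR : realType) n (C : cartan_datum n) (H : realization C)
   (V : lmodType (laurent RR[i])) (d : 'Hom(hsp H, rat^o) -> nat)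
   (e : forall w, 'I_(d w) -> V) kap w p v j :
  coords (wvec e) kap -> coefs_in (@e w) (upow p) v -> vge p (kap j v : laurent RR[i]).
Proof.
move=> ek [c -> cp]; rewrite linear_sum; apply: vge_sum => a _.
have kE : kap j (e w a) = (j == Tagged (fun w => 'I_(d w)) a)%:R by rewrite -(kap_eps ek).
rewrite linearZ /= kE scale_regular; case: eqP => _; rewrite ?mulr1 ?mulr0 //.
exact: cp.
Qed.

Theorem theorem6p7 (RR : realType) (q : qparam RR) (n : nat)
    (C : cartan_datum n) (H : realization C) (R : nat)
    (V1 : lmodType RR[i]) (M1 : uops H V1)
    (V2 : lmodType (laurent RR[i])) (M2 : uops H V2) :
  catO q M1 -> catOR q R M2 ->
  exists M : uops H (tens (scalext V1) V2),
    [/\ unique (fun M' => is_umodule q (@lconst RR[i]) M' /\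
                          is_Delta q M1 M2 M') M,
        catOR q R.+1 M
      & forall l Psi, is_luweight q M l Psi ->
          exists l1 Psi1 l2 Psi2,
            [/\ is_lweight q M1 l1 Psi1,
                is_luweight q M2 l2 Psi2,
                l = l1 + l2
              & forall s i m,
                  Psi s i m =
                  \sum_(k < m.+1)
                    lconst (Psi1 s i k) * Psi2 s i (m - k)%N
                      * lu RR[i] ^ (sg s * (m - k)%N%:Z)]].
Proof.
move=> [HM1 ds1 fin1 [ls1 cone1]] [[[HM2 ds2 fin2 [ls2 cone2]] luds2] [d2 [e2 [e2b e2x e2m e2p]]]].
(* Any bases of the weight spaces of V1 will do; those of V2 are imposed by the bounds of O^R. *)
have [d1 [e1 e1b]] : exists (d1 : 'Hom(hsp H, rat^o) -> nat) (e1 : forall w, 'I_(d1 w) -> V1),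
    forall w, is_basis (wtsp q idfun M1 w) (@e1 w).
  have /choice[f fP] : forall w, exists de : {d : nat & 'I_d -> V1},
      is_basis (wtsp q idfun M1 w) (tagged de).
    by move=> w; have [d [e eb]] := fin1 w; exists (Tagged (fun d => 'I_d -> V1) e).
  by exists (fun w => tag (f w)), (fun w => tagged (f w)).
have [kap1 ek1] := wvec_coords e1b ds1.
have [kap2 ek2] := wvec_coords e2b ds2.
have ew1 := wvec_wt e1b; have ew2 := wvec_wt e2b.
have [S [S_uniq SE]] := @weight_fibers n C H (is_weight q idfun M1) (is_weight q (@lconst RR[i]) M2)
  ls1 ls2 d1 d2 cone1 cone2 (wt_is_weight ek1 ew1) (wt_is_weight ek2 ew2).
have uxb s i m j j' : vge (xbound R m) (kap2 j' (ux M2 s i m (wvec e2 j)) : laurent RR[i]).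
  have [h0 h1] := e2x (tag j) i m (tagged j); rewrite /xbound; case: ifP => m0.
    have [hp hm] := h0 m0.
    by case: s; [apply: (kap_coefs_in _ ek2 hp) | apply: (kap_coefs_in _ ek2 hm)].
  have /h1[hp hm] : m <= 0 by move: m0; lia.
  by case: s; [apply: (kap_coefs_in _ ek2 hp) | apply: (kap_coefs_in _ ek2 hm)].
have phmb i (m : nat) j j' :
    vge (- (m%:Z * R%:Z)) (kap2 j' (phi q (@lconst RR[i]) M2 false i m (wvec e2 j)) : laurent RR[i]).
  exact: (kap_coefs_in _ ek2 (e2m _ _ _ _)).
have phpb i (m : nat) j j' :
    vge 0 (kap2 j' (phi q (@lconst RR[i]) M2 true i m (wvec e2 j)) : laurent RR[i]).
  exact: (kap_coefs_in _ ek2 (e2p _ _ _ _)).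
pose T := tens (scalext V1) V2.
have Spx := xp_sum_ex HM1 HM2 ek1 ek2 ew1 ew2 S_uniq SE uxb.
have Smx := xm_sum_ex HM1 HM2 ek1 ek2 ew1 ew2 S_uniq SE phpb.
have /choice[Sp SpP] : forall ir : 'I_n * int, exists Xs : {linear T -> T},
   (forall v, usum (fun=> True) (fun l => xp_term q (iops M1) M2 ir.1 ir.2 l v) (Xs v)) /\
   (forall w v, tweight kap1 kap2 (fun j => tag j.1 + tag j.2) w v ->
      usum (tweight kap1 kap2 (fun j => tag j.1 + tag j.2) (w + sroot H ir.1))
        (fun l => xp_term q (iops M1) M2 ir.1 ir.2 l v) (Xs v)).
  by move=> [i r]; have [Xs h1 h2] := Spx i r; exists Xs.
have /choice[Sm SmP] : forall ir : 'I_n * int, exists Xs : {linear T -> T},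
   (forall v, usum (fun=> True) (fun l => xm_term q (iops M1) M2 ir.1 ir.2 l v) (Xs v)) /\
   (forall w v, tweight kap1 kap2 (fun j => tag j.1 + tag j.2) w v ->
      usum (tweight kap1 kap2 (fun j => tag j.1 + tag j.2) (w - sroot H ir.1))
        (fun l => xm_term q (iops M1) M2 ir.1 ir.2 l v) (Xs v)).
  by move=> [i r]; have [Xs h1 h2] := Smx i r; exists Xs.
pose M := fusion (iops M1) M2 (fun i r => Sp (i, r)) (fun i r => Sm (i, r)).
have ek := tcoords ek1 ek2.
have SpP1 i r := (SpP (i, r)).1; have SpP2 i r := (SpP (i, r)).2.
have SmP1 i r := (SmP (i, r)).1; have SmP2 i r := (SmP (i, r)).2.
have HM : is_umodule q (@lconst RR[i]) M := fused_umodule HM1 HM2 ek1 ek2 SpP1 SmP1.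
have HD : is_Delta q M1 M2 M.
  exact: (fused_Delta HM1 HM2 ek1 ek2 ew1 ew2 S_uniq SE SpP2 SmP2).
have Mb w := fused_basis ek1 ek2 ew1 ew2 S_uniq SE (fun i r => Sp (i, r)) (fun i r => Sm (i, r)) w.
have Mw j := teps_wt ew1 ew2 (fun i r => Sp (i, r)) (fun i r => Sm (i, r)) j.
pose Mwts := wtsp q (@lconst RR[i]) M.
(* Each basis vector of the tensor product is a product of weight vectors: the second is split by
   the definition of the category, the first because C is algebraically closed. *)
have dec l v : Mwts l v -> sumclos (fun x => exists l1 Psi1 l2 Psi2,
    [/\ is_lweight q M1 l1 Psi1, is_luweight q M2 l2 Psi2, l = l1 + l2
      & lwtsp q (@lconst RR[i]) M l (tensor_lweight Psi1 Psi2) x]) v.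
  move=> vl; rewrite (wtsp_expand ek Mw (S_uniq l) (SE l) vl) big_seq.
  apply: sumclos_sum => j; rewrite SE => /eqP <-.
  rewrite -tpureZr.
  have [_ /(_ _ (wtspZ (tkap kap1 kap2 j v) (ew2 j.2)))[m [x [w [_ xw wE]]]] _] := luds2 (tag j.2).
  apply: (sumclosW _ (tensor_decomp HM1 HM2 HM HD (e1b (tag j.1)) (Mb _) (ew1 j.1) _)).
    move=> y _ [Psi1 [Psi2 [h1 h2 h3]]]; exists (tag j.1), Psi1, (tag j.2), Psi2.
    by split; [exact: h1 | exact: h2 | exact: erefl | exact: h3].
  rewrite wE; apply: sumclos_sum => k _; apply: sumclos_one.
  by exists (x k); [exact: (xw k).1 | exact: (xw k).2].
exists M; split.
- split=> // M' [HM' HD'].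
  exact: (fused_unique HM1 HM2 ek1 ek2 ew1 ew2 SpP1 SmP1 HM' HD').
- split.
    split.
      split.
      + exact: HM.
      + exact: (wt_dsum ek Mw).
      + by move=> w; exists (size (S w)); eexists; apply: Mb.
      + exists [seq l1 + l2 | l1 <- ls1, l2 <- ls2] => w /(is_weight_wt ek Mw)[j <-].
        have [l1 l1s [c1 c1E]] := cone1 _ (wt_is_weight ek1 ew1 j.1).
        have [l2 l2s [c2 c2E]] := cone2 _ (wt_is_weight ek2 ew2 j.2).
        exists (l1 + l2); first by apply/allpairsP; exists (l1, l2).
        exists (fun i => c1 i + c2 i)%N; rewrite opprD addrACA c1E c2E -big_split.
        by apply: eq_bigr => i _; rewrite mulrnDr.
    move=> l; split.
    + by move=> Psi _ v [].
    + move=> v vl; apply: sumclos_repr.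
        by move=> Psi x y; apply: lwtspD.
      apply: (sumclosW _ (dec l v vl)) => x _ [l1 [Psi1 [l2 [Psi2 [h1 h2 -> h4]]]]].
      exists (tensor_lweight Psi1 Psi2) => //.
      exact: (tensor_lweight_Plu h1.1 h2.1).
    (* [lwtsp_indep] sets one vector apart: here the one of index k, the others being enumerated by
       [lift k]. *)
    + move=> d x w xinj xw sum0 k.
      case: d x w xinj xw sum0 k => [|d] x w xinj xw sum0 k; first by case: k.
      apply: (lwtsp_indep HM (x := fun j => x (lift k j)) (w := fun j => w (lift k j)) (xw k).2).
        move=> j; split; first exact: (xw _).2.
        by move/xinj/eqP; rewrite eq_sym (negbTE (neq_lift _ _)).
      by rewrite -[RHS]sum0 (bigD1_ord k).
  have cin w p v : Mwts w v -> (forall j, vge p (tkap kap1 kap2 j v : laurent RR[i])) ->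
      coefs_in (fun a : 'I_(size (S w)) => teps (wvec e1) (wvec e2) (tnth (in_tuple (S w)) a)) (upow p) v.
    move=> vw vp; apply: (coefs_in_kap ek (S_uniq w)) => // j; rewrite SE.
    exact: (kap_wtsp ek Mw vw).
  exists (fun l => size (S l)), (fun l a => teps (wvec e1) (wvec e2) (tnth (in_tuple (S l)) a)); split.
  + exact: Mb.
  + move=> l i m a.
    have ub s j : vge (xbound R.+1 m) (tkap kap1 kap2 j
        (ux M s i m (teps (wvec e1) (wvec e2) (tnth (in_tuple (S l)) a))) : laurent RR[i]).
      exact: (fused_ux_bound HM1 _ _ ek2 uxb phpb SpP1 SmP1 s i).
    have tp := ux_wtsp HM true i m ((Mb l).1 a); have tm := ux_wtsp HM false i m ((Mb l).1 a).
    split=> m0.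
      by split; apply: cin => // j; [have := ub true j | have := ub false j]; rewrite /xbound m0.
    have mE : xbound R.+1 m = R.+1%:Z * m by rewrite /xbound; case: ifP => ?; nia.
    by rewrite -mE; split; apply: cin => // j; apply: ub.
  + move=> l i m a; apply: cin; first exact: (phi_wtsp HM _ _ _ ((Mb l).1 a)).
    by move=> j; apply: (fused_phim_bound HM1 HM2 _ _ phmb).
  + move=> l i m a; apply: cin; first exact: (phi_wtsp HM _ _ _ ((Mb l).1 a)).
    by move=> j; apply: (fused_phip_bound HM1 HM2 _ _ phpb).
- move=> l Psi [Pl [v vP v0]].
  have [|d [x [w [xinj xw vE]]]] := @sumclos_repr _ _
      (fun Psi => exists l1 Psi1 l2 Psi2, [/\ is_lweight q M1 l1 Psi1, is_luweight q M2 l2 Psi2,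
         l = l1 + l2 & Psi = tensor_lweight Psi1 Psi2])
      (lwtsp q (@lconst RR[i]) M l) v (fun Psi x y => @lwtspD _ _ _ _ _ _ _ _ _ l Psi x y).
    apply: (sumclosW _ (dec l v vP.1)) => y _ [l1 [Psi1 [l2 [Psi2 [h1 h2 h3 h4]]]]].
    by exists (tensor_lweight Psi1 Psi2) => //; exists l1, Psi1, l2, Psi2.
  (* If Psi is none of the systems occurring in the decomposition of v, then - v and the components
     of v sum to zero, and independence forces v = 0. *)
  have [[k xk]|nk] := pselect (exists k, x k = Psi).
    have [[l1 [Psi1 [l2 [Psi2 [h1 h2 -> h4]]]]] _] := xw k.
    by exists l1, Psi1, l2, Psi2; split=> // s i m; rewrite -xk h4.
  move/eqP: v0; case; apply: oppr_inj; rewrite oppr0.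
  apply: (lwtsp_indep HM (lwtspN vP) (x := x) (w := w)); last by rewrite vE addNr.
  by move=> k; split; [exact: (xw k).2 | move=> xk; apply: nk; exists k].
Qed.
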